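(* Let $\mathbb{S}^2\times\mathbb{R}$ carry the Riemannian product metric $g=g_{\mathbb{S}^2}+dy^2$, where $g_{\mathbb{S}^2}$ is the standard metric of the unit sphere $\mathbb{S}^2\subset\mathbb{R}^3$ and $y$ is the coordinate of $\mathbb{R}$. Let $dV_{\mathbb{S}^2}$ be the area form of $\mathbb{S}^2$ (for a fixed orientation), pulled back to $\mathbb{S}^2\times\mathbb{R}$. Then $\mathbb{S}^2\times\mathbb{R}$ admits, up to isomorphism, only one type of homogeneous structure tensors, namely $$T^{\lambda}=\lambda\,(dy\otimes dV_{\mathbb{S}^2})\qquad(\lambda\ge 0).$$ That is, each $T^\lambda$ with $\lambda\ge 0$ is a homogeneous structure tensor on $(\mathbb{S}^2\times\mathbb{R},g)$, and every homogeneous structure tensor on $(\mathbb{S}^2\times\mathbb{R},g)$ is isomorphic to $T^\lambda$ for exactly one $\lambda\ge 0$. Moreover, for each $\lambda\ge 0$ the coset space representation corresponding to $T^\lambda$ is $\mathbb{S}^2\times\mathbb{R}=(\mathrm{SO}(3)\times\mathbb{R})/\mathrm{SO}(2)$, where $\mathrm{SO}(3)$ acts on $\mathbb{S}^2$ by rotations and $\mathbb{R}$ acts on the second factor by translations.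
   Context: **Homogeneous structure tensor.** Let $(M,g)$ be a Riemannian manifold with Levi-Civita connection $\nabla$ and curvature tensor field $R$. A homogeneous (Riemannian) structure tensor on $(M,g)$ is a tensor field $T$ of type $(1,2)$ on $M$, written $(X,Y)\mapsto T_XY$, such that the affine connection $\tilde\nabla=\nabla-T$ (i.e. $\tilde\nabla_XY=\nabla_XY-T_XY$) satisfies $\tilde\nabla g=0$, $\tilde\nabla R=0$ and $\tilde\nabla T=0$. The covariant tensor field $(X,Y,Z)\mapsto g(T_XY,Z)$ is denoted by the same letter $T$; so $T=\omega\otimes\beta$ with a 1-form $\omega$ and a 2-form $\beta$ means $g(T_XY,Z)=\omega(X)\beta(Y,Z)$. An area form takes the value $1$ on positively oriented orthonormal pairs tangent to the surface. **Isomorphism.** Homogeneous structure tensors $T$ on $(M,g)$ and $T'$ on $(M',g')$ are isomorphic if there is an isometry $\phi:(M,g)\to(M',g')$ such that $\phi_*(T_XY)=T'_{\phi_*X}\phi_*Y$ for all vector fields $X,Y$ on $M$. **Corresponding coset space representation.** Let $G$ be a connected Lie group acting transitively by isometries on $M$, let $H$ be the isotropy group at a point $o\in M$, so $M=G/H$, and let $\mathfrak g,\mathfrak h$ be the Lie algebras of $G$ and $H$. A reductive decomposition is a direct sum decomposition $\mathfrak g=\mathfrak m\oplus\mathfrak h$ with $\mathfrak m$ an $\mathrm{Ad}(H)$-invariant linear subspace. For $X\in\mathfrak g$ let $X^*$ be the vector field on $M$ given by $X^*_p=\frac{d}{dt}\exp(tX)\cdot p\,|_{t=0}$; the map $\tau:\mathfrak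 m\to T_oM$, $\tau(X)=X^*_o$, is an isomorphism. The reductive decomposition determines a homogeneous structure tensor $T$, namely the $G$-invariant tensor field whose value at $o$ is given, for $u=\tau(X)$, $v=\tau(Y)$, $w=\tau(Z)$ with $X,Y,Z\in\mathfrak m$, by $$2g(T_uv,w)_o=g([X,Y]^*,Z^* )_o-g([Y,Z]^*,X^* )_o+g([Z,X]^*,Y^* )_o .$$ Saying that the coset space representation corresponding to $T$ is $M=G/H$ means that $T$ is determined in this way by some reductive decomposition of $\mathfrak g$ with respect to $\mathfrak h$. *)

(* Defs.v *)
From HB Require Import structures.
From mathcomp Require Import all_boot all_order all_algebra.
From mathcomp Require Import ring.
From mathcomp Require Import all_classical all_reals all_analysis.

Set Implicit Arguments.
Unset Strict Implicit.
Unset Printing Implicit Defensive.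

Import Order.TTheory GRing.Theory Num.Theory.
Import numFieldNormedType.Exports.

Local Open Scope classical_set_scope.
Local Open Scope ring_scope.

Section Smoothness.
Context {R : realType} {V W : normedModType R}.

Fixpoint Ck (k : nat) (U : set V) (f : V -> W) : Prop :=
  match k with
  | 0%N => forall x, U x -> {for x, continuous f}
  | k'.+1 => (forall x, U x -> differentiable f x) /\
             (forall v : V, Ck k' U ('D_v f))
  end.

Definition smooth_on (U : set V) (f : V -> W) : Prop := forall k, Ck k U f.

End Smoothness.

(* S^2 x R is realized as the submanifold |x| = 1 of R^3 x R, with points and
   vectors written as pairs. Maps, fields and tensors on it are represented by
   functions on the ambient space (resp. on ambient vectors); their values at
   points off the submanifold, or on non-tangent vectors, carry no meaning. *)
Notation ambient R := ('cV[R]_3 * R^o)%type.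

Section Cylinder.
Context {R : realType}.

Definition dotp (x y : 'cV[R]_3) : R := \sum_(i < 3) x i 0 * y i 0.

Definition S2R : set (ambient R) := [set p | dotp p.1 p.1 = 1].

Definition tangent (p u : ambient R) : Prop := dotp p.1 u.1 = 0.

(* The product metric: S^2 carries the metric induced from R^3. *)
Definition metric (u v : ambient R) : R := dotp u.1 v.1 + u.2 * v.2.

Definition retr (p : ambient R) : ambient R :=
  ((Num.sqrt (dotp p.1 p.1))^-1 *: p.1, p.2).

Definition eq_on_S2R {W : Type} (f f' : ambient R -> W) : Prop :=
  forall p, S2R p -> f p = f' p.

Definition smooth_S2R {W : normedModType R} (f : ambient R -> W) : Prop :=
  forall p, S2R p ->
    exists (U : set (ambient R)) (F : ambient R -> W),
      [/\ open U, U p, smooth_on U F & forall q, U q -> S2R q -> F q = f q].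

(* df_p(v) for p on the submanifold and v tangent at p: the velocity at t = 0 of
   f along t |-> retr (p + t v), a curve in the submanifold through p with
   velocity v. *)
Definition der {W : normedModType R} (f : ambient R -> W)
    (p v : ambient R) : W :=
  'D_v (f \o retr) p.

Definition vfield (X : ambient R -> ambient R) : Prop :=
  smooth_S2R X /\ forall p, S2R p -> tangent p (X p).

Local Notation fields := (ambient R -> ambient R).
Local Notation operator := (fields -> fields -> fields).

Definition act_on {W : normedModType R} (X : fields) (f : ambient R -> W) :
  ambient R -> W := fun p => der f p (X p).

(* The identity [X, Y] f = X (Y f) - Y (X f), read on the ambient coordinate
   functions. *)
Definition lie_bracket (X Y : fields) : fields :=
  fun p => act_on X Y p - act_on Y X p.

Record affine_connection (D : operator) : Prop := AffineConnection {
  conn_field : forall X Y, vfield X -> vfield Y -> vfield (D X Y);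
  (* independence of the values off the submanifold *)
  conn_ext : forall X X' Y Y', vfield X -> vfield X' -> vfield Y -> vfield Y' ->
    eq_on_S2R X X' -> eq_on_S2R Y Y' -> eq_on_S2R (D X Y) (D X' Y');
  conn_linl : forall (f : ambient R -> R^o) X X' Y,
    smooth_S2R f -> vfield X -> vfield X' -> vfield Y ->
    eq_on_S2R (D (fun p => f p *: X p + X' p) Y)
              (fun p => f p *: D X Y p + D X' Y p);
  conn_addr : forall X Y Y', vfield X -> vfield Y -> vfield Y' ->
    eq_on_S2R (D X (fun p => Y p + Y' p)) (fun p => D X Y p + D X Y' p);
  conn_leibniz : forall (f : ambient R -> R^o) X Y,
    smooth_S2R f -> vfield X -> vfield Y ->
    eq_on_S2R (D X (fun p => f p *: Y p))
              (fun p => (act_on X f p : R) *: Y p + f p *: D X Y p) }.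

Definition torsion_free (D : operator) : Prop :=
  forall X Y, vfield X -> vfield Y ->
    eq_on_S2R (fun p => D X Y p - D Y X p) (lie_bracket X Y).

Definition parallel_metric (D : operator) : Prop :=
  forall X Y Z, vfield X -> vfield Y -> vfield Z ->
    eq_on_S2R (act_on X (fun p => metric (Y p) (Z p) : R^o))
              (fun p => metric (D X Y p) (Z p) + metric (Y p) (D X Z p)).

Definition levi_civita (D : operator) : Prop :=
  [/\ affine_connection D, torsion_free D & parallel_metric D].

Definition curvature (D : operator) (X Y Z : fields) : fields :=
  fun p => D X (D Y Z) p - D Y (D X Z) p - D (lie_bracket X Y) Z p.

Local Notation tensor :=
  (ambient R -> ambient R -> ambient R -> ambient R).

(* T p u v is (T_u v) at the point p. *)
Definition apply_tensor (T : tensor) (X Y : fields) : fields :=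
  fun p => T p (X p) (Y p).

Record tensor_field12 (T : tensor) : Prop := TensorField12 {
  tens_linl : forall p (a : R) u u' v, S2R p ->
    tangent p u -> tangent p u' -> tangent p v ->
    T p (a *: u + u') v = a *: T p u v + T p u' v;
  tens_linr : forall p (a : R) u v v', S2R p ->
    tangent p u -> tangent p v -> tangent p v' ->
    T p u (a *: v + v') = a *: T p u v + T p u v';
  tens_tangent : forall p u v, S2R p -> tangent p u -> tangent p v ->
    tangent p (T p u v);
  tens_smooth : forall X Y, vfield X -> vfield Y ->
    smooth_S2R (apply_tensor T X Y) }.

(* The connection D - T *)
Definition sub_tensor (D : operator) (T : tensor) : operator :=
  fun X Y p => D X Y p - apply_tensor T X Y p.

(* Dt R = 0 for the curvature tensor R of D, evaluated on fields by the product
   rule. *)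
Definition parallel_curvature (Dt D : operator) : Prop :=
  forall X Y Z U, vfield X -> vfield Y -> vfield Z -> vfield U ->
    eq_on_S2R (Dt X (curvature D Y Z U))
      (fun p => curvature D (Dt X Y) Z U p + curvature D Y (Dt X Z) U p
                + curvature D Y Z (Dt X U) p).

Definition parallel_tensor (Dt : operator) (T : tensor) : Prop :=
  forall X Y Z, vfield X -> vfield Y -> vfield Z ->
    eq_on_S2R (Dt X (apply_tensor T Y Z))
      (fun p => apply_tensor T (Dt X Y) Z p + apply_tensor T Y (Dt X Z) p).

Definition homogeneous_structure (T : tensor) : Prop :=
  tensor_field12 T /\
  exists D : operator, levi_civita D /\
    let Dt := sub_tensor D T in
    [/\ parallel_metric Dt, parallel_curvature Dt D & parallel_tensor Dt T].

Definition isometry (phi : fields) : Prop :=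
  [/\ forall p, S2R p -> S2R (phi p),
      smooth_S2R phi,
      exists psi : fields,
        [/\ forall p, S2R p -> S2R (psi p), smooth_S2R psi,
            forall p, S2R p -> psi (phi p) = p &
            forall p, S2R p -> phi (psi p) = p] &
      forall p u v, S2R p -> tangent p u -> tangent p v ->
        metric (der phi p u) (der phi p v) = metric u v].

Definition isomorphic (T T' : tensor) : Prop :=
  exists2 phi : fields, isometry phi &
    forall X Y, vfield X -> vfield Y -> forall p, S2R p ->
      der phi p (T p (X p) (Y p)) =
      T' (phi p) (der phi p (X p)) (der phi p (Y p)).

Definition dy (u : ambient R) : R := u.2.

(* The area form of S^2 at x, pulled back to the product. The orientation of
   S^2 is given by the outer normal x if s = false, by - x if s = true. *)
Definition dV (s : bool) (p v w : ambient R) : R :=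
  (-1) ^+ s * \det (\matrix_(i < 3, j < 3) [:: p.1; v.1; w.1]`_j i 0).

(* Indices are taken modulo 3. *)
Definition cross (x y : 'cV[R]_3) : 'cV[R]_3 :=
  \col_(i < 3) (x (i + 1) 0 * y (i + 2) 0 - x (i + 2) 0 * y (i + 1) 0).

(* T^lambda as a field of type (1,2); Tlam_cov below identifies its covariant
   form with lambda dy (x) dV. *)
Definition Tlam (s : bool) (lam : R) : tensor :=
  fun p u v => ((lam * dy u * (-1) ^+ s) *: cross p.1 v.1, 0).

Lemma Tlam_cov s lam p u v w :
  metric (Tlam s lam p u v) w = lam * (dy u * dV s p v w).
Proof.
rewrite /metric /dV /dotp /dy /= mul0r addr0 (expand_det_col _ ord0).
rewrite !big_ord_recl !big_ord0 /cofactor !(expand_det_row _ ord0).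
rewrite !big_ord_recl !big_ord0 /cofactor !det_mx11 !mxE /=.
have e1 : lift ord0 ord0 = 1 :> 'I_3 by apply/val_inj.
have e2 : lift ord0 (lift ord0 ord0) = 2 :> 'I_3 by apply/val_inj.
have e2' : lift ord0 (lift ord0 0) = 2 :> 'I_3 by apply/val_inj.
have e3 : lift 1 ord0 = 0 :> 'I_3 by apply/val_inj.
have e4 : lift 2 ord0 = 0 :> 'I_3 by apply/val_inj.
have e5 : lift 1 (lift ord0 0) = 2 :> 'I_3 by apply/val_inj.
have e6 : lift 2 (lift ord0 0) = 1 :> 'I_3 by apply/val_inj.
have e0 : ord0 = 0 :> 'I_3 by apply/val_inj.
have f1 : 1 + 1 = 2 :> 'I_3 by apply/val_inj.
have f2 : 1 + 2 = 0 :> 'I_3 by apply/val_inj.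
have f3 : 2 + 1 = 0 :> 'I_3 by apply/val_inj.
have f4 : 2 + 2 = 1 :> 'I_3 by apply/val_inj.
rewrite ?e2' ?e2 ?e1 ?e3 ?e4 ?e5 ?e6 ?e0 ?f1 ?f2 ?f3 ?f4 /bump /=.
have f0 (i : 'I_3) : 0 + i = i by rewrite add0r.
rewrite !f0 ?addn0 ?add0n ?addn1 !(expr0, expr1, sqrr_sign) /dy.
ring.
Qed.

Local Notation group := ('M[R]_3 * R^o)%type.

Definition SO {n : nat} (A : 'M[R]_n) : Prop := A *m A^T = 1%:M /\ \det A = 1.

Definition SO3R : set group := [set a | SO a.1].

Definition gact (a : group) (p : ambient R) : ambient R :=
  (a.1 *m p.1, p.2 + a.2).

Definition expm (A : 'M[R]_3) : 'M[R]_3 :=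
  lim ((fun n : nat => \sum_(k < n) (k`!%:R : R)^-1 *: A ^+ k) @ \oo).

(* Exponential, bracket and adjoint representation of the group GL_3(R) x R,
   whose second factor is additive, on its Lie algebra gl_3(R) x R. *)
Definition gexp (X : group) : group := (expm X.1, X.2).
Definition gbracket (X Y : group) : group := (X.1 *m Y.1 - Y.1 *m X.1, 0).
Definition Ad (a X : group) : group := (a.1 *m X.1 *m invmx a.1, X.2).

(* The Lie algebra of a closed subgroup K of GL_3(R) x R. *)
Definition lie (K : set group) : set group :=
  [set X | forall t : R, K (gexp (t *: X))].

Definition isotropy (G : set group) (o : ambient R) : set group :=
  [set a | G a /\ gact a o = o].

(* The value at p of the vector field generated by X. *)
Definition fund (X : group) (p : ambient R) : ambient R :=
  derive1 (fun t : R => gact (gexp (t *: X)) p) 0.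

Definition subspace (m : set group) : Prop :=
  m 0 /\ forall (a : R) X Y, m X -> m Y -> m (a *: X + Y).

(* m is an Ad(H)-invariant complement of Lie(H) in Lie(G). *)
Definition reductive (G H m : set group) : Prop :=
  [/\ subspace m,
      m `<=` lie G,
      m `&` lie H = [set 0],
      forall X, lie G X -> exists Y Z, [/\ m Y, lie H Z & X = Y + Z] &
      forall a X, H a -> m X -> m (Ad a X)].

Definition transitive_isometric (G : set group) : Prop :=
  (forall a, G a -> isometry (gact a)) /\
  (forall p q, S2R p -> S2R q -> exists2 a, G a & gact a p = q).

Definition invariant (G : set group) (T : tensor) : Prop :=
  forall a p u v, G a -> S2R p -> tangent p u -> tangent p v ->
    der (gact a) p (T p u v) =
    T (gact a p) (der (gact a) p u) (der (gact a) p v).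

Definition determined_by (G m : set group) (o : ambient R) (T : tensor) : Prop :=
  invariant G T /\
  forall X Y Z, m X -> m Y -> m Z ->
    2 * metric (T o (fund X o) (fund Y o)) (fund Z o) =
      metric (fund (gbracket X Y) o) (fund Z o)
      - metric (fund (gbracket Y Z) o) (fund X o)
      + metric (fund (gbracket Z X) o) (fund Y o).

(* The coset space representation corresponding to T is G/H, H being the
   isotropy group of G at o. *)
Definition coset_representation (G H : set group) (o : ambient R)
    (T : tensor) : Prop :=
  [/\ connected G,
      transitive_isometric G,
      S2R o /\ isotropy G o = H &
      exists m, reductive G H m /\ determined_by G m o T].

Definition base_point : ambient R := (delta_mx (2 : 'I_3) 0, 0).

Definition SO2 : set group :=
  [set a | a.2 = 0 /\
     exists2 B : 'M[R]_2, SO B & a.1 = block_mx B 0 0 1%:M :> 'M[R]_(2 + 1)].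

End Cylinder.

(* Main.v *)
(* The Levi-Civita connection is the tangential projection of the ambient derivative, and
   symmetry of second derivatives yields its curvature R(X,Y)Z = <Y,Z> X' - <X,Z> Y', with
   X' the component of X tangent to the sphere and <,> its metric. R is parallel, so a
   homogeneous structure is a tensor T such that every T_X is skew and annihilates R and
   such that T is parallel for nabla - T. The first two conditions force T_X = w(X) J, where
   J = p x (.) is the rotation by a right angle tangent to the sphere and w is a 1-form.
   Being parallel, T is annihilated by the curvature of nabla - T, which in a frame
   (e, Je) of the sphere equals -(1 + w(e)^2 + w(Je)^2) J; the factor never vanishes
   because the sphere is positively curved, and this kills w on the sphere. Hence
   w = f dy; once more because T is parallel, df = 0. The reflection y -> -y changes the
   sign of f, and |f| is the maximum of |T_u v| over unit vectors u, v, an invariant.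

   The structure with parameter k belongs to the complement of so(2) in so(3) + R that is
   spanned by the rotations about horizontal axes and by (k Z, 1), with Z the generator
   of so(2). *)
From HB Require Import structures.
Require Import Defs.
From mathcomp Require Import all_boot all_order all_algebra.
From mathcomp Require Import ring lra.
From mathcomp Require Import all_classical all_reals all_analysis.
Import Order.TTheory GRing.Theory Num.Theory.
Import numFieldNormedType.Exports.
Local Open Scope classical_set_scope.
Local Open Scope ring_scope.
Set Implicit Arguments.
Unset Strict Implicit.
Unset Printing Implicit Defensive.

(** * Differentiable maps of class C^k *)

(** The delicate point of the classification is that the curvature of nabla - T seems to involve
    derivatives of w. They never appear: parallelism of T lets nabla - T pass through T by the
    product rule, so only w(T_X Y) = w(X) w(JY) is left. This algebraic term produces the squares
    w(e)^2 and w(Je)^2, and they come with the same sign as the curvature of the sphere; with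
    negative curvature the factor could vanish.

    The vertical direction is singled out by R alone, since R(x, y) kills it. A skew map that
    annihilates R must therefore kill it too, and on the remaining plane skew maps are multiples of
    J.

    The parameter k measures a freedom in the choice of complement: so(2) commutes with the vertical
    direction (0, 1), so tilting this vector by k Z preserves Ad-invariance.

    The calculus rests on one device: [der] differentiates f o retr, an honest function near the
    submanifold, and for tangent directions it agrees with the derivative of any local extension of
    f. Rules on open sets thus pass to the submanifold, symmetry of second derivatives included. *)

Lemma near_eq_differentiable (R : realType) (V W : normedModType R) (f g : V -> W) (x : V) :
  (\near x, f x = g x) -> differentiable f x -> differentiable g x.
Proof.
move=> fg df.
have fgx : f x = g x by exact: nbhs_singleton fg.
have key : g \o shift x = cst (g x) + 'd f x +o_ 0 id.
  apply/eqaddoP => e e0.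
  have /eqaddoP/(_ e e0) H := diff_locally df.
  have fg0 : \forall y \near (0 : V), f (y + x) = g (y + x).
    by move: fg; rewrite (near_shift 0) /= subr0.
  near=> y.
  have /= : `|(f \o shift x - (cst (f x) + 'd f x)) y| <= e * `|id y| by near: y.
  have E : f (y + x) = g (y + x) by near: y.
  by rewrite !fctE /= E fgx.
apply/diff_locallyP; rewrite (diff_unique (diff_continuous df) key).
by split; [exact: diff_continuous|].
Unshelve. all: by end_near. Qed.

Section Ck_theory.
Context {R : realType}.
Implicit Types V W : normedModType R.

Lemma Ck_pred V W k (U : set V) (f : V -> W) : Ck k.+1 U f -> Ck k U f.
Proof.
elim: k f => [|k ih] f [df Df].
  by move=> x Ux; exact/differentiable_continuous/df.
by split => // v; exact/ih/Df.
Qed.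

Lemma Ck_ext V W k (U : set V) (f g : V -> W) : open U ->
  {in U, f =1 g} -> Ck k U f -> Ck k U g.
Proof.
move=> oU; elim: k f g => [|k ih] f g fg.
  move=> cf x Ux; have H : f @ x --> g x by rewrite -(fg x (mem_set Ux)); exact: cf.
  suff : g @ x --> g x by [].
  apply: cvg_trans H; apply: near_eq_cvg.
  by have := open_nbhs_nbhs (conj oU Ux); apply: filterS => y Uy; apply: fg; exact/mem_set.
have nfg x : U x -> \near x, f x = g x.
  by move=> Ux; have := open_nbhs_nbhs (conj oU Ux); apply: filterS => y Uy; apply: fg;
    exact/mem_set.
move=> [df Df]; split=> [x Ux|v]; first exact: near_eq_differentiable (nfg x Ux) (df x Ux).
apply: ih (Df v) => x /set_mem Ux; exact: near_eq_derive (nfg x Ux).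
Qed.

Lemma Ck_cst V W k (U : set V) (a : W) : Ck k U (fun _ : V => a).
Proof.
elim: k a => [|k ih] a; first by move=> x _; exact: cst_continuous.
split=> [x _|v]; first exact: differentiable_cst.
have -> : 'D_v (fun _ : V => a) = (fun=> 0) by apply/funext => x; exact: derive_cst.
exact: ih.
Qed.

Lemma CkD V W k (U : set V) (f g : V -> W) : open U ->
  Ck k U f -> Ck k U g -> Ck k U (fun x => f x + g x).
Proof.
move=> oU; elim: k f g => [|k ih] f g.
  by move=> cf cg x Ux; apply: continuousD; [exact: cf|exact: cg].
move=> [df Df] [dg Dg]; split=> [x Ux|v].
  by apply: differentiableD; [exact: df|exact: dg].
apply: Ck_ext oU _ (ih _ _ (Df v) (Dg v)) => x /set_mem Ux.
by rewrite deriveD //; apply: diff_derivable; [exact: df|exact: dg].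
Qed.

Lemma Ck_sum V W k (U : set V) (I : Type) (r : seq I) (F : I -> V -> W) : open U ->
  (forall i, Ck k U (F i)) -> Ck k U (fun x => \sum_(i <- r) F i x).
Proof.
move=> oU H; elim: r => [|i r ih].
  have -> : (fun x => \sum_(i <- [::]) F i x) = (fun=> 0) by apply/funext => x; rewrite big_nil.
  exact: Ck_cst.
have -> : (fun x => \sum_(i <- i :: r) F i x) = (fun x => F i x + \sum_(i <- r) F i x).
  by apply/funext => x; rewrite big_cons.
exact: CkD.
Qed.

Lemma CkM V k (U : set V) (f g : V -> R^o) : open U ->
  Ck k U f -> Ck k U g -> Ck k U (fun x => f x * g x : R^o).
Proof.
move=> oU; elim: k f g => [|k ih] f g.
  by move=> cf cg x Ux; apply: continuousM; [exact: cf|exact: cg].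
move=> f1 g1; have [df Df] := f1; have [dg Dg] := g1.
split=> [x Ux|v].
  by apply: differentiableM; [exact: df|exact: dg].
apply: Ck_ext oU _ (CkD oU (ih _ _ (Ck_pred f1) (Dg v)) (ih _ _ (Ck_pred g1) (Df v))) => x
  /set_mem Ux.
have dfx := df x Ux; have dgx := dg x Ux.
by rewrite -[RHS]/('D_v (f * g) x) deriveM //; apply: diff_derivable.
Qed.

Lemma derive_lin V W W' (L : {linear W -> W'}) (f : V -> W) x v :
  continuous L -> differentiable f x -> 'D_v (L \o f) x = L ('D_v f x).
Proof.
move=> cL dfx; have dL := linear_differentiable (f x) cL.
rewrite deriveE; last exact: differentiable_comp.
by rewrite deriveE // (diff_comp dfx dL) /= (diff_lin (f x) cL).
Qed.

Lemma Ck_lin V W W' k (U : set V) (L : {linear W -> W'}) (f : V -> W) : open U ->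
  continuous L -> Ck k U f -> Ck k U (L \o f).
Proof.
move=> oU cL; elim: k f => [|k ih] f.
  by move=> cf x Ux; apply: continuous_comp; [exact: cf|exact: cL].
move=> [df Df]; split=> [x Ux|v].
  by apply: differentiable_comp; [exact: df|exact: linear_differentiable].
apply: Ck_ext oU _ (ih _ (Df v)) => x /set_mem Ux /=.
by rewrite derive_lin //; exact: df.
Qed.

Lemma Ck_id V k (U : set V) : Ck k U (@id V).
Proof.
case: k => [|k]; first by move=> x _; exact: cvg_id.
split=> [x _|v]; first by [].
have -> : 'D_v (@id V) = (fun=> v) by apply/funext => x; rewrite derive_id.
exact: Ck_cst.
Qed.

Lemma Ck_Zl V W k (U : set V) (f : V -> R^o) (w : W) : open U ->
  Ck k U f -> Ck k U (fun x => f x *: w).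
Proof.
move=> oU; elim: k f => [|k ih] f.
  by move=> cf x Ux; apply: continuousZr_tmp; exact: cf.
move=> [df Df]; split=> [x Ux|v].
  by apply: differentiableZl; exact: df.
apply: Ck_ext oU _ (ih _ (Df v)) => x /set_mem Ux /=.
have dfx := df x Ux.
rewrite !deriveE //; last exact: differentiableZl.
by rewrite diffZl.
Qed.

Lemma Ck_sub V W k (U U' : set V) (f : V -> W) : U' `<=` U -> Ck k U f -> Ck k U' f.
Proof.
move=> s; elim: k f => [|k ih] f; first by move=> cf x /s; exact: cf.
by move=> [df Df]; split=> [x /s|v]; [exact: df|exact: (ih _ (Df v))].
Qed.

End Ck_theory.

(** * Symmetry of second derivatives *)

Section Mixed_derivatives.
Context {R : realType} {V : normedModType R}.

Lemma is_derive_line (W : normedModType R) (f : V -> W) (a w : V) (s : R) :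
  differentiable f (a + s *: w) ->
  is_derive s 1 (fun t : R => f (a + t *: w)) ('D_w f (a + s *: w)).
Proof.
move=> df.
have d1 : is_diff s (fun t : R => a + t *: w) (fun t => t *: w).
  have -> : (fun t : R => a + t *: w) = cst a + ( *:%R ^~ w) by [].
  by apply: is_diff_eq; rewrite add0r.
have d2 := is_diff_comp d1 (differentiableP df).
apply: DeriveDef; first by apply: diff_derivable; exact: (@ex_diff _ _ _ _ _ _ _ d2).
rewrite deriveE; last exact: (@ex_diff _ _ _ _ _ _ _ d2).
rewrite (deriveE _ df).
by rewrite [LHS](congr1 (@^~ 1) (@diff_val _ _ _ _ _ _ _ d2)) /= scale1r.
Qed.

Lemma MVT_line (f : V -> R^o) (a w : V) (h : R) : 0 < h ->
  (forall s, 0 <= s <= h -> differentiable f (a + s *: w)) ->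
  exists2 s, 0 <= s <= h & f (a + h *: w) - f a = h * 'D_w f (a + s *: w).
Proof.
move=> h0 df.
pose g (t : R) : R := f (a + t *: w); pose dg (t : R) : R := 'D_w f (a + t *: w).
have D s : s \in `[0, h] -> is_derive s 1 g (dg s).
  by rewrite in_itv /= => sh; apply: is_derive_line; exact: df.
have D' s : s \in `]0, h[ -> is_derive s 1 g (dg s).
  by move=> /subset_itv_oo_cc; exact: D.
have cg : {within `[0, h], continuous g}.
  by apply: derivable_within_continuous => s /D [].
have [s sh E] := MVT h0 D' cg.
exists s; first by move: sh; rewrite in_itv /= => /andP[/ltW -> /ltW ->].
by move: E; rewrite /g /dg scale0r addr0 subr0 mulrC.
Qed.

Lemma derive_translate (W : normedModType R) (f : V -> W) (a x v : V) :
  'D_v (f \o shift a) x = 'D_v f (x + a).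
Proof.
rewrite /derive; set F := (F in lim (F @ _) = _); set G := (G in _ = lim (G @ _)).
by have -> : F = G by apply/funext => h; rewrite /F /G /= addrA.
Qed.

(* Taken with u and v exchanged, this writes one second difference as h^2 times either
   mixed derivative at nearby points. *)
Lemma second_difference (f : V -> R^o) (p u v : V) (h : R) : 0 < h ->
  (forall s t, 0 <= s <= h -> 0 <= t <= h ->
     differentiable f (p + s *: u + t *: v) /\
     differentiable ('D_u f : V -> R^o) (p + s *: u + t *: v)) ->
  exists s t, [/\ 0 <= s <= h, 0 <= t <= h &
    f (p + h *: u + h *: v) - f (p + h *: u) - f (p + h *: v) + f p
      = h * (h * 'D_v ('D_u f) (p + s *: u + t *: v))].
Proof.
move=> h0 H.
have h00 : 0 <= (0:R) <= h by rewrite lexx ltW.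
have hh : 0 <= h <= h by rewrite lexx ltW.
have [s sh E] : exists2 s, 0 <= s <= h &
   (f (p + h *: u + h *: v) - f (p + h *: u)) - (f (p + h *: v) - f p)
   = h * 'D_u (f \o shift (h *: v) - f) (p + s *: u).
  have d1 s : 0 <= s <= h -> differentiable (f \o shift (h *: v)) (p + s *: u).
    move=> sh; apply: differentiable_comp => //=; exact: (H _ _ sh hh).1.
  have d2 s : 0 <= s <= h -> differentiable f (p + s *: u).
    by move=> sh; have [] := H _ _ sh h00; rewrite scale0r addr0.
  apply: (MVT_line (f := f \o shift (h *: v) - f) h0) => s sh.
  by apply: differentiableB; [exact: d1|exact: d2].
have d0 t : 0 <= t <= h -> differentiable ('D_u f : V -> R^o) (p + s *: u + t *: v).
  by move=> th; exact: (H _ _ sh th).2.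
have [t th E2] := MVT_line h0 d0.
exists s, t; split => //; rewrite -E2.
have -> : f (p + h *: u + h *: v) - f (p + h *: u) - f (p + h *: v) + f p
  = (f (p + h *: u + h *: v) - f (p + h *: u)) - (f (p + h *: v) - f p).
  by rewrite opprB addrA addrAC.
rewrite E deriveB ?derive_translate //.
  apply: diff_derivable; apply: differentiable_comp => //=; exact: (H _ _ sh hh).1.
by apply: diff_derivable; have [] := H _ _ sh h00; rewrite scale0r addr0.
Qed.

(** Schwarz's theorem: if the two mixed derivatives are within e / 2 of their values at p throughout
    a ball, evaluating one small second difference in both orders shows that these values differ by
    at most e. *)
Lemma derive_comm (U : set V) (f : V -> R^o) (p u v : V) :
  open U -> U p -> Ck 2 U f -> 'D_u ('D_v f) p = 'D_v ('D_u f) p.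
Proof.
move=> oU Up [df Df].
pose A (x : V) : R := 'D_u ('D_v f) x; pose B (x : V) : R := 'D_v ('D_u f) x.
have cA : {for p, continuous A} by have [_ /(_ u)] := Df v; apply.
have cB : {for p, continuous B} by have [_ /(_ v)] := Df u; apply.
suff : A p = B p by [].
apply/eqP; rewrite -subr_eq0 -normr_le0; apply/ler_addgt0Pr => e e0; rewrite add0r.
have e20 : 0 < e / 2 by rewrite divr_gt0.
have nA : \forall x \near p, `|A p - A x| < e / 2 by move/cvgrPdist_lt : cA; apply.
have nB : \forall x \near p, `|B p - B x| < e / 2 by move/cvgrPdist_lt : cB; apply.
have nU : \forall x \near p, U x by exact: open_nbhs_nbhs.
have [d /= d0 Hd] := (nbhs_ballP _ _).1 (filterI nU (filterI nA nB)).
(* The summand 1 keeps M positive even if u and v vanish. With h M = d / 2 the whole parallelogram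
   spanned by h u and h v stays in the ball of radius d. *)
pose M := 1 + `|u| + `|v|.
have M0 : 0 < M by rewrite /M -addrA ltr_pwDl // addr_ge0.
pose h := d / (M * 2).
have h0 : 0 < h by rewrite divr_gt0 // mulr_gt0.
have inb s t a b : 0 <= s <= h -> 0 <= t <= h -> `|a| + `|b| <= M ->
    ball p d (p + s *: a + t *: b).
  move=> /andP[s0 sh] /andP[t0 th] abM; rewrite -ball_normE /= -addrA opprD addrA subrr sub0r
    normrN.
  apply: le_lt_trans (ler_normD _ _) _; rewrite !normrZ (ger0_norm s0) (ger0_norm t0).
  apply: (@le_lt_trans _ _ (h * M)).
    apply: (@le_trans _ _ (h * (`|a| + `|b|))); last by rewrite ler_pM2l.
    by rewrite mulrDr lerD // ler_wpM2r.
  have -> : h * M = d / 2 by rewrite /h; field; rewrite gt_eqF.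
  by rewrite ltr_pdivrMr // ltr_pMr // ltr1n.
have uvM : `|u| + `|v| <= M by rewrite /M -addrA lerDr.
have vuM : `|v| + `|u| <= M by rewrite addrC.
have [s [t [sh th E1]]] : exists s1 t1, [/\ 0 <= s1 <= h, 0 <= t1 <= h &
    f (p + h *: u + h *: v) - f (p + h *: u) - f (p + h *: v) + f p
      = h * (h * B (p + s1 *: u + t1 *: v))].
  apply: second_difference => // s1 t1 sh1 th1.
  have [Ux _] := Hd _ (inb s1 t1 u v sh1 th1 uvM).
  by split; [exact: df|exact: (Df u).1].
have [s' [t' [sh' th' E2]]] : exists s t, [/\ 0 <= s <= h, 0 <= t <= h &
    f (p + h *: v + h *: u) - f (p + h *: v) - f (p + h *: u) + f p
      = h * (h * A (p + s *: v + t *: u))].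
  apply: second_difference => // s1 t1 sh1 th1.
  have [Ux _] := Hd _ (inb s1 t1 v u sh1 th1 vuM).
  by split; [exact: df|exact: (Df v).1].
have hn0 : h != 0 by rewrite gt_eqF.
have AB : A (p + s' *: v + t' *: u) = B (p + s *: u + t *: v).
  have hh0 : h * h != 0 by rewrite mulf_neq0.
  have aux (a b c e1 x y : R) : a - b - c + e1 = h * (h * y) ->
      a - c - b + e1 = h * (h * x) -> x = y.
    by move=> H1 H2; apply: (mulfI hh0); lra.
  have E : p + h *: v + h *: u = p + h *: u + h *: v by rewrite addrAC.
  by rewrite E in E2; exact: aux E1 E2.
have [_ [_ HB]] := Hd _ (inb s t u v sh th uvM).
have [_ [HA _]] := Hd _ (inb s' t' v u sh' th' vuM).
have -> : A p - B p = (A p - A (p + s' *: v + t' *: u)) - (B p - B (p + s *: u + t *: v)).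
  by rewrite AB opprB addrA subrK.
have H3 : `|A p - A (p + s' *: v + t' *: u)| + `|B p - B (p + s *: u + t *: v)| <= e.
  by rewrite (splitr e); exact: (lerD (ltW HA) (ltW HB)).
exact: le_trans (ler_normB _ _) H3.
Qed.

End Mixed_derivatives.

(** * Functions on the cylinder and their derivatives *)

Section Coordinates.
Context {R : realType}.
Local Notation amb := (ambient R).

(** [Some j] indexes the coordinates of R^3 and [None] that of the line, so that statements on the
    product are proved for one uniform family of linear forms. *)
Definition crd (i : option 'I_3) (u : amb) : R^o :=
  if i is Some j then u.1 j 0 else u.2.

Definition bas (i : option 'I_3) : amb :=
  if i is Some j then (delta_mx j 0, 0) else (0, 1).

Fact crd_is_linear i : linear (crd i).
Proof. by case: i => [j|] a u v //=; rewrite !mxE. Qed.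

HB.instance Definition _ i := GRing.isLinear.Build R amb R^o _ (crd i) (crd_is_linear i).

Lemma crd_continuous i : continuous (crd i).
Proof.
case: i => [j|] u.
  by apply: (@continuous_comp _ _ _ fst (fun M : 'cV[R]_3 => M j 0));
    [exact: cvg_fst|exact: coord_continuous].
exact: cvg_snd.
Qed.

Lemma crd_inj (u v : amb) : (forall i, crd i u = crd i v) -> u = v.
Proof.
case: u v => [u a] [v b] H; congr pair; last exact: (H None).
by apply/matrixP => i j; rewrite ord1; exact: (H (Some i)).
Qed.

Lemma crd_bas i j : crd i (bas j) = (i == j)%:R.
Proof.
case: i j => [i|] [j|] //=; first by rewrite mxE eqxx andbT.
by rewrite mxE.
Qed.

Lemma crd_sum (u : amb) : u = \sum_i crd i u *: bas i.
Proof.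
apply: crd_inj => i; rewrite linear_sum (bigD1 i) //= linearZ /= crd_bas eqxx.
rewrite big1 ?addr0 => [|j ji]; first by rewrite /GRing.scale /= mulr1.
by rewrite linearZ /= crd_bas eq_sym (negbTE ji) scaler0.
Qed.

Section Differentiation.
Context {V : normedModType R}.

Lemma derive_crd i (F : V -> amb) x v : differentiable F x ->
  'D_v (crd i \o F) x = crd i ('D_v F x).
Proof. exact/derive_lin/crd_continuous. Qed.

Lemma differentiable_crd i (F : V -> amb) x : differentiable F x ->
  differentiable (crd i \o F) x.
Proof.
by move=> dF; apply: differentiable_comp => //; exact/linear_differentiable/crd_continuous.
Qed.

Lemma differentiable_ambient (F : V -> amb) x :
  (forall i, differentiable (crd i \o F) x) -> differentiable F x.
Proof.
move=> H; have -> : F = \sum_i (fun x => crd i (F x) *: bas i).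
  by apply/funext => y; rewrite fct_sumE -crd_sum.
elim/big_ind : _ => [||i _]; first exact: differentiable_cst.
  by move=> f g; exact: differentiableD.
by apply: (differentiableZl (k := crd i \o F)); exact: H.
Qed.

End Differentiation.

Lemma differentiable_crd_id i (x : amb) : differentiable (crd i) x.
Proof. exact/linear_differentiable/crd_continuous. Qed.

Lemma derive_crd_id i (x v : amb) : 'D_v (crd i) x = crd i v.
Proof. by rewrite -[crd i]/(crd i \o id) derive_crd // derive_id. Qed.

Lemma derive_sum_bas (W : normedModType R) (F : amb -> W) x v : differentiable F x ->
  'D_v F x = \sum_i crd i v *: 'D_(bas i) F x.
Proof.
move=> dF; rewrite deriveE // {1}[v]crd_sum linear_sum.
by apply: eq_bigr => i _; rewrite linearZ deriveE.
Qed.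

Lemma Ck_crd_comp (V : normedModType R) k U i (F : V -> amb) : open U -> Ck k U F ->
  Ck k U (crd i \o F).
Proof. by move=> oU; apply: Ck_lin => //; exact: crd_continuous. Qed.

Lemma Ck_crd k (U : set amb) i : open U -> Ck k U (crd i).
Proof. by move=> oU; apply: (Ck_crd_comp i oU (@Ck_id _ _ k U)). Qed.

Lemma smooth_onP (V W : normedModType R) (U : set V) (F : V -> W) : smooth_on U F ->
  (forall x, U x -> differentiable F x) /\ forall v, smooth_on U ('D_v F).
Proof.
by move=> sF; split; [exact: (sF 1%N).1|move=> v k; exact: ((sF k.+1).2 v)].
Qed.

End Coordinates.

Section Smooth.
Context {R : realType}.
Local Notation amb := (ambient R).
Implicit Types W : normedModType R.

Lemma smooth_S2R_global W (f : amb -> W) : smooth_on setT f -> smooth_S2R f.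
Proof. by move=> sf p Sp; exists setT, f; split => //; exact: openT. Qed.

Lemma smooth_S2R_cst W (w : W) : smooth_S2R (fun _ : amb => w).
Proof. by apply: smooth_S2R_global => k; exact: Ck_cst. Qed.

Lemma smooth_S2R_id : smooth_S2R (@id amb).
Proof. by apply: smooth_S2R_global => k; exact: Ck_id. Qed.

Lemma smooth_S2R_ext W (f g : amb -> W) : eq_on_S2R f g -> smooth_S2R f -> smooth_S2R g.
Proof.
move=> fg sf p Sp; have [U [F [oU Up sF E]]] := sf p Sp.
by exists U, F; split => // q Uq Sq; rewrite E // fg.
Qed.

Lemma smooth_S2R_map2 W1 W2 W3 (h : W1 -> W2 -> W3) :
  (forall U (F : amb -> W1) (G : amb -> W2), open U -> smooth_on U F -> smooth_on U G ->
     smooth_on U (fun q => h (F q) (G q))) ->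
  forall f g, smooth_S2R f -> smooth_S2R g -> smooth_S2R (fun q => h (f q) (g q)).
Proof.
move=> H f g sf sg p Sp.
have [U [F [oU Up sF EF]]] := sf p Sp; have [U' [G [oU' Up' sG EG]]] := sg p Sp.
exists (U `&` U'), (fun q => h (F q) (G q)); split; first exact: openI.
- by split.
- apply: H; first exact: openI.
    by move=> k; apply: Ck_sub (sF k); exact: subIsetl.
  by move=> k; apply: Ck_sub (sG k); exact: subIsetr.
- by move=> q [Uq Uq'] Sq; rewrite EF // EG.
Qed.

Lemma smooth_S2RD W (f g : amb -> W) : smooth_S2R f -> smooth_S2R g ->
  smooth_S2R (fun q => f q + g q).
Proof. by apply: (smooth_S2R_map2 (h := +%R)) => U F G oU sF sG k; exact: CkD. Qed.

Lemma smooth_S2RM (f g : amb -> R^o) : smooth_S2R f -> smooth_S2R g ->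
  smooth_S2R (fun q => f q * g q : R^o).
Proof.
by apply: (smooth_S2R_map2 (h := fun x y : R^o => x * y : R^o)) => U F G oU sF sG k; exact: CkM.
Qed.

Lemma smooth_S2RZl W (f : amb -> R^o) (w : W) : smooth_S2R f -> smooth_S2R (fun q => f q *: w).
Proof.
move=> sf p Sp; have [U [F [oU Up sF E]]] := sf p Sp.
exists U, (fun q => F q *: w); split => // [k|q Uq Sq]; first exact: Ck_Zl.
by rewrite E.
Qed.

Lemma smooth_S2R_crd i (f : amb -> amb) : smooth_S2R f -> smooth_S2R (fun q => crd i (f q)).
Proof.
move=> sf p Sp; have [U [F [oU Up sF E]]] := sf p Sp.
exists U, (crd i \o F); split => // [k|q Uq Sq]; first exact: Ck_crd_comp.
by rewrite /= E.
Qed.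

Lemma smooth_S2R_sum W (I : Type) (r : seq I) (f : I -> amb -> W) :
  (forall i, smooth_S2R (f i)) -> smooth_S2R (fun q => \sum_(i <- r) f i q).
Proof.
move=> H; elim: r => [|i r ih].
  have -> : (fun q => \sum_(i <- [::]) f i q) = (fun=> 0) by apply/funext => q; rewrite big_nil.
  exact: smooth_S2R_cst.
have -> : (fun q => \sum_(i <- i :: r) f i q) = (fun q => f i q + \sum_(i <- r) f i q).
  by apply/funext => q; rewrite big_cons.
exact: smooth_S2RD.
Qed.

Lemma smooth_S2R_ambient (f : amb -> amb) :
  (forall i, smooth_S2R (fun q => crd i (f q))) -> smooth_S2R f.
Proof.
move=> H; apply: (@smooth_S2R_ext _ (fun q => \sum_i crd i (f q) *: bas i)).
  by move=> q _; rewrite -crd_sum.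
by apply: smooth_S2R_sum => i; exact: smooth_S2RZl.
Qed.

Lemma smooth_S2RZ (f : amb -> R^o) (g : amb -> amb) :
  smooth_S2R f -> smooth_S2R g -> smooth_S2R (fun q => f q *: g q).
Proof.
move=> sf sg; apply: smooth_S2R_ambient => i.
have -> : (fun q => crd i (f q *: g q)) = (fun q => f q * crd i (g q)).
  by apply/funext => q; rewrite linearZ.
by apply: smooth_S2RM => //; exact: smooth_S2R_crd.
Qed.

Lemma smooth_S2RN (g : amb -> amb) : smooth_S2R g -> smooth_S2R (fun q => - g q).
Proof.
move=> sg; apply: (@smooth_S2R_ext _ (fun q => (-1 : R^o) *: g q)).
  by move=> q _; rewrite scaleN1r.
by apply: smooth_S2RZ => //; exact: smooth_S2R_cst.
Qed.

Lemma smooth_S2RB (f g : amb -> amb) : smooth_S2R f -> smooth_S2R g ->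
  smooth_S2R (fun q => f q - g q).
Proof. by move=> sf sg; apply: smooth_S2RD => //; exact: smooth_S2RN. Qed.

Lemma smooth_S2R_dotp (f g : amb -> amb) : smooth_S2R f -> smooth_S2R g ->
  smooth_S2R (fun q => dotp (f q).1 (g q).1 : R^o).
Proof.
move=> sf sg; apply: (@smooth_S2R_sum R^o _ _ (fun (i : 'I_3) q => (f q).1 i 0 * (g q).1 i 0 :
  R^o)) => i.
by apply: smooth_S2RM; [exact: (smooth_S2R_crd (Some i))|exact: (smooth_S2R_crd (Some i))].
Qed.

Lemma smooth_S2R_cross (f g : amb -> amb) : smooth_S2R f -> smooth_S2R g ->
  smooth_S2R (fun q => (cross (f q).1 (g q).1, 0) : amb).
Proof.
move=> sf sg; apply: smooth_S2R_ambient => -[i|] /=; last exact: smooth_S2R_cst.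
have sfi j := smooth_S2R_crd (Some j) sf; have sgi j := smooth_S2R_crd (Some j) sg.
apply: (@smooth_S2R_ext _ (fun q => (f q).1 (i + 1) 0 * (g q).1 (i + 2) 0
    + (-1) * ((f q).1 (i + 2) 0 * (g q).1 (i + 1) 0) : R^o)).
  by move=> q _; rewrite !mxE mulN1r.
exact: smooth_S2RD (smooth_S2RM (sfi (i + 1)) (sgi (i + 2)))
  (smooth_S2RM (smooth_S2R_cst (-1 : R^o)) (smooth_S2RM (sfi (i + 2)) (sgi (i + 1)))).
Qed.

End Smooth.

Section Der.
Context {R : realType}.
Local Notation amb := (ambient R).
Implicit Types W : normedModType R.

Lemma dotpC (x y : 'cV[R]_3) : dotp x y = dotp y x.
Proof. by apply: eq_bigr => i _; rewrite mulrC. Qed.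

Lemma dotpDr (x y z : 'cV[R]_3) : dotp x (y + z) = dotp x y + dotp x z.
Proof. by rewrite -big_split; apply: eq_bigr => i _; rewrite mxE mulrDr. Qed.

Lemma dotpZr (a : R) (x y : 'cV[R]_3) : dotp x (a *: y) = a * dotp x y.
Proof. by rewrite /dotp mulr_sumr; apply: eq_bigr => i _; rewrite mxE mulrCA. Qed.

Lemma dotpDl (x y z : 'cV[R]_3) : dotp (x + y) z = dotp x z + dotp y z.
Proof. by rewrite dotpC dotpDr !(dotpC z). Qed.

Lemma dotpZl (a : R) (x y : 'cV[R]_3) : dotp (a *: x) y = a * dotp x y.
Proof. by rewrite dotpC dotpZr dotpC. Qed.

Lemma dotpNr (x y : 'cV[R]_3) : dotp x (- y) = - dotp x y.
Proof. by rewrite -scaleN1r dotpZr mulN1r. Qed.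

Lemma dotpNl (x y : 'cV[R]_3) : dotp (- x) y = - dotp x y.
Proof. by rewrite dotpC dotpNr dotpC. Qed.

Lemma dotp0r (x : 'cV[R]_3) : dotp x 0 = 0.
Proof. by rewrite -(scale0r 0) dotpZr mul0r. Qed.

Lemma dotp0l (x : 'cV[R]_3) : dotp 0 x = 0.
Proof. by rewrite dotpC dotp0r. Qed.

Lemma dotp_ge0 (x : 'cV[R]_3) : 0 <= dotp x x.
Proof. by apply: sumr_ge0 => i _; rewrite -expr2 sqr_ge0. Qed.

Lemma dotp_eq0 (x : 'cV[R]_3) : (dotp x x == 0) = (x == 0).
Proof.
apply/eqP/eqP => [H|->]; last exact: dotp0r.
apply/matrixP => i j; rewrite ord1 mxE; apply/eqP; rewrite -sqrf_eq0 expr2.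
have /eqP := H; rewrite psumr_eq0 => [/allP/(_ i)|k _]; last by rewrite -expr2 sqr_ge0.
by rewrite mem_index_enum => /(_ isT).
Qed.

Lemma retr_S2R (p : amb) : S2R p -> retr p = p.
Proof. by move=> Sp; rewrite /retr Sp sqrtr1 invr1 scale1r; case: p Sp. Qed.

Lemma S2R_retr (q : amb) : 0 < dotp q.1 q.1 -> S2R (retr q).
Proof.
move=> q0; rewrite /S2R /retr /= dotpZl dotpZr mulrA -invfM.
by rewrite -expr2 sqr_sqrtr ?ltW // mulVf // gt_eqF.
Qed.

Lemma S2R_gt0 (p : amb) : S2R p -> 0 < dotp p.1 p.1.
Proof. by move=> ->. Qed.

Lemma Ck_dotp_sqr k (U : set amb) : open U -> Ck k U (fun q => dotp q.1 q.1 : R^o).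
Proof.
move=> oU; apply: (@Ck_sum _ _ R^o _ _ _ _ (fun (i : 'I_3) (q : amb) => q.1 i 0 * q.1 i 0 :
  R^o)) => // i.
by apply: CkM => //; exact: (Ck_crd _ (Some i)).
Qed.

Lemma differentiable_dotp_sqr (p : amb) : differentiable (fun q : amb => dotp q.1 q.1 : R^o) p.
Proof. by have [H _] := Ck_dotp_sqr 1 openT; exact: H. Qed.

Lemma near_dotp_gt0 (p : amb) : 0 < dotp p.1 p.1 -> \forall q \near p, 0 < dotp q.1 q.1.
Proof.
move=> p0; have := differentiable_continuous (differentiable_dotp_sqr p).
by move=> /cvgr_gt; apply.
Qed.

Let nrm (q : amb) : R := (Num.sqrt (dotp q.1 q.1))^-1.

Let inv_sqrt (t : R) : R := (Num.sqrt t)^-1.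

Lemma derivable_inv_sqrt (t : R) : 0 < t -> derivable inv_sqrt t 1.
Proof.
move=> t0; apply: derivableV; first by rewrite gt_eqF // sqrtr_gt0.
by have [] := is_derive1_sqrt t0.
Qed.

Lemma differentiable_nrm (p : amb) : 0 < dotp p.1 p.1 -> differentiable (nrm : amb -> R^o) p.
Proof.
move=> p0; apply: (differentiable_comp (g := inv_sqrt)); first exact: differentiable_dotp_sqr.
exact/derivable1_diffP/derivable_inv_sqrt.
Qed.

Lemma crd_retr i (q : amb) : crd i (retr q) = if i is Some j then nrm q * q.1 j 0 else q.2.
Proof. by case: i => [j|] //=; rewrite mxE. Qed.

Lemma differentiable_retr (p : amb) : 0 < dotp p.1 p.1 -> differentiable (@retr R) p.
Proof.
move=> p0; apply: differentiable_ambient => i.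
have -> : crd i \o retr = fun q => if i is Some j then nrm q * crd (Some j) q else crd None q.
  by apply/funext => q /=; rewrite crd_retr.
case: i => [j|]; last exact: (differentiable_crd_id None).
apply: (@differentiableM _ _ (nrm : amb -> R^o) (crd (Some j))); first exact: differentiable_nrm.
exact: (differentiable_crd_id (Some j)).
Qed.
Lemma derive_dotp_sqr (p v : amb) : 'D_v (fun q : amb => dotp q.1 q.1 : R^o) p = 2 * dotp p.1 v.1.
Proof.
have -> : (fun q : amb => dotp q.1 q.1 : R^o) = \sum_(i < 3) (crd (Some i) * crd (Some i)).
  by apply/funext => q; rewrite fct_sumE.
have d i x : derivable (@crd R i) x v.
  by apply: diff_derivable; exact: differentiable_crd_id.
rewrite derive_sum => [|i]; last exact: derivableM.
rewrite /dotp mulr_sumr; apply: eq_bigr => i _.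
by rewrite deriveM // derive_crd_id /GRing.scale /= mulr2n mulrDl mul1r mulrC.
Qed.

(** Along a tangent direction the length of the R^3 component is stationary, its square having
    derivative 2 <p, v> = 0, so the normalising factor stays equal to 1 to first order. *)
Lemma derive_retr (p v : amb) : S2R p -> tangent p v -> 'D_v (@retr R) p = v.
Proof.
move=> Sp tv; have p0 := S2R_gt0 Sp; have dr := differentiable_retr p0.
apply: crd_inj => i; rewrite -derive_crd //.
have -> : crd i \o retr = fun q => if i is Some j then nrm q * crd (Some j) q else crd None q.
  by apply/funext => q /=; rewrite crd_retr.
case: i => [j|]; last by rewrite -[LHS]/('D_v (crd None) p) derive_crd_id.
have dN : 'D_v (nrm : amb -> R^o) p = 0.
  have -> : (nrm : amb -> R^o) = inv_sqrt \o (fun q => dotp q.1 q.1) by [].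
  have d1 := differentiable_dotp_sqr p.
  have d2 : differentiable inv_sqrt (dotp p.1 p.1) by exact/derivable1_diffP/derivable_inv_sqrt.
  rewrite deriveE; last exact: differentiable_comp.
  rewrite (diff_comp d1 d2) /= -(deriveE _ d1) derive_dotp_sqr tv mulr0.
  exact: linear0.
rewrite -[LHS]/('D_v ((nrm : amb -> R^o) * crd (Some j)) p) deriveM.
- by rewrite dN scaler0 addr0 derive_crd_id /nrm Sp sqrtr1 invr1 scale1r.
- by apply: diff_derivable; exact: differentiable_nrm.
- by apply: diff_derivable; exact: differentiable_crd_id.
Qed.

(** [retr] takes values in the submanifold, so composing with it turns an equality known only there
    into one on an ambient neighbourhood, where derivatives can be compared. *)
Lemma near_retr (W : normedModType R) (U : set amb) (f F : amb -> W) (p : amb) : S2R p ->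
  open U -> U p ->
  (forall q, U q -> S2R q -> F q = f q) -> \forall q \near p, F (retr q) = f (retr q).
Proof.
move=> Sp oU Up E.
have cr : retr q @[q --> p] --> retr p.
  exact/differentiable_continuous/differentiable_retr/S2R_gt0.
have nU : \forall q \near p, U (retr q).
  by apply: cr; rewrite retr_S2R //; exact: open_nbhs_nbhs.
have n0 := near_dotp_gt0 (S2R_gt0 Sp).
near=> q; apply: E; first by near: q.
by apply: S2R_retr; near: q.
Unshelve. all: by end_near. Qed.

Lemma differentiable_retr_comp W (f : amb -> W) p : smooth_S2R f -> S2R p ->
  differentiable (f \o retr) p.
Proof.
move=> sf Sp; have [U [F [oU Up sF E]]] := sf p Sp.
apply: near_eq_differentiable (near_retr Sp oU Up E) _.
apply: differentiable_comp; first exact/differentiable_retr/S2R_gt0.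
by rewrite retr_S2R //; exact: (smooth_onP sF).1.
Qed.

Lemma der_ext W (f g : amb -> W) p v : S2R p -> eq_on_S2R f g -> der f p v = der g p v.
Proof.
move=> Sp fg; apply: near_eq_derive.
by apply: (near_retr (U := setT)) => //; [exact: openT|move=> q _ /fg].
Qed.

(** Chain rule for F o retr, the derivative of [retr] being the identity on tangent vectors. *)
Lemma der_extension W (f F : amb -> W) (U : set amb) p v : S2R p -> open U -> U p ->
  differentiable F p -> (forall q, U q -> S2R q -> F q = f q) -> tangent p v ->
  der f p v = 'D_v F p.
Proof.
move=> Sp oU Up dF E tv.
rewrite /der -(near_eq_derive _ (near_retr Sp oU Up E)).
have dr := differentiable_retr (S2R_gt0 Sp).
have dF' : differentiable F (retr p) by rewrite retr_S2R.
rewrite deriveE; last exact: differentiable_comp.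
by rewrite (diff_comp dr dF') /= -(deriveE _ dr) derive_retr // retr_S2R // deriveE.
Qed.

Lemma der_linear W (f : amb -> W) p (a : R) u v : smooth_S2R f -> S2R p ->
  der f p (a *: u + v) = a *: der f p u + der f p v.
Proof.
move=> sf Sp; have df := differentiable_retr_comp sf Sp.
by rewrite /der !deriveE // linearP.
Qed.

Lemma der_cst W (w : W) p v : der (fun=> w) p v = 0.
Proof. exact: derive_cst. Qed.

Lemma derD W (f g : amb -> W) p v : smooth_S2R f -> smooth_S2R g -> S2R p ->
  der (fun q => f q + g q) p v = der f p v + der g p v.
Proof.
move=> sf sg Sp.
rewrite -[LHS]/('D_v ((f \o retr) + (g \o retr)) p) deriveD //;
  by apply: diff_derivable; exact: differentiable_retr_comp.
Qed.

Lemma der_sum W (I : Type) (r : seq I) (f : I -> amb -> W) p v :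
  (forall i, smooth_S2R (f i)) -> S2R p ->
  der (fun q => \sum_(i <- r) f i q) p v = \sum_(i <- r) der (f i) p v.
Proof.
move=> H Sp; elim: r => [|i r ih].
  rewrite big_nil; have -> : (fun q => \sum_(i <- [::]) f i q) = (fun=> 0).
    by apply/funext => q; rewrite big_nil.
  exact: der_cst.
have -> : (fun q => \sum_(i <- i :: r) f i q) = (fun q => f i q + \sum_(i <- r) f i q).
  by apply/funext => q; rewrite big_cons.
by rewrite derD // ?ih ?big_cons //; exact: smooth_S2R_sum.
Qed.

Lemma derM (f g : amb -> R^o) p v : smooth_S2R f -> smooth_S2R g -> S2R p ->
  der (fun q => f q * g q : R^o) p v = der f p v * g p + f p * der g p v :> R.
Proof.
move=> sf sg Sp.
rewrite -[LHS]/('D_v ((f \o retr) * (g \o retr)) p) deriveM;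
  [|by apply: diff_derivable; exact: differentiable_retr_comp..].
by rewrite /GRing.scale /= !retr_S2R // addrC [der f p v * _]mulrC.
Qed.

Lemma der_crd i (f : amb -> amb) p v : smooth_S2R f -> S2R p ->
  der (fun q => crd i (f q)) p v = crd i (der f p v).
Proof.
by move=> sf Sp; rewrite /der -derive_crd //; exact: differentiable_retr_comp.
Qed.

Lemma derZ (f : amb -> R^o) (g : amb -> amb) p v : smooth_S2R f -> smooth_S2R g -> S2R p ->
  der (fun q => f q *: g q) p v = (der f p v : R) *: g p + f p *: der g p v.
Proof.
move=> sf sg Sp; apply: crd_inj => i.
rewrite -der_crd //; last exact: smooth_S2RZ.
rewrite linearD !linearZ /= -(der_crd i) //.
have -> : (fun q => crd i (f q *: g q)) = (fun q => f q * crd i (g q)).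
  by apply/funext => q; rewrite linearZ.
by rewrite derM //; exact: smooth_S2R_crd.
Qed.

Lemma derN (g : amb -> amb) p v : smooth_S2R g -> S2R p ->
  der (fun q => - g q) p v = - der g p v.
Proof.
move=> sg Sp; have -> : (fun q => - g q) = (fun q => (-1 : R^o) *: g q).
  by apply/funext => q; rewrite scaleN1r.
rewrite (derZ v (smooth_S2R_cst (-1 : R^o)) sg Sp) der_cst scale0r add0r.
by rewrite scaleN1r.
Qed.

Lemma derB (f g : amb -> amb) p v : smooth_S2R f -> smooth_S2R g -> S2R p ->
  der (fun q => f q - g q) p v = der f p v - der g p v.
Proof. by move=> sf sg Sp; rewrite derD ?derN //; exact: smooth_S2RN. Qed.

Lemma der_id (p v : amb) : S2R p -> tangent p v -> der id p v = v.
Proof.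
move=> Sp tv; rewrite (der_extension (F := id) (U := setT) Sp openT) //.
by rewrite derive_id.
Qed.

Lemma der_dotp (f g : amb -> amb) p v : smooth_S2R f -> smooth_S2R g -> S2R p ->
  der (fun q => dotp (f q).1 (g q).1 : R^o) p v
  = dotp (der f p v).1 (g p).1 + dotp (f p).1 (der g p v).1.
Proof.
move=> sf sg Sp.
rewrite (@der_sum R^o _ _ (fun (i : 'I_3) q => (f q).1 i 0 * (g q).1 i 0 : R^o)) // => [|i].
  rewrite /dotp -big_split; apply: eq_bigr => i _ /=.
  rewrite (derM v (smooth_S2R_crd (Some i) sf) (smooth_S2R_crd (Some i) sg) Sp).
  by rewrite !der_crd.
exact: smooth_S2RM (smooth_S2R_crd (Some i) sf) (smooth_S2R_crd (Some i) sg).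
Qed.

Lemma der_cross (f g : amb -> amb) p v : smooth_S2R f -> smooth_S2R g -> S2R p ->
  der (fun q => (cross (f q).1 (g q).1, 0) : amb) p v
  = (cross (der f p v).1 (g p).1 + cross (f p).1 (der g p v).1, 0).
Proof.
move=> sf sg Sp; have sc := smooth_S2R_cross sf sg.
apply: crd_inj => -[i|]; rewrite -der_crd //=; last exact: der_cst.
have sfi j := smooth_S2R_crd (Some j) sf; have sgi j := smooth_S2R_crd (Some j) sg.
have dfi j : der (fun q => (f q).1 j 0 : R^o) p v = (der f p v).1 j 0.
  exact: (der_crd (Some j) v sf Sp).
have dgi j : der (fun q => (g q).1 j 0 : R^o) p v = (der g p v).1 j 0.
  exact: (der_crd (Some j) v sg Sp).
have -> : (fun q => cross (f q).1 (g q).1 i 0 : R^o) = (fun q => (f q).1 (i + 1) 0 * (g q).1 (i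
  + 2) 0
    + (-1) * ((f q).1 (i + 2) 0 * (g q).1 (i + 1) 0) : R^o).
  by apply/funext => q; rewrite !mxE mulN1r.
rewrite derD //; [|exact: smooth_S2RM (sfi _) (sgi _)|
  exact: (smooth_S2RM (smooth_S2R_cst (-1 : R^o)) (smooth_S2RM (sfi _) (sgi _)))].
rewrite (derM v (sfi _) (sgi _) Sp).
rewrite (derM v (smooth_S2R_cst (-1 : R^o)) (smooth_S2RM (sfi _) (sgi _)) Sp) der_cst.
rewrite (derM v (sfi _) (sgi _) Sp) !dfi !dgi !mxE.
have aux (a b c d a' b' c' d' : R) : a' * d + a * d' + (0 * (c * b) + (-1) * (c' * b + c * b'))
  = (a' * d - c' * b) + (a * d' - c * b') by ring.
exact: aux.
Qed.

End Der.

(** * The Levi-Civita connection *)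

Section Connection.
Context {R : realType}.
Local Notation amb := (ambient R).
Local Notation fields := (amb -> amb).

Lemma tangentE (p u : amb) : tangent p u -> dotp p.1 u.1 = 0.
Proof. by []. Qed.

Lemma tangent_linear (p u v : amb) (a : R) : tangent p u -> tangent p v -> tangent p (a *: u + v).
Proof. by move=> tu tv; rewrite /tangent /= dotpDr dotpZr tu tv mulr0 addr0. Qed.

Lemma tangentB (p u v : amb) : tangent p u -> tangent p v -> tangent p (u - v).
Proof. by move=> tu tv; rewrite /tangent /= dotpDr dotpNr tu tv subr0. Qed.

Lemma vfield_smooth (X : fields) : vfield X -> smooth_S2R X.
Proof. by case. Qed.

Lemma vfield_tangent (X : fields) p : vfield X -> S2R p -> tangent p (X p).
Proof. by case=> _; apply. Qed.

(** With local extensions F of f and G of X, the derivative is the sum of the products of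
    coordinates of G and partial derivatives of F, and this expression is smooth on an open set. *)
Lemma smooth_act_on_scalar (X : fields) (f : amb -> R^o) :
  vfield X -> smooth_S2R f -> smooth_S2R (act_on X f).
Proof.
move=> [sX tX] sf p Sp.
have [U [F [oU Up sF EF]]] := sf p Sp; have [U' [G [oU' Up' sG EG]]] := sX p Sp.
have [dF DF] := smooth_onP sF.
exists (U `&` U'), (fun q => \sum_i crd i (G q) * 'D_(bas i) F q : R^o); split.
- exact: openI.
- by [].
- move=> k; apply: (@Ck_sum _ _ R^o _ _ _ _ (fun i q => crd i (G q) * 'D_(bas i) F q : R^o));
  first exact: openI.
  move=> i; apply: CkM; first exact: openI.
    by apply: Ck_crd_comp; [exact: openI|apply: Ck_sub (sG k); exact: subIsetr].
  by apply: Ck_sub (DF _ k); exact: subIsetl.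
- move=> q [Uq Uq'] Sq; rewrite /act_on (der_extension Sq oU Uq (dF q Uq) EF (tX q Sq)).
  by rewrite derive_sum_bas; [rewrite EG|exact: dF].
Qed.

Lemma smooth_act_on (X Y : fields) : vfield X -> smooth_S2R Y -> smooth_S2R (act_on X Y).
Proof.
move=> vX sY; apply: smooth_S2R_ambient => i.
apply: (@smooth_S2R_ext _ _ (act_on X (fun q => crd i (Y q)))).
  by move=> q Sq; rewrite /act_on der_crd.
by apply: smooth_act_on_scalar => //; exact: smooth_S2R_crd.
Qed.

Lemma act_on_ext (W : normedModType R) (X X' : fields) (f f' : amb -> W) :
  eq_on_S2R X X' -> eq_on_S2R f f' -> eq_on_S2R (act_on X f) (act_on X' f').
Proof. by move=> XX' ff' p Sp; rewrite /act_on XX' //; exact: der_ext. Qed.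

(** A second derivative splits into a first derivative along [der X p v] and the Hessian of F. The
    Hessian is symmetric, so a commutator retains only the first-order part, which is the Lie
    bracket. *)
Lemma der_act_on (U : set amb) (F f : amb -> R^o) (X : fields) p v :
  open U -> U p -> smooth_on U F -> (forall q, U q -> S2R q -> F q = f q) ->
  vfield X -> S2R p -> tangent p v ->
  der (act_on X f) p v = 'D_(der X p v) F p +
      \sum_i \sum_j crd i (X p) * (crd j v * 'D_(bas j) ('D_(bas i) F) p).
Proof.
move=> oU Up sF EF [sX tX] Sp tv.
have [dF DF] := smooth_onP sF.
have [U' [G [oU' Up' sG EG]]] := sX p Sp.
have E q : (U `&` U') q -> S2R q -> \sum_i crd i (G q) * 'D_(bas i) F q = act_on X f q.
  move=> [Uq Uq'] Sq; rewrite /act_on (der_extension Sq oU Uq (dF q Uq) EF (tX q Sq)).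
  by rewrite derive_sum_bas; [rewrite EG|exact: dF].
have dG := (smooth_onP sG).1 p Up'.
have dcG i : differentiable (crd i \o G) p by exact: differentiable_crd.
have dDF i : differentiable ('D_(bas i) F) p by exact: (smooth_onP (DF (bas i))).1.
pose T i := ((crd i \o G) * ('D_(bas i) F : amb -> R^o)).
have dT i : differentiable (T i) p by exact: differentiableM.
have ET : (fun q => \sum_i crd i (G q) * 'D_(bas i) F q : R^o) = \sum_i T i.
  by apply/funext => q; rewrite fct_sumE.
have dsum : differentiable (\sum_i T i) p.
  elim/big_ind : _ => [||i _]; [exact: differentiable_cst|by move=> f1 g1;
    exact: differentiableD|exact: dT].
rewrite (der_extension (F := \sum_i T i) Sp (openI oU oU') (conj Up Up') dsum) => //; last first.
  by rewrite -ET.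
have dX : der X p v = 'D_v G p by exact: der_extension EG tv.
rewrite dX (derive_sum_bas ('D_v G p) (dF p Up)) -big_split /=.
have -> : 'D_v (\sum_i T i) p = \sum_i 'D_v (T i) p.
  have : forall r, derivable (\sum_(i <- r) T i) p v /\ 'D_v (\sum_(i <- r) T i) p = \sum_(i <-
    r) 'D_v (T i) p.
    elim=> [|i r [ih1 ih2]].
      by rewrite !big_nil; split; [exact: derivable_cst|exact: derive_cst].
    have dTi : derivable (T i) p v by exact: diff_derivable.
    rewrite !big_cons; split; first exact: derivableD.
    exact: etrans (deriveD dTi ih1) (congr1 _ ih2).
  by move=> /(_ (index_enum _)) [].
apply: eq_bigr => i _.
rewrite deriveM; [|exact: diff_derivable..].
rewrite derive_crd // addrC; congr (_ + _); last by rewrite /GRing.scale /= mulrC.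
by rewrite (derive_sum_bas v (dDF i)) scaler_sumr /= EG.
Qed.

(** Differentiate the tangency relation <q, Y q> = 0. The right-hand side is the second fundamental
    form of the sphere with respect to the outer normal. *)
Lemma dotp_der_vfield (Y : fields) p v : vfield Y -> S2R p -> tangent p v ->
  dotp p.1 (der Y p v).1 = - dotp v.1 (Y p).1.
Proof.
move=> vY Sp tv; have sY := vfield_smooth vY.
have := der_dotp v smooth_S2R_id sY Sp.
rewrite der_id // (der_ext (g := fun=> 0) _ Sp); last by move=> q Sq; exact: (vfield_tangent vY).
by rewrite der_cst => /esym/eqP; rewrite addrC addr_eq0 => /eqP.
Qed.

(** The normal components of the two derivatives cancel because the second fundamental form is
    symmetric. *)
Lemma tangent_lie_bracket (X Y : fields) p : vfield X -> vfield Y -> S2R p ->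
  tangent p (lie_bracket X Y p).
Proof.
move=> vX vY Sp; have tX := vfield_tangent vX Sp; have tY := vfield_tangent vY Sp.
have eY := dotp_der_vfield vY Sp tX; have eX := dotp_der_vfield vX Sp tY.
have dotpB (x a b : 'cV[R]_3) : dotp x (a - b) = dotp x a - dotp x b by rewrite dotpDr dotpNr.
apply: etrans (dotpB p.1 (der Y p (X p)).1 (der X p (Y p)).1) _.
apply: etrans (congr2 (fun a b : R => a - b) eY eX) _.
by rewrite (dotpC (X p).1) subrr.
Qed.

Lemma vfield_lie_bracket (X Y : fields) : vfield X -> vfield Y -> vfield (lie_bracket X Y).
Proof.
move=> vX vY; split; last by move=> p; exact: tangent_lie_bracket.
by apply: smooth_S2RB; apply: smooth_act_on => //; exact: vfield_smooth.
Qed.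

Lemma act_on_commutator_scalar (X Y : fields) (f : amb -> R^o) p :
  vfield X -> vfield Y -> smooth_S2R f -> S2R p ->
  act_on X (act_on Y f) p - act_on Y (act_on X f) p = act_on (lie_bracket X Y) f p.
Proof.
move=> vX vY sf Sp; have tX := vfield_tangent vX Sp; have tY := vfield_tangent vY Sp.
have [U [F [oU Up sF EF]]] := sf p Sp.
have dF := (smooth_onP sF).1 p Up.
rewrite {1 3 5}/act_on (der_act_on oU Up sF EF vY Sp tX) (der_act_on oU Up sF EF vX Sp tY).
rewrite (der_extension Sp oU Up dF EF (tangent_lie_bracket vX vY Sp)).
have dB (u v : amb) : 'D_(u - v) F p = 'D_u F p - 'D_v F p by rewrite !deriveE // linearB.
rewrite /lie_bracket dB.
have aux (a b s t : R) : s = t -> a + s - (b + t) = a - b by move=> ->; ring.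
apply: aux.
rewrite exchange_big /=; apply: eq_bigr => i _; apply: eq_bigr => j _.
by rewrite (derive_comm _ _ oU Up (sF 2%N)) mulrCA.
Qed.

Lemma act_on_commutator (X Y Z : fields) p :
  vfield X -> vfield Y -> smooth_S2R Z -> S2R p ->
  act_on X (act_on Y Z) p - act_on Y (act_on X Z) p = act_on (lie_bracket X Y) Z p.
Proof.
move=> vX vY sZ Sp.
have H (X' Y' : fields) i : vfield X' -> vfield Y' ->
    crd i (act_on X' (act_on Y' Z) p) = act_on X' (act_on Y' (fun q => crd i (Z q))) p.
  move=> vX' vY'; rewrite {1 3}/act_on -der_crd //; last exact: smooth_act_on.
  by apply: der_ext => // q Sq; rewrite /act_on der_crd.
have crdB i (u v : amb) : crd i (u - v) = crd i u - crd i v by exact: raddfB.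
apply: crd_inj => i.
have E := act_on_commutator_scalar vX vY (smooth_S2R_crd i sZ) Sp.
apply: etrans (crdB _ _ _) _.
apply: etrans (congr2 (fun a b : R^o => a - b) (H X Y i vX vY) (H Y X i vY vX)) _.
by apply: etrans E _; exact: der_crd.
Qed.

Definition tproj (p w : amb) : amb := (w.1 - dotp p.1 w.1 *: p.1, w.2).

(** Applied to a tangent vector this is its component along the sphere; applied to the point p
    itself it is the unit normal of the submanifold at p. *)
Definition hor (w : amb) : amb := (w.1, 0).

Definition nabla (X Y : fields) : fields := fun p => tproj p (act_on X Y p).

Lemma tprojE (p w : amb) : tproj p w = w - dotp p.1 w.1 *: hor p.
Proof. by case: w => w a; rewrite /tproj /hor; congr pair; rewrite /= scaler0 subr0. Qed.

Lemma tangent_tproj (p w : amb) : S2R p -> tangent p (tproj p w).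
Proof. by move=> Sp; rewrite /tangent /tproj /= dotpDr dotpNr dotpZr Sp mulr1 subrr. Qed.

Lemma tproj_tangent (p w : amb) : tangent p w -> tproj p w = w.
Proof. by move=> tw; rewrite tprojE tw scale0r subr0. Qed.

Fact tproj_is_linear (p : amb) : linear (tproj p).
Proof.
move=> a u v; rewrite !tprojE /= dotpDr dotpZr scalerDl -scalerA scalerBr.
by rewrite opprD addrACA.
Qed.

HB.instance Definition _ p := GRing.isLinear.Build R amb amb _ (tproj p) (tproj_is_linear p).

Fact hor_is_linear : linear hor.
Proof. by move=> a u v; rewrite /hor; congr pair; rewrite /= scaler0 addr0. Qed.

HB.instance Definition _ := GRing.isLinear.Build R amb amb _ hor hor_is_linear.

Lemma smooth_hor (f : amb -> amb) : smooth_S2R f -> smooth_S2R (fun q => hor (f q)).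
Proof.
move=> sf; apply: smooth_S2R_ambient => -[i|]; last exact: smooth_S2R_cst.
exact: (smooth_S2R_crd (Some i) sf).
Qed.

Lemma smooth_tproj (f : amb -> amb) : smooth_S2R f -> smooth_S2R (fun q => tproj q (f q)).
Proof.
move=> sf; apply: (@smooth_S2R_ext _ _ (fun q => f q - (dotp q.1 (f q).1 : R^o) *: hor q)).
  by move=> q _; rewrite tprojE.
apply: smooth_S2RB => //; apply: smooth_S2RZ; last exact: smooth_hor smooth_S2R_id.
exact: smooth_S2R_dotp smooth_S2R_id sf.
Qed.

Lemma vfield_tproj (f : amb -> amb) : smooth_S2R f -> vfield (fun q => tproj q (f q)).
Proof. by move=> sf; split; [exact: smooth_tproj|move=> p; exact: tangent_tproj]. Qed.

Lemma vfield_nabla X Y : vfield X -> vfield Y -> vfield (nabla X Y).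
Proof. by move=> vX vY; apply: vfield_tproj; apply: smooth_act_on => //;
  exact: vfield_smooth. Qed.

Lemma der_hor (f : amb -> amb) p v : smooth_S2R f -> S2R p ->
  der (fun q => hor (f q)) p v = hor (der f p v).
Proof.
move=> sf Sp; apply: crd_inj => i; rewrite -der_crd //; last exact: smooth_hor.
case: i => [i|]; last exact: der_cst.
exact: (der_crd (Some i) v sf Sp).
Qed.

Lemma metricC (u v : amb) : metric u v = metric v u.
Proof. by rewrite /metric dotpC mulrC. Qed.

Lemma metric_linear (a : R) (u v w : amb) : metric (a *: u + v) w = a * metric u w + metric v w.
Proof.
rewrite /metric /= dotpDl dotpZl.
have aux (x y u2 v2 w2 : R) : a * x + y + (a * u2 + v2) * w2 = a * (x + u2 * w2) + (y + v2 * w2).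
  by ring.
exact: aux.
Qed.

Lemma metric_tproj (p u w : amb) : tangent p u -> metric (tproj p w) u = metric w u.
Proof.
move=> tu; rewrite /metric /tproj /= dotpDl dotpNl dotpZl.
by rewrite (tangentE tu) mulr0 subr0.
Qed.

Lemma metric_eq0 (u : amb) : (metric u u == 0) = (u == 0).
Proof.
rewrite /metric -expr2 paddr_eq0 ?dotp_ge0 ?sqr_ge0 // dotp_eq0 sqrf_eq0.
by case: u => u a.
Qed.

Lemma der_metric (f g : amb -> amb) p v : smooth_S2R f -> smooth_S2R g -> S2R p ->
  der (fun q => metric (f q) (g q) : R^o) p v = metric (der f p v) (g p) + metric (f p) (der g p
    v).
Proof.
move=> sf sg Sp.
have s1 := smooth_S2R_dotp sf sg.
have s2 := smooth_S2RM (smooth_S2R_crd None sf) (smooth_S2R_crd None sg).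
rewrite (derD v s1 s2 Sp) der_dotp // (derM v (smooth_S2R_crd None sf) (smooth_S2R_crd None sg)
  Sp).
by rewrite !der_crd // addrACA.
Qed.

Lemma nabla_affine_connection : affine_connection nabla.
Proof.
split.
- exact: vfield_nabla.
- move=> X X' Y Y' vX vX' vY vY' XX' YY' p Sp.
  by rewrite /nabla (act_on_ext XX' YY').
- move=> f X X' Y sf vX vX' vY p Sp.
  by rewrite /nabla /act_on der_linear //; [exact: linearP|exact: vfield_smooth].
- move=> X Y Y' vX vY vY' p Sp.
  rewrite /nabla /act_on derD; [exact: linearD|exact: vfield_smooth..|by []].
- move=> f X Y sf vX vY p Sp.
  rewrite /nabla /act_on derZ //; last exact: vfield_smooth.
  by rewrite linearP linearZ /= tproj_tangent //; exact: vfield_tangent.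
Qed.

Lemma nabla_torsion_free : torsion_free nabla.
Proof.
move=> X Y vX vY p Sp; rewrite /nabla -linearB /=.
by rewrite -[act_on X Y p - _]/(lie_bracket X Y p) tproj_tangent //; exact: tangent_lie_bracket.
Qed.

Lemma nabla_parallel_metric : parallel_metric nabla.
Proof.
move=> X Y Z vX vY vZ p Sp.
rewrite /act_on der_metric //; [|exact: vfield_smooth..].
rewrite /nabla metric_tproj; last exact: vfield_tangent.
by rewrite [in RHS](metricC (Y p)) metric_tproj ?(metricC (Y p)) //; exact: vfield_tangent.
Qed.

Lemma nabla_levi_civita : levi_civita nabla.
Proof.
by split; [exact: nabla_affine_connection|exact: nabla_torsion_free|exact: nabla_parallel_metric].
Qed.

End Connection.

(** * Dot and cross products in R^3 *)

Section Vector3.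
Context {R : realType}.
Implicit Types x y z : 'cV[R]_3.

Lemma ord3_case (P : 'I_3 -> Prop) : P 0 -> P 1 -> P 2 -> forall i, P i.
Proof.
move=> P0 P1 P2 [[|[|[|//]]] i3].
- by rewrite (_ : Ordinal i3 = 0) //; exact: val_inj.
- by rewrite (_ : Ordinal i3 = 1) //; exact: val_inj.
- by rewrite (_ : Ordinal i3 = 2) //; exact: val_inj.
Qed.

Lemma cV3P x y : x 0 0 = y 0 0 -> x 1 0 = y 1 0 -> x 2 0 = y 2 0 -> x = y.
Proof.
move=> e0 e1 e2; apply/matrixP => i j; rewrite ord1.
by elim/ord3_case: i.
Qed.

Lemma sum3E (F : 'I_3 -> R) : \sum_i F i = F 0 + F 1 + F 2.
Proof.
rewrite !big_ord_recl big_ord0 addr0 addrA.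
by congr (F _ + F _ + F _); exact: val_inj.
Qed.

Lemma dotpE x y : dotp x y = x 0 0 * y 0 0 + x 1 0 * y 1 0 + x 2 0 * y 2 0.
Proof. exact: sum3E. Qed.

Lemma cross0E x y : cross x y 0 0 = x 1 0 * y 2 0 - x 2 0 * y 1 0.
Proof. by rewrite mxE !add0r. Qed.

Lemma cross1E x y : cross x y 1 0 = x 2 0 * y 0 0 - x 0 0 * y 2 0.
Proof.
rewrite mxE; have -> : 1 + 1 = 2 :> 'I_3 by exact: val_inj.
by have -> : 1 + 2 = 0 :> 'I_3 by exact: val_inj.
Qed.

Lemma cross2E x y : cross x y 2 0 = x 0 0 * y 1 0 - x 1 0 * y 0 0.
Proof.
rewrite mxE; have -> : 2 + 1 = 0 :> 'I_3 by exact: val_inj.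
by have -> : 2 + 2 = 1 :> 'I_3 by exact: val_inj.
Qed.

Definition vec3E := (cross0E, cross1E, cross2E, dotpE, mxE).

Lemma cross_cross x y z : cross x (cross y z) = dotp x z *: y - dotp x y *: z.
Proof. by apply: cV3P; rewrite !vec3E; ring. Qed.

Lemma dotp_cross_l x y : dotp x (cross x y) = 0.
Proof. by rewrite !vec3E; ring. Qed.

Lemma dotp_cross_r x y : dotp y (cross x y) = 0.
Proof. by rewrite !vec3E; ring. Qed.

Lemma dotp_cross_skew x y z : dotp (cross x y) z = - dotp y (cross x z).
Proof. by rewrite !vec3E; ring. Qed.

Lemma cross_linear (a : R) x y z : cross x (a *: y + z) = a *: cross x y + cross x z.
Proof. by apply: cV3P; rewrite !vec3E; ring. Qed.

Lemma crossxx x : cross x x = 0.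
Proof. by apply: cV3P; rewrite !vec3E; ring. Qed.

Lemma cross0r x : cross x 0 = 0.
Proof. by apply: cV3P; rewrite !vec3E; ring. Qed.

Lemma dotp_cross_cross p x y : dotp p p = 1 -> dotp p x = 0 ->
  dotp (cross p x) (cross p y) = dotp x y.
Proof.
move=> pp px; rewrite dotp_cross_skew cross_cross dotpDr dotpNr !dotpZr pp.
by rewrite (dotpC x p) px mulr0 mul1r sub0r opprK.
Qed.

(** By the triple product formula p x (x x y) vanishes, both factors being orthogonal to p; applying
    p x (.) once more, the same formula leaves the multiple of p. *)
Lemma cross_normal p x y : dotp p p = 1 -> dotp p x = 0 -> dotp p y = 0 ->
  cross x y = dotp p (cross x y) *: p.
Proof.
move=> pp px py; have E : cross p (cross x y) = 0.
  by rewrite cross_cross px py !scale0r subr0.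
have := cross_cross p p (cross x y); rewrite E cross0r pp scale1r.
by move=> /esym/eqP; rewrite subr_eq0 => /eqP ->.
Qed.

End Vector3.

(** * Uniqueness and curvature of the Levi-Civita connection *)

Section Geometry.
Context {R : realType}.
Local Notation amb := (ambient R).
Local Notation fields := (amb -> amb).

Implicit Types (X Y Z U : fields) (p q : amb).

(** The coordinate [crd], but with values in R instead of R^o: rewriting with [ambE] then reduces a
    vector identity to scalar ones within reach of [ring]. *)
Definition entry (i : option 'I_3) (u : amb) : R := crd i u.

Lemma entryP (u v : amb) : (forall i, entry i u = entry i v) -> u = v.
Proof. exact: crd_inj. Qed.

Lemma entryD i (u v : amb) : entry i (u + v) = entry i u + entry i v.
Proof. exact: raddfD (crd i) u v. Qed.

Lemma entryN i (u : amb) : entry i (- u) = - entry i u.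
Proof. exact: raddfN (crd i) u. Qed.

Lemma entryZ i (a : R) (u : amb) : entry i (a *: u) = a * entry i u.
Proof. by case: i => [j|] //; rewrite /entry /= mxE. Qed.

Lemma entry0 i : entry i 0 = 0.
Proof. exact: raddf0 (crd i). Qed.

Definition ambE := (entryD, entryN, entryZ, entry0).

(** The difference of the two connections, paired with a third field, is symmetric in its first two
    arguments by vanishing torsion and skew in its last two by compatibility with the metric.
    Alternating the two exchanges three times returns to the start with the opposite sign. The
    difference is finally paired with itself. *)
Lemma levi_civita_unique (D : fields -> fields -> fields) X Y : levi_civita D ->
  vfield X -> vfield Y -> eq_on_S2R (D X Y) (nabla X Y).
Proof.
move=> [cD tD mD] vX vY.
have vD A B : vfield A -> vfield B -> vfield (D A B) by exact: (conn_field cD).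
pose A (X Y : fields) : fields := fun p => D X Y p - nabla X Y p.
have vA B C : vfield B -> vfield C -> vfield (A B C).
  move=> vB vC; have [sD tgD] := vD _ _ vB vC; have [sn tn] := vfield_nabla vB vC.
  split; first exact: smooth_S2RB.
  by move=> q Sq; apply: tangentB; [exact: tgD|exact: tn].
move=> p Sp.
pose a (X Y Z : fields) : R := metric (A X Y p) (Z p).
have mB u v w : metric (u - v) w = metric u w - metric v w :> R.
  by rewrite addrC -scaleN1r metric_linear mulN1r addrC.
have asym B C E : vfield B -> vfield C -> vfield E -> a B C E = a C B E.
  move=> vB vC vE; rewrite /a; suff -> : A B C p = A C B p by [].
  have aux (V : zmodType) (u v u' v' : V) : u - v = u' - v' -> u - u' = v - v'.
    by move=> /eqP; rewrite subr_eq => /eqP ->; rewrite -[u' - v' + v]addrA addrAC subrr add0r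
      addrC.
  by apply: aux; rewrite (tD B C vB vC p Sp) -(nabla_torsion_free vB vC Sp).
have askew B C E : vfield B -> vfield C -> vfield E -> a B C E = - a B E C.
  move=> vB vC vE; have := nabla_parallel_metric vB vC vE Sp.
  rewrite (mD B C E vB vC vE p Sp) /= => e.
  have e1 : a B C E = metric (D B C p) (E p) - metric (nabla B C p) (E p) by exact: mB.
  have e2 : a B E C = metric (C p) (D B E p) - metric (C p) (nabla B E p).
    by rewrite !(metricC (C p)); exact: mB.
  rewrite e1 e2; clear -e; lra.
have a0 E : vfield E -> a X Y E = 0.
  move=> vE.
  have aux (a1 a2 a3 a4 a5 a6 : R) : a1 = a2 -> a2 = - a3 -> a3 = a4 -> a4 = - a5 ->
    a5 = a6 -> a6 = - a1 -> a1 = 0 by lra.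
  exact: aux (asym X Y E vX vY vE) (askew Y X E vY vX vE) (asym Y E X vY vE vX)
    (askew E Y X vE vY vX) (asym E X Y vE vX vY) (askew X E Y vX vE vY).
have /eqP := a0 _ (vA _ _ vX vY).
by rewrite /a metric_eq0 /A subr_eq0 => /eqP.
Qed.

(* The value R(x, y)z of the curvature tensor: constant curvature 1 on the sphere factor,
   flat along the line. *)
Definition Rc (x y z : amb) : amb := dotp y.1 z.1 *: hor x - dotp x.1 z.1 *: hor y.

Lemma tproj_hor (p : amb) : S2R p -> tproj p (hor p) = 0.
Proof. by move=> Sp; rewrite tprojE /= Sp scale1r subrr. Qed.

Lemma nabla_hor X Y p : vfield X -> vfield Y -> S2R p ->
  nabla X (fun q => hor (Y q)) p = hor (nabla X Y p).
Proof.
move=> vX vY Sp; rewrite /nabla /act_on der_hor //; exact: vfield_smooth.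
Qed.

Lemma vfield_hor X : vfield X -> vfield (fun q => hor (X q)).
Proof. by move=> [sX tX]; split; [exact: smooth_hor|move=> p Sp; exact: (tX p Sp)]. Qed.

(** By the Gauss formula nabla_Y Z is the ambient derivative plus <Y, Z> times the unit normal.
    Differentiating this product along X, the derivative of the coefficient multiplies the normal
    and is projected away, while the derivative of the normal is the horizontal part of X. *)
Lemma nabla_nabla X Y Z p : vfield X -> vfield Y -> vfield Z -> S2R p ->
  nabla X (nabla Y Z) p =
  tproj p (act_on X (act_on Y Z) p) + dotp (Y p).1 (Z p).1 *: hor (X p).
Proof.
move=> vX vY vZ Sp.
have sA : smooth_S2R (act_on Y Z) by apply: smooth_act_on => //; exact: vfield_smooth.
have sd : smooth_S2R (fun q => dotp (Y q).1 (Z q).1 : R^o).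
  by apply: smooth_S2R_dotp; exact: vfield_smooth.
have sh : smooth_S2R (@hor R) by exact: smooth_hor smooth_S2R_id.
have tX := vfield_tangent vX Sp.
have E : eq_on_S2R (nabla Y Z) (fun q => act_on Y Z q + (dotp (Y q).1 (Z q).1 : R^o) *: hor q).
  move=> q Sq; rewrite /nabla tprojE; congr (_ + _); rewrite /act_on dotp_der_vfield //.
    by rewrite scaleNr opprK.
  exact: vfield_tangent.
rewrite {1}/nabla {1}/act_on (der_ext _ Sp E) derD //; last exact: smooth_S2RZ.
rewrite derZ // (der_hor (f := id)) //; last exact: smooth_S2R_id.
have tD u v : tproj p (u + v) = tproj p u + tproj p v by exact: linearD.
have tZ c u : tproj p (c *: u) = c *: tproj p u by exact: linearZZ.
rewrite der_id // !tD !tZ tproj_hor // scaler0 add0r.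
by rewrite (tproj_tangent (w := hor (X p))).
Qed.

(** The Gauss equation: the ambient second derivatives cancel by [act_on_commutator], the ambient
    space being flat, and the terms from the normal remain. *)
Lemma curvature_nabla X Y Z p : vfield X -> vfield Y -> vfield Z -> S2R p ->
  curvature nabla X Y Z p = Rc (X p) (Y p) (Z p).
Proof.
move=> vX vY vZ Sp; rewrite /curvature !nabla_nabla //.
rewrite [nabla (lie_bracket X Y) Z p]/nabla -act_on_commutator //; last exact: vfield_smooth.
have tB u v : tproj p (u - v) = tproj p u - tproj p v by exact: linearB.
rewrite tB /Rc.
have aux (a b c d : amb) : a + c - (b + d) - (a - b) = c - d.
  by apply: entryP => i; rewrite !ambE; ring.
exact: aux.
Qed.

Lemma dotp_tproj p u w : tangent p u -> dotp (tproj p w).1 u.1 = dotp w.1 u.1.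
Proof. by move=> tu; rewrite /tproj /= dotpDl dotpNl dotpZl (tangentE tu) mulr0 subr0. Qed.

Lemma der_dotp_hor X Y Z p : vfield X -> vfield Y -> vfield Z -> S2R p ->
  act_on X (fun q => dotp (Y q).1 (Z q).1 : R^o) p =
  dotp (nabla X Y p).1 (Z p).1 + dotp (Y p).1 (nabla X Z p).1.
Proof.
move=> vX vY vZ Sp; rewrite /act_on der_dotp //; [|exact: vfield_smooth..].
have tY := vfield_tangent vY Sp; have tZ := vfield_tangent vZ Sp.
by rewrite /nabla dotp_tproj // (dotpC (Y p).1 (tproj _ _).1) dotp_tproj // (dotpC (Y p).1).
Qed.

Lemma vfieldZ (f : amb -> R^o) X : smooth_S2R f -> vfield X -> vfield (fun q => f q *: X q).
Proof.
move=> sf [sX tX]; split; first exact: smooth_S2RZ.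
by move=> p /tX; rewrite /tangent /= dotpZr => ->; rewrite mulr0.
Qed.

Lemma vfieldD X Y : vfield X -> vfield Y -> vfield (fun q => X q + Y q).
Proof.
move=> [sX tX] [sY tY]; split; first exact: smooth_S2RD.
by move=> p Sp; rewrite /tangent /= dotpDr (tangentE (tX p Sp)) (tangentE (tY p Sp)) addr0.
Qed.

Lemma vfieldN X : vfield X -> vfield (fun q => - X q).
Proof.
move=> [sX tX]; split; first exact: smooth_S2RN.
by move=> p Sp; rewrite /tangent /= dotpNr (tangentE (tX p Sp)) oppr0.
Qed.

Lemma vfieldB X Y : vfield X -> vfield Y -> vfield (fun q => X q - Y q).
Proof. by move=> vX vY; apply: vfieldD => //; exact: vfieldN. Qed.

Lemma nablaZ (f : amb -> R^o) X Y p : smooth_S2R f -> vfield X -> vfield Y -> S2R p ->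
  nabla X (fun q => f q *: Y q) p = (act_on X f p : R) *: Y p + f p *: nabla X Y p.
Proof. by move=> sf vX vY Sp; exact: (conn_leibniz nabla_affine_connection). Qed.

Lemma nablaB X Y Z p : vfield X -> vfield Y -> vfield Z -> S2R p ->
  nabla X (fun q => Y q - Z q) p = nabla X Y p - nabla X Z p.
Proof.
move=> vX vY vZ Sp; rewrite /nabla /act_on derB //; [exact: linearB|exact: vfield_smooth..].
Qed.

Lemma smooth_vdot X Y : vfield X -> vfield Y -> smooth_S2R (fun q => dotp (X q).1 (Y q).1 : R^o).
Proof. by move=> vX vY; apply: smooth_S2R_dotp; exact: vfield_smooth. Qed.

Lemma vfield_Rc X Y Z : vfield X -> vfield Y -> vfield Z -> vfield (fun q => Rc (X q) (Y q) (Z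
  q)).
Proof.
by move=> vX vY vZ; apply: vfieldB; apply: vfieldZ;
  [exact: smooth_vdot|exact: vfield_hor|exact: smooth_vdot|exact: vfield_hor].
Qed.

(** [Rc] is built from [hor] and the horizontal inner product only, and both are parallel. *)
Lemma nabla_Rc X Y Z U p : vfield X -> vfield Y -> vfield Z -> vfield U -> S2R p ->
  nabla X (fun q => Rc (Y q) (Z q) (U q)) p =
  Rc (nabla X Y p) (Z p) (U p) + Rc (Y p) (nabla X Z p) (U p) + Rc (Y p) (Z p) (nabla X U p).
Proof.
move=> vX vY vZ vU Sp.
have H A B C : vfield A -> vfield B -> vfield C ->
   nabla X (fun q => dotp (A q).1 (B q).1 *: hor (C q)) p =
   (dotp (nabla X A p).1 (B p).1 + dotp (A p).1 (nabla X B p).1) *: hor (C p)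
   + dotp (A p).1 (B p).1 *: hor (nabla X C p).
  move=> vA vB vC.
  rewrite (nablaZ (f := fun q => dotp (A q).1 (B q).1) _ vX (vfield_hor vC) Sp);
    last exact: smooth_vdot.
  by rewrite der_dotp_hor // nabla_hor.
have vd A B C : vfield A -> vfield B -> vfield C -> vfield (fun q => dotp (A q).1 (B q).1 *: hor
  (C q)).
  by move=> vA vB vC; apply: (vfieldZ (f := fun q => dotp (A q).1 (B q).1));
    [exact: smooth_vdot|exact: vfield_hor].
rewrite (nablaB vX (vd _ _ _ vZ vU vY) (vd _ _ _ vY vU vZ) Sp) !H // /Rc.
have aux (zu' z'u yu' y'u zu yu : R) (y z y' z' : amb) :
  (z'u + zu') *: y + zu *: y' - ((y'u + yu') *: z + yu *: z') =
  (zu *: y' - y'u *: z) + (z'u *: y - yu *: z') + (zu' *: y - yu' *: z).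
  by apply: entryP => i; rewrite !ambE; ring.
exact: aux.
Qed.

End Geometry.

(** * Reduction to conditions on the tensor *)

Section Structures.
Context {R : realType}.
Local Notation amb := (ambient R).
Local Notation fields := (amb -> amb).
Local Notation tensor := (amb -> amb -> amb -> amb).
Implicit Types (X Y Z U : fields) (p q : amb) (T : tensor).

Definition J p (w : amb) : amb := (cross p.1 w.1, 0).

Lemma tangent_J p w : tangent p (J p w).
Proof. exact: dotp_cross_l. Qed.

Lemma vfield_J X : vfield X -> vfield (fun q => J q (X q)).
Proof.
move=> vX; split; last by move=> p _; exact: tangent_J.
exact: smooth_S2R_cross smooth_S2R_id (vfield_smooth vX).
Qed.

Lemma J_linear p (a : R) (u v : amb) : J p (a *: u + v) = a *: J p u + J p v.
Proof. by rewrite /J /= cross_linear; congr pair; rewrite /= scaler0 addr0. Qed.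

Lemma JZ p (a : R) (u : amb) : J p (a *: u) = a *: J p u.
Proof.
have := J_linear p a u 0; rewrite addr0 => ->.
by rewrite {2}/J /= cross0r addr0.
Qed.

Lemma JB p (u v : amb) : J p (u - v) = J p u - J p v.
Proof. by rewrite addrC -scaleN1r J_linear scaleN1r addrC. Qed.

Lemma metric_J p (u v : amb) : metric (J p u) v = - metric u (J p v).
Proof. by rewrite /metric /= mul0r mulr0 !addr0 dotp_cross_skew. Qed.

Lemma tprojJ p (w : amb) : tproj p (J p w) = J p w.
Proof. by rewrite tproj_tangent //; exact: tangent_J. Qed.

Lemma J_tproj p (w : amb) : J p (tproj p w) = J p w.
Proof.
rewrite /J /tproj /= -scaleNr addrC cross_linear crossxx scaler0 add0r.
by [].
Qed.

(* Differentiating the base point in [cross p] only creates a normal component. *)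
Lemma nabla_J X Y p : vfield X -> vfield Y -> S2R p ->
  nabla X (fun q => J q (Y q)) p = J p (nabla X Y p).
Proof.
move=> vX vY Sp; have tX := vfield_tangent vX Sp; have tY := vfield_tangent vY Sp.
rewrite {1}/nabla /act_on (der_cross _ smooth_S2R_id (vfield_smooth vY) Sp).
rewrite der_id // (cross_normal Sp tX tY).
have -> : (dotp p.1 (cross (X p).1 (Y p).1) *: p.1 + cross p.1 (der Y p (X p)).1, 0) =
   dotp p.1 (cross (X p).1 (Y p).1) *: hor p + J p (der Y p (X p)) :> amb.
  by congr pair; rewrite /= scaler0 addr0.
by rewrite linearD linearZ /= tproj_hor // scaler0 add0r tprojJ /nabla J_tproj.
Qed.

(** Extends a tangent vector given at one point to a global field, through which identities between
    fields are evaluated on arbitrary tangent vectors. *)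
Lemma vfield_const (u : amb) : vfield (fun q => tproj q u).
Proof. by apply: vfield_tproj; exact: smooth_S2R_cst. Qed.

Lemma vfield_tensor T X Y : tensor_field12 T -> vfield X -> vfield Y ->
  vfield (apply_tensor T X Y).
Proof.
move=> tT vX vY; split; first exact: tens_smooth.
by move=> p Sp; apply: (tens_tangent tT) => //; exact: vfield_tangent.
Qed.

Lemma vfield_sub_tensor T X Y : tensor_field12 T -> vfield X -> vfield Y ->
  vfield (sub_tensor nabla T X Y).
Proof. by move=> tT vX vY; apply: vfieldB; [exact: vfield_nabla|exact: vfield_tensor]. Qed.

Lemma sub_tensor_ext T X Y Y' p : tensor_field12 T -> vfield X -> vfield Y -> vfield Y' ->
  eq_on_S2R Y Y' -> S2R p -> sub_tensor nabla T X Y p = sub_tensor nabla T X Y' p.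
Proof.
move=> tT vX vY vY' YY' Sp; rewrite /sub_tensor /apply_tensor (YY' p Sp).
by rewrite (conn_ext nabla_affine_connection vX vX vY vY' (fun _ _ => erefl) YY' Sp).
Qed.

Definition tensor_skew T := forall p x y z, S2R p -> tangent p x -> tangent p y -> tangent p z ->
  metric (T p x y) z + metric y (T p x z) = 0.

Definition tensor_kills_curvature T := forall p x y z u, S2R p ->
  tangent p x -> tangent p y -> tangent p z -> tangent p u ->
  T p x (Rc y z u) = Rc (T p x y) z u + Rc y (T p x z) u + Rc y z (T p x u).

Lemma RcB1 (x x' y z : amb) : Rc (x - x') y z = Rc x y z - Rc x' y z.
Proof.
rewrite /Rc raddfB /= dotpDl dotpNl.
by apply: entryP => i; rewrite !ambE; ring.
Qed.

Lemma RcB2 (x y y' z : amb) : Rc x (y - y') z = Rc x y z - Rc x y' z.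
Proof.
rewrite /Rc raddfB /= dotpDl dotpNl.
by apply: entryP => i; rewrite !ambE; ring.
Qed.

Lemma RcB3 (x y z z' : amb) : Rc x y (z - z') = Rc x y z - Rc x y z'.
Proof.
rewrite /Rc /= !dotpDr !dotpNr.
by apply: entryP => i; rewrite !ambE; ring.
Qed.

Lemma metricBl (u v w : amb) : metric (u - v) w = metric u w - metric v w :> R.
Proof. by rewrite addrC -scaleN1r metric_linear mulN1r addrC. Qed.

Lemma metricBr (u v w : amb) : metric w (u - v) = metric w u - metric w v :> R.
Proof. by rewrite metricC metricBl !(metricC w). Qed.

(** The derivative terms drop out since [nabla] is already metric. The equivalence is stated for
    given fields at one point so as to serve both the model structures and the classification. *)
Lemma parallel_metric_skew T X Y Z p : tensor_field12 T ->
  vfield X -> vfield Y -> vfield Z -> S2R p ->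
  act_on X (fun q => metric (Y q) (Z q) : R^o) p =
    metric (sub_tensor nabla T X Y p) (Z p) + metric (Y p) (sub_tensor nabla T X Z p)
  <-> metric (T p (X p) (Y p)) (Z p) + metric (Y p) (T p (X p) (Z p)) = 0.
Proof.
move=> tT vX vY vZ Sp; rewrite (nabla_parallel_metric vX vY vZ Sp).
rewrite /sub_tensor /apply_tensor metricBl metricBr.
have aux (a b c d : R) : a + b = (a - c) + (b - d) <-> c + d = 0 by split; lra.
exact: aux.
Qed.

Lemma vfield_curvature (D : fields -> fields -> fields) X Y Z :
  (forall A B, vfield A -> vfield B -> vfield (D A B)) ->
  vfield X -> vfield Y -> vfield Z -> vfield (curvature D X Y Z).
Proof.
move=> vD vX vY vZ.
exact: vfieldB (vfieldB (vD _ _ vX (vD _ _ vY vZ)) (vD _ _ vY (vD _ _ vX vZ)))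
  (vD _ _ (vfield_lie_bracket vX vY) vZ).
Qed.

Lemma parallel_curvature_kills T X Y Z U p : tensor_field12 T ->
  vfield X -> vfield Y -> vfield Z -> vfield U -> S2R p ->
  sub_tensor nabla T X (curvature nabla Y Z U) p =
    curvature nabla (sub_tensor nabla T X Y) Z U p + curvature nabla Y (sub_tensor nabla T X Z)
      U p
    + curvature nabla Y Z (sub_tensor nabla T X U) p
  <-> T p (X p) (Rc (Y p) (Z p) (U p)) =
   Rc (T p (X p) (Y p)) (Z p) (U p) + Rc (Y p) (T p (X p) (Z p)) (U p) + Rc (Y p) (Z p) (T p (X
     p) (U p)).
Proof.
move=> tT vX vY vZ vU Sp.
have vc := curvature_nabla vY vZ vU.
have vR : vfield (curvature nabla Y Z U) by apply: vfield_curvature => // A B;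
  exact: vfield_nabla.
have vs A : vfield A -> vfield (sub_tensor nabla T X A) by move=> vA; exact: vfield_sub_tensor.
rewrite !curvature_nabla //; [|exact: vs..].
rewrite /sub_tensor /apply_tensor vc // RcB1 RcB2 RcB3.
have E : eq_on_S2R (curvature nabla Y Z U) (fun q => Rc (Y q) (Z q) (U q)) by move=> q Sq;
  exact: vc.
rewrite (conn_ext nabla_affine_connection vX vX vR (vfield_Rc vY vZ vU) (fun _ _ => erefl) E Sp).
rewrite nabla_Rc //.
have aux (a b c d e f g : amb) : a + b + c - g = (a - d) + (b - e) + (c - f) <-> g = d + e + f.
  split=> [H|->]; last by apply: entryP => i; rewrite !ambE; ring.
  have -> : g = a + b + c - (a + b + c - g) by rewrite opprB addrC subrK.
  by rewrite H; apply: entryP => i; rewrite !ambE; ring.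
exact: aux.
Qed.

Lemma homogeneous_structureI T : tensor_field12 T -> tensor_skew T -> tensor_kills_curvature T ->
  parallel_tensor (sub_tensor nabla T) T -> homogeneous_structure T.
Proof.
move=> tT sT kT pT; split => //; exists nabla; split; first exact: nabla_levi_civita.
split=> //.
- move=> X Y Z vX vY vZ p Sp; apply/parallel_metric_skew => //.
  by apply: sT => //; exact: vfield_tangent.
- move=> X Y Z U vX vY vZ vU p Sp; apply/parallel_curvature_kills => //.
  by apply: kT => //; exact: vfield_tangent.
Qed.

(** The definition provides some Levi-Civita connection D, which uniqueness replaces by [nabla]. As
    the two agree only on the submanifold, nested derivatives also need that D is independent of
    values elsewhere. The pointwise conditions are then read off on the fields [tproj q u]. *)
Lemma homogeneous_structureE T : homogeneous_structure T ->
  [/\ tensor_field12 T, tensor_skew T, tensor_kills_curvature T &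
      parallel_tensor (sub_tensor nabla T) T].
Proof.
move=> [tT [D [lD [mD cD pD]]]]; have [aD _ _] := lD.
have uD (A B : fields) : vfield A -> vfield B -> eq_on_S2R (D A B) (nabla A B)
  by exact: levi_civita_unique.
have vD (A B : fields) : vfield A -> vfield B -> vfield (D A B) by exact: (conn_field aD).
have vn (A B : fields) : vfield A -> vfield B -> vfield (nabla A B) by exact: vfield_nabla.
have uDt (A B : fields) : vfield A -> vfield B -> eq_on_S2R (sub_tensor D T A B) (sub_tensor
  nabla T A B).
  by move=> vA vB p Sp; rewrite /sub_tensor uD.
have vDt (A B : fields) : vfield A -> vfield B -> vfield (sub_tensor D T A B).
  by move=> vA vB; apply: vfieldB; [exact: vD|exact: vfield_tensor].
have vnt (A B : fields) : vfield A -> vfield B -> vfield (sub_tensor nabla T A B).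
  by move=> vA vB; exact: vfield_sub_tensor.
have uDD (A B C : fields) : vfield A -> vfield B -> vfield C ->
  eq_on_S2R (D A (D B C)) (nabla A (nabla B C)).
  move=> vA vB vC p Sp.
  rewrite (conn_ext aD vA vA (vD _ _ vB vC) (vn _ _ vB vC) (fun _ _ => erefl) (uD _ _ vB vC) Sp).
  exact: uD vA (vn _ _ vB vC) p Sp.
have uc (A B C : fields) : vfield A -> vfield B -> vfield C ->
  eq_on_S2R (curvature D A B C) (curvature nabla A B C).
  move=> vA vB vC p Sp; rewrite /curvature !uDD // uD //; exact: vfield_lie_bracket.
have e0 (A : fields) : eq_on_S2R A A by [].
have vcn (A B C : fields) : vfield A -> vfield B -> vfield C -> vfield (curvature nabla A B C).
  exact: vfield_curvature.
have vcD (A B C : fields) : vfield A -> vfield B -> vfield C -> vfield (curvature D A B C).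
  exact: vfield_curvature.
split => //.
- move=> p x y z Sp tx ty tz.
  have vx := vfield_const x; have vy := vfield_const y; have vz := vfield_const z.
  have := mD _ _ _ vx vy vz p Sp; rewrite /= !uDt //.
  by move=> /(parallel_metric_skew tT vx vy vz Sp); rewrite !tproj_tangent.
- move=> p x y z u Sp tx ty tz tu.
  have vx := vfield_const x; have vy := vfield_const y; have vz := vfield_const z;
    have vu := vfield_const u.
  have K (X Y Z U : fields) : vfield X -> vfield Y -> vfield Z -> vfield U ->
    T p (X p) (Rc (Y p) (Z p) (U p)) = Rc (T p (X p) (Y p)) (Z p) (U p)
      + Rc (Y p) (T p (X p) (Z p)) (U p) + Rc (Y p) (Z p) (T p (X p) (U p)).
    move=> vX vY vZ vU; apply/(parallel_curvature_kills tT vX vY vZ vU Sp).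
    have -> : sub_tensor nabla T X (curvature nabla Y Z U) p = sub_tensor D T X (curvature D Y Z
      U) p.
      rewrite (uDt _ _ vX (vcD _ _ _ vY vZ vU) p Sp).
      exact/esym/(sub_tensor_ext tT vX (vcD _ _ _ vY vZ vU) (vcn _ _ _ vY vZ vU) (uc _ _ _ vY vZ
        vU) Sp).
    rewrite (cD X Y Z U vX vY vZ vU p Sp) /=.
    have e (A B C : fields) : vfield A -> vfield B -> vfield C ->
      curvature D A B C p = Rc (A p) (B p) (C p).
      by move=> vA vB vC; rewrite uc // curvature_nabla.
    by rewrite !curvature_nabla ?e ?uDt //; first [exact: vDt|exact: vnt].
  by have := K _ _ _ _ vx vy vz vu; rewrite !tproj_tangent.
- move=> X Y Z vX vY vZ p Sp.
  have := pD X Y Z vX vY vZ p Sp; rewrite /= uDt //; last exact: vfield_tensor.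
  by rewrite /apply_tensor !uDt.
Qed.

End Structures.

(** * The model structures *)

Section ModelStructures.
Context {R : realType}.
Local Notation amb := (ambient R).
Local Notation fields := (amb -> amb).
Implicit Types (X Y Z U : fields) (p q : amb).

Lemma TlamE s (lam : R) p u v : Tlam s lam p u v = (lam * u.2 * (-1) ^+ s) *: J p v.
Proof. by rewrite /Tlam /J; congr pair; rewrite /= scaler0. Qed.

Lemma act_on_snd X Y p : vfield Y -> S2R p ->
  act_on X (fun q => (Y q).2 : R^o) p = (nabla X Y p).2.
Proof. by move=> [sY _] Sp; exact: (der_crd None (X p) sY Sp). Qed.

Lemma Tlam_tensor s (lam : R) : tensor_field12 (Tlam s lam).
Proof.
split.
- move=> p a u u' v Sp tu tu' tv; rewrite !TlamE /=.
  apply: entryP => i; rewrite !ambE.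
  have aux (x y c d : R) : lam * (a * x + y) * c * d = a * (lam * x * c * d) + lam * y * c * d
    by ring.
  exact: aux.
- move=> p a u v v' Sp tu tv tv'; rewrite !TlamE J_linear.
  by apply: entryP => i; rewrite !ambE; ring.
- by move=> p u v Sp tu tv; rewrite TlamE /tangent /= dotpZr dotp_cross_l mulr0.
- move=> X Y vX vY.
  apply: (@smooth_S2R_ext _ _ (fun p => (lam * (X p).2 * (-1) ^+ s : R^o) *: J p (Y p))).
    by move=> p _; rewrite -TlamE.
  apply: smooth_S2RZ; last exact: vfield_smooth (vfield_J vY).
  apply: (smooth_S2RM _ (smooth_S2R_cst ((-1) ^+ s : R^o))).
  exact: smooth_S2RM (smooth_S2R_cst (lam : R^o)) (smooth_S2R_crd None (vfield_smooth vX)).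
Qed.

Lemma metricZl (a : R) (u w : amb) : metric (a *: u) w = a * metric u w.
Proof.
rewrite -[a *: u]addr0 metric_linear.
by rewrite [X in _ + X = _](_ : metric 0 w = 0) ?addr0 // /metric /= dotp0l mul0r addr0.
Qed.

Lemma Tlam_skew s (lam : R) : tensor_skew (Tlam s lam).
Proof.
move=> p x y z Sp tx ty tz; rewrite !TlamE metricZl (metricC y) metricZl metric_J (metricC y).
by rewrite mulrN addNr.
Qed.

(** J is skew for the horizontal inner product and commutes with [hor], the two ingredients of
    [Rc]. *)
Lemma J_Rc p y z u :
  J p (Rc y z u) = Rc (J p y) z u + Rc y (J p z) u + Rc y z (J p u).
Proof.
rewrite /Rc JB !JZ.
have hJ w : hor (J p w) = J p w by [].
have Jh w : J p (hor w) = J p w by [].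
rewrite !hJ !Jh /= !(dotp_cross_skew p.1).
by apply: entryP => i; rewrite !ambE; ring.
Qed.

Lemma horZ (a : R) (u : amb) : hor (a *: u) = a *: hor u.
Proof. by rewrite /hor; congr pair; rewrite /= scaler0. Qed.

Lemma RcZ1 (a : R) (x y z : amb) : Rc (a *: x) y z = a *: Rc x y z.
Proof.
by rewrite /Rc horZ /= dotpZl; apply: entryP => i; rewrite !ambE; ring.
Qed.

Lemma RcZ2 (a : R) (x y z : amb) : Rc x (a *: y) z = a *: Rc x y z.
Proof.
by rewrite /Rc horZ /= dotpZl; apply: entryP => i; rewrite !ambE; ring.
Qed.

Lemma RcZ3 (a : R) (x y z : amb) : Rc x y (a *: z) = a *: Rc x y z.
Proof.
by rewrite /Rc /= !dotpZr; apply: entryP => i; rewrite !ambE; ring.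
Qed.

Lemma Tlam_kills_curvature s (lam : R) : tensor_kills_curvature (Tlam s lam).
Proof.
move=> p x y z u Sp tx ty tz tu; rewrite !TlamE RcZ1 RcZ2 RcZ3 J_Rc.
by rewrite !scalerDr.
Qed.

(** dy and J are parallel for [nabla]. Subtracting T_X, a multiple of J, changes nothing: J commutes
    with itself, and its values are horizontal, so dy vanishes on them. *)
Lemma Tlam_parallel s (lam : R) : parallel_tensor (sub_tensor nabla (Tlam s lam)) (Tlam s lam).
Proof.
move=> X Y Z vX vY vZ p Sp.
have tT := Tlam_tensor s lam.
set k := lam * (-1) ^+ s.
have TE q u v : Tlam s lam q u v = (k * u.2) *: J q v.
  by rewrite TlamE /k; congr (_ *: _); rewrite mulrAC.
have sc : smooth_S2R (fun q => k * (Y q).2 : R^o).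
  exact: smooth_S2RM (smooth_S2R_cst (k : R^o)) (smooth_S2R_crd None (vfield_smooth vY)).
have E : eq_on_S2R (apply_tensor (Tlam s lam) Y Z) (fun q => (k * (Y q).2 : R^o) *: J q (Z q)).
  by move=> q _; rewrite /apply_tensor TE.
have vf : vfield (fun q => (k * (Y q).2 : R^o) *: J q (Z q)).
  by apply: vfieldZ => //; exact: vfield_J.
rewrite (sub_tensor_ext tT vX (vfield_tensor tT vY vZ) vf E Sp).
rewrite {1}/sub_tensor nablaZ //; last exact: vfield_J.
rewrite nabla_J //.
have -> : act_on X (fun q => k * (Y q).2 : R^o) p = k * (nabla X Y p).2 :> R.
  rewrite /act_on (derM _ (smooth_S2R_cst (k : R^o)) (smooth_S2R_crd None (vfield_smooth vY)) Sp).
  by rewrite der_cst mul0r add0r -[der _ p (X p)]/(act_on X (fun q => (Y q).2 : R^o) p)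
    act_on_snd.
rewrite /apply_tensor /sub_tensor /apply_tensor !TE JB JZ /=.
have aux (a b c : R) (u v w : amb) : a *: u + b *: v - c *: (b *: w) = a *: u + b *: (v - c *: w).
  by apply: entryP => i; rewrite !ambE; ring.
by rewrite scaler0 subr0 (JZ p (k * (Y p).2)); exact: aux.
Qed.

Lemma Tlam_homogeneous s (lam : R) : homogeneous_structure (Tlam s lam).
Proof.
apply: homogeneous_structureI; [exact: Tlam_tensor|exact: Tlam_skew|
  exact: Tlam_kills_curvature|exact: Tlam_parallel].
Qed.

End ModelStructures.

(** * Classification *)

Section Classification.
Context {R : realType}.
Local Notation amb := (ambient R).
Local Notation fields := (amb -> amb).
Local Notation tensor := (amb -> amb -> amb -> amb).
Implicit Types (X Y Z U : fields) (p q : amb) (T : tensor).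

Definition dy_vec : amb := (0, 1).

(** If the products of p with the three basis vectors all vanished, every coordinate of p would be
    zero; a nonzero product is normalised. *)
Lemma exists_unit_orthogonal (p : 'cV[R]_3) : dotp p p = 1 ->
  exists x, dotp p x = 0 /\ dotp x x = 1.
Proof.
move=> pp.
have [i Hi] : exists i : 'I_3, cross p (delta_mx i 0) != 0.
  apply/existsP; rewrite -[X in is_true X]negbK negb_exists; apply/negP => /forallP H.
  have H' i : cross p (delta_mx i 0) = 0 by have := H i; rewrite negbK => /eqP.
  have c0 := H' 0; have c1 := H' 1; have c2 := H' 2.
  have e0 := congr1 (fun M : 'cV[R]_3 => M 1 0) c0.
  have e1 := congr1 (fun M : 'cV[R]_3 => M 2 0) c1.
  have e2 := congr1 (fun M : 'cV[R]_3 => M 0 0) c2.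
  move: e0 e1 e2; rewrite !vec3E /= !(mulr1, mulr0, subr0, sub0r) => p2 p0 p1.
  by move: pp; rewrite dotpE p0 p1 p2 !mulr0 !addr0 => /esym/eqP; rewrite oner_eq0.
set w := cross p (delta_mx i 0) in Hi.
have w0 : 0 < dotp w w by rewrite lt_def dotp_eq0 Hi dotp_ge0.
exists ((Num.sqrt (dotp w w))^-1 *: w); split; first by rewrite dotpZr dotp_cross_l mulr0.
by rewrite dotpZl dotpZr mulrA -invfM -expr2 sqr_sqrtr ?ltW // mulVf // gt_eqF.
Qed.

(** The remainder w of u after removing its x component is orthogonal to p and x, so its product
    with p x x vanishes and w is a multiple of p x x. *)
Lemma orthonormal_expansion (p x u : 'cV[R]_3) : dotp p p = 1 -> dotp x x = 1 -> dotp p x = 0 ->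
  dotp p u = 0 -> u = dotp x u *: x + dotp (cross p x) u *: cross p x.
Proof.
move=> pp xx px pu.
pose w := u - dotp x u *: x.
have pw : dotp p w = 0 by rewrite /w dotpDr dotpNr dotpZr pu px mulr0 subr0.
have xw : dotp x w = 0 by rewrite /w dotpDr dotpNr dotpZr xx mulr1 subrr.
have cc : dotp (cross p x) (cross p x) = 1 by rewrite dotp_cross_cross.
have E0 : cross w (cross p x) = 0 by rewrite cross_cross (dotpC w x) (dotpC w p) pw xw !scale0r
  subr0.
have E1 : cross (cross p x) (cross w (cross p x)) = 0 by rewrite E0 cross0r.
have E2 : w = dotp (cross p x) w *: cross p x.
  by move/eqP: E1; rewrite cross_cross cc scale1r subr_eq0 => /eqP.
have E3 : dotp (cross p x) w = dotp (cross p x) u.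
  by rewrite /w dotpDr dotpNr dotpZr (dotpC (cross p x) x) dotp_cross_r mulr0 subr0.
by rewrite -E3 -E2 /w addrC subrK.
Qed.

Lemma addrr_eq0 (c : R) : c + c = 0 -> c = 0.
Proof. lra. Qed.

(** * Skew maps of a tangent space that annihilate the curvature *)

Section Frame.
Variables (p : amb) (x : 'cV[R]_3).
Hypotheses (Sp : S2R p) (xx : dotp x x = 1) (px : dotp p.1 x = 0).

Definition frame1 : amb := (x, 0).
Definition frame2 : amb := J p frame1.

Lemma tangent_frame1 : tangent p frame1.
Proof. exact: px. Qed.

Lemma tangent_frame2 : tangent p frame2.
Proof. exact: tangent_J. Qed.

Lemma tangent_dy : tangent p dy_vec.
Proof. exact: dotp0r. Qed.

Lemma dotp_frame12 : dotp frame1.1 frame2.1 = 0.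
Proof. exact: dotp_cross_r. Qed.

Lemma dotp_frame22 : dotp frame2.1 frame2.1 = 1.
Proof. by rewrite dotp_cross_cross. Qed.

Lemma frame_expansion u : tangent p u ->
  u = dotp frame1.1 u.1 *: frame1 + dotp frame2.1 u.1 *: frame2 + u.2 *: dy_vec.
Proof.
move=> tu; have e := orthonormal_expansion Sp xx px tu.
have -> : dotp frame1.1 u.1 *: frame1 + dotp frame2.1 u.1 *: frame2 + u.2 *: dy_vec =
    (dotp x u.1 *: x + dotp (cross p.1 x) u.1 *: cross p.1 x, u.2).
  congr pair; first by rewrite /= scaler0 addr0.
  by rewrite /= !scaler0 !add0r; exact: mulr1.
by rewrite -e; case: u {tu e}.
Qed.

Lemma J_frame1 : J p frame1 = frame2.
Proof. by []. Qed.

Lemma J_frame2 : J p frame2 = - frame1.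
Proof.
rewrite /frame2 /frame1 /J /= cross_cross px Sp scale0r scale1r sub0r.
by congr pair; rewrite /= oppr0.
Qed.

Lemma J_expansion u : tangent p u ->
  J p u = dotp frame1.1 u.1 *: frame2 - dotp frame2.1 u.1 *: frame1.
Proof.
move=> tu; rewrite {1}(frame_expansion tu) -addrA J_linear J_frame1.
have -> : J p (dotp frame2.1 u.1 *: frame2 + u.2 *: dy_vec) = dotp frame2.1 u.1 *: J p frame2 +
  u.2 *: J p dy_vec.
  by rewrite J_linear JZ.
have -> : J p dy_vec = 0 by rewrite /J /= cross0r.
by rewrite J_frame2 scaler0 addr0 scalerN.
Qed.

(** R(e1, e2) kills the vertical vector, and since A annihilates R it kills A dy_vec as well. Hence
    A dy_vec is vertical, and zero by skewness. Skewness then also confines the values of A to the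
    plane of e1 and e2, where its matrix has a single free entry. *)
Lemma skew_is_rotation (A : amb -> amb) :
  (forall (a : R) u v, tangent p u -> tangent p v -> A (a *: u + v) = a *: A u + A v) ->
  (forall u, tangent p u -> tangent p (A u)) ->
  (forall u v, tangent p u -> tangent p v -> metric (A u) v + metric u (A v) = 0) ->
  (forall y z u, tangent p y -> tangent p z -> tangent p u ->
    A (Rc y z u) = Rc (A y) z u + Rc y (A z) u + Rc y z (A u)) ->
  forall u, tangent p u -> A u = dotp (A frame1).1 frame2.1 *: J p u.
Proof.
move=> lA tA sA kA.
have t1 := tangent_frame1; have t2 := tangent_frame2; have ty := tangent_dy.
have A0 : A 0 = 0.
  have t0 : tangent p 0 by exact: dotp0r.
  by have := lA (-1) 0 0 t0 t0; rewrite scaler0 addr0 scaleN1r addNr.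
have d11 : dotp frame1.1 frame1.1 = 1 by exact: xx.
have d12 := dotp_frame12; have d22 := dotp_frame22.
have d21 : dotp frame2.1 x = 0 by rewrite dotpC; exact: dotp_frame12.
have Ady : A dy_vec = 0.
  have := kA _ _ _ t1 t2 ty.
  have Rdy a b : Rc a b dy_vec = 0 by rewrite /Rc /= !dotp0r !scale0r subr0.
  rewrite !Rdy A0 !add0r /Rc => /esym E.
  have Ea : dotp frame2.1 (A dy_vec).1 = 0.
    have := congr1 (fun w : amb => dotp frame1.1 w.1) E; rewrite /= dotpDr dotpNr !dotpZr.
    by rewrite -[dotp x x]/(dotp frame1.1 frame1.1) d11 d12 mulr1 mulr0 subr0 dotp0r.
  have Eb : dotp frame1.1 (A dy_vec).1 = 0.
    have := congr1 (fun w : amb => dotp frame2.1 w.1) E; rewrite /= dotpDr dotpNr !dotpZr.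
    by rewrite -[cross p.1 x]/(frame2.1) d22 d21 mulr1 mulr0 sub0r dotp0r => /eqP;
      rewrite oppr_eq0 => /eqP.
  rewrite (frame_expansion (tA _ ty)) Ea Eb !scale0r !add0r.
  have := sA _ _ ty ty; rewrite /metric /= dotp0r dotp0l !add0r mulr1 mul1r => e.
  by rewrite (addrr_eq0 e) scale0r.
have A2 u : tangent p u -> (A u).2 = 0.
  move=> tu; have := sA _ _ tu ty; rewrite Ady /metric /= !dotp0r mulr0 !addr0 add0r mulr1.
  by [].
have E11 : dotp frame1.1 (A frame1).1 = 0.
  have := sA _ _ t1 t1; rewrite /metric A2 // !(mul0r, mulr0) !addr0 dotpC.
  exact: addrr_eq0.
have E22 : dotp frame2.1 (A frame2).1 = 0.
  have := sA _ _ t2 t2; rewrite /metric A2 // !(mul0r, mulr0) !addr0 dotpC.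
  exact: addrr_eq0.
have E12 : dotp frame1.1 (A frame2).1 = - dotp (A frame1).1 frame2.1.
  have := sA _ _ t1 t2; rewrite /metric !A2 // !(mul0r, mulr0) !addr0.
  by rewrite addrC => /eqP; rewrite addr_eq0 => /eqP.
have Af1 := frame_expansion (tA _ t1); have Af2 := frame_expansion (tA _ t2).
rewrite E11 A2 // !scale0r add0r addr0 (dotpC frame2.1) in Af1.
rewrite E22 A2 // !scale0r !addr0 E12 in Af2.
move=> u tu; rewrite {1}(frame_expansion tu) -addrA lA //; last first.
  by apply: tangent_linear => //; rewrite -[_ *: _]addr0; apply: tangent_linear => //;
    exact: dotp0r.
rewrite lA //; last by rewrite -[_ *: _]addr0; apply: tangent_linear => //; exact: dotp0r.
have -> : A (u.2 *: dy_vec) = 0.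
  by rewrite -[_ *: _]addr0 lA // Ady A0 scaler0 addr0.
rewrite (J_expansion tu) {1}Af1 {1}Af2.
by apply: entryP => i; rewrite !ambE; ring.
Qed.

End Frame.
(* If T_u = a J then the sum is a |J|^2 = 2 a. Summing over the coordinate vectors of R^3,
   rather than over a tangent frame, makes a manifestly smooth in p. *)
Definition weight T p (u : amb) : R :=
  2^-1 * \sum_(i < 3) dotp (T p u (tproj p (bas (Some i)))).1 (J p (bas (Some i))).1.

(** The i-th term is 1 - p_i^2, and the three add up to 3 - 1. *)
Lemma sum_dotp_J p : S2R p -> \sum_(i < 3) dotp (J p (bas (Some i))).1 (J p (bas (Some i))).1 = 2.
Proof.
move=> Sp; rewrite sum3E /J /= !vec3E /=.
have := Sp; rewrite /S2R /= dotpE.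
move: (p.1 0 0) (p.1 1 0) (p.1 2 0) => a b c abc.
by apply: (@etrans _ _ (2 * (a * a + b * b + c * c))); [ring|rewrite abc mulr1].
Qed.

(** [skew_is_rotation] expresses the coefficient through a frame vector chosen at p; tracing against
    J identifies it with [weight], which involves no choice. *)
Lemma structure_form T p u v : homogeneous_structure T -> S2R p -> tangent p u -> tangent p v ->
  T p u v = weight T p u *: J p v.
Proof.
move=> /homogeneous_structureE[tT sT kT _] Sp tu.
have [x [px xx]] := exists_unit_orthogonal Sp.
have H : forall v, tangent p v -> T p u v = dotp (T p u (frame1 x)).1 (frame2 p x).1 *: J p v.
  apply: (skew_is_rotation Sp xx px).
  - by move=> a y z ty tz; exact: (tens_linr tT).
  - by move=> y ty; exact: (tens_tangent tT).
  - by move=> y z ty tz; exact: sT.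
  - by move=> y z w ty tz tw; exact: kT.
move: (dotp _ _) H => a H tv; rewrite H //; congr (_ *: _).
rewrite /weight (eq_bigr (fun i => a * dotp (J p (bas (Some i))).1 (J p (bas (Some i))).1)).
  by rewrite -mulr_sumr sum_dotp_J // mulrC mulfK // pnatr_eq0.
by move=> i _; rewrite H ?J_tproj ?dotpZl //; exact: tangent_tproj.
Qed.

Lemma weight_linear T p (a : R) u v : tensor_field12 T -> S2R p -> tangent p u -> tangent p v ->
  weight T p (a *: u + v) = a * weight T p u + weight T p v.
Proof.
move=> tT Sp tu tv; rewrite /weight mulrCA -mulrDr; congr (_ * _).
rewrite mulr_sumr -big_split; apply: eq_bigr => i _ /=.
rewrite (tens_linl tT) //; last exact: tangent_tproj.
by rewrite -dotpZl -dotpDl.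
Qed.

Lemma weightB T p u v : tensor_field12 T -> S2R p -> tangent p u -> tangent p v ->
  weight T p (u - v) = weight T p u - weight T p v.
Proof.
by move=> tT Sp tu tv; rewrite addrC -scaleN1r weight_linear // mulN1r addrC.
Qed.

Lemma weightZ T p (a : R) u : tensor_field12 T -> S2R p -> tangent p u ->
  weight T p (a *: u) = a * weight T p u.
Proof.
move=> tT Sp tu; have t0 : tangent p 0 by exact: dotp0r.
have w0 : weight T p 0 = 0.
  have := weight_linear (-1) tT Sp t0 t0.
  by rewrite scaler0 addr0 mulN1r addNr.
by have := weight_linear a tT Sp tu t0; rewrite !addr0 w0 addr0.
Qed.

Lemma smooth_weight T X : tensor_field12 T -> vfield X -> smooth_S2R (fun q => weight T q (X q)
  : R^o).
Proof.
move=> tT vX.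
apply: (smooth_S2RM (smooth_S2R_cst (2^-1 : R^o))).
apply: (@smooth_S2R_sum _ R^o _ _ (fun (i : 'I_3) q => dotp (T q (X q) (tproj q (bas (Some
  i)))).1 (J q (bas (Some i))).1 : R^o)) => i.
apply: smooth_S2R_dotp; first exact: (tens_smooth tT vX (vfield_const _)).
exact: smooth_S2R_cross smooth_S2R_id (smooth_S2R_cst _).
Qed.

(** * Curvature of the connection nabla - T *)

Section AmbroseSinger.
Variable T : tensor.
Hypothesis hT : homogeneous_structure T.

Let tT : tensor_field12 T.
Proof. by have [] := homogeneous_structureE hT. Qed.
Let pT : parallel_tensor (sub_tensor nabla T) T.
Proof. by have [] := homogeneous_structureE hT. Qed.

Local Notation Dt := (sub_tensor nabla T).
Local Notation w := (weight T).

Let vDt X Y : vfield X -> vfield Y -> vfield (Dt X Y).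
Proof. exact: vfield_sub_tensor. Qed.

Let vT X Y : vfield X -> vfield Y -> vfield (apply_tensor T X Y).
Proof. exact: vfield_tensor. Qed.

Let DtD X Y Z p : vfield X -> vfield Y -> vfield Z -> S2R p ->
  Dt X (fun q => Y q + Z q) p = Dt X Y p + Dt X Z p.
Proof.
move=> vX vY vZ Sp; rewrite /sub_tensor (conn_addr nabla_affine_connection vX vY vZ Sp)
  /apply_tensor.
have := tens_linr tT 1 Sp (vfield_tangent vX Sp) (vfield_tangent vY Sp) (vfield_tangent vZ Sp).
by rewrite !scale1r => ->; rewrite opprD addrACA.
Qed.

(* The curvature operator of nabla - T. It acts on tensors as a derivation and, T being
   parallel for nabla - T, it annihilates T. *)
Definition canonical_curvature X Y Z p : amb :=
  Dt X (Dt Y Z) p - Dt Y (Dt X Z) p - Dt (lie_bracket X Y) Z p.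

Let TBl p x y z : S2R p -> tangent p x -> tangent p y -> tangent p z ->
  T p (x - y) z = T p x z - T p y z.
Proof. by move=> Sp tx ty tz; rewrite addrC -scaleN1r (tens_linl tT) // scaleN1r addrC. Qed.

Let TBr p x y z : S2R p -> tangent p x -> tangent p y -> tangent p z ->
  T p z (x - y) = T p z x - T p z y.
Proof. by move=> Sp tx ty tz; rewrite addrC -scaleN1r (tens_linr tT) // scaleN1r addrC. Qed.

Let DtDtT X Y Z U p : vfield X -> vfield Y -> vfield Z -> vfield U -> S2R p ->
  Dt X (Dt Y (apply_tensor T Z U)) p =
  (T p (Dt X (Dt Y Z) p) (U p) + T p (Dt Y Z p) (Dt X U p)) +
  (T p (Dt X Z p) (Dt Y U p) + T p (Z p) (Dt X (Dt Y U) p)).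
Proof.
move=> vX vY vZ vU Sp.
have v1 := vT (vDt vY vZ) vU; have v2 := vT vZ (vDt vY vU).
have E : eq_on_S2R (Dt Y (apply_tensor T Z U))
    (fun q => apply_tensor T (Dt Y Z) U q + apply_tensor T Z (Dt Y U) q) by exact: pT.
rewrite (sub_tensor_ext tT vX (vDt vY (vT vZ vU)) (vfieldD v1 v2) E Sp) DtD //.
by rewrite (pT vX (vDt vY vZ) vU Sp) (pT vX vZ (vDt vY vU) Sp).
Qed.

(** The product rule is applied twice; the cross terms are symmetric in X and Y and cancel. *)
Lemma canonical_curvature_derivation X Y Z U p :
  vfield X -> vfield Y -> vfield Z -> vfield U -> S2R p ->
  canonical_curvature X Y (apply_tensor T Z U) p =
  T p (canonical_curvature X Y Z p) (U p) + T p (Z p) (canonical_curvature X Y U p).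
Proof.
move=> vX vY vZ vU Sp.
have tU := vfield_tangent vU Sp; have tZ := vfield_tangent vZ Sp.
have vL := vfield_lie_bracket vX vY.
have tg A B : vfield A -> vfield B -> tangent p (Dt A B p) by move=> vA vB;
  exact: vfield_tangent (vDt vA vB) Sp.
have tXYZ := tg _ _ vX (vDt vY vZ); have tYXZ := tg _ _ vY (vDt vX vZ); have tLZ := tg _ _ vL vZ.
have tXYU := tg _ _ vX (vDt vY vU); have tYXU := tg _ _ vY (vDt vX vU); have tLU := tg _ _ vL vU.
have e1 := DtDtT vX vY vZ vU Sp; have e2 := DtDtT vY vX vZ vU Sp.
have e3 : Dt (lie_bracket X Y) (apply_tensor T Z U) p =
    T p (Dt (lie_bracket X Y) Z p) (U p) + T p (Z p) (Dt (lie_bracket X Y) U p)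
      by refine (pT vL vZ vU Sp).
rewrite /canonical_curvature e1 e2 e3.
rewrite (TBl Sp (tangentB tXYZ tYXZ) tLZ tU) (TBl Sp tXYZ tYXZ tU).
rewrite (TBr Sp (tangentB tXYU tYXU) tLU tZ) (TBr Sp tXYU tYXU tZ).
have aux (a1 a4 b1 b4 c1 c2 x y : amb) :
    (a1 + x) + (y + a4) - ((b1 + y) + (x + b4)) - (c1 + c2) = (a1 - b1 - c1) + (a4 - b4 - c2).
  by apply: entryP => i; rewrite !ambE; ring.
exact: aux.
Qed.

(** The weight is only evaluated, never differentiated: Dt_X (T_Y Z) is expanded by parallelism of
    T, and w(Dt_X Y) = w(nabla_X Y) - w(X) w(JY). *)
Let DtDt X Y Z p : vfield X -> vfield Y -> vfield Z -> S2R p ->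
  Dt X (Dt Y Z) p = nabla X (nabla Y Z) p
   - (w p (nabla X Y p) - w p (X p) * w p (J p (Y p))) *: J p (Z p)
   - w p (Y p) *: J p (nabla X Z p) - w p (X p) *: J p (nabla Y Z p)
   + (w p (X p) * w p (Y p)) *: J p (J p (Z p)).
Proof.
move=> vX vY vZ Sp.
have tX := vfield_tangent vX Sp; have tY := vfield_tangent vY Sp; have tZ := vfield_tangent vZ Sp.
have tn A B : vfield A -> vfield B -> tangent p (nabla A B p).
  by move=> vA vB; exact: vfield_tangent (vfield_nabla vA vB) Sp.
have tXY := tn _ _ vX vY; have tXZ := tn _ _ vX vZ; have tYZ := tn _ _ vY vZ.
have wT u v : tangent p u -> tangent p v -> T p u v = w p u *: J p v by exact: structure_form.
have DtE A B : vfield A -> vfield B -> Dt A B p = nabla A B p - w p (A p) *: J p (B p).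
  by move=> vA vB; rewrite /sub_tensor /apply_tensor wT //; exact: vfield_tangent.
have tJ v : tangent p (J p v) := tangent_J p v.
have tcJ c v : tangent p (c *: J p v) by rewrite /tangent /= dotpZr (tangentE (tJ v)) mulr0.
have e1 : Dt X (apply_tensor T Y Z) p = w p (Dt X Y p) *: J p (Z p) + w p (Y p) *: J p (Dt X Z p).
  have tXY' := vfield_tangent (vDt vX vY) Sp; have tXZ' := vfield_tangent (vDt vX vZ) Sp.
  by rewrite (pT vX vY vZ Sp) /apply_tensor !wT.
have e2 := DtE _ _ vX (vT vY vZ).
have e3 : nabla X (Dt Y Z) p = nabla X (nabla Y Z) p - nabla X (apply_tensor T Y Z) p.
  exact: (nablaB vX (vfield_nabla vY vZ) (vT vY vZ) Sp).
rewrite (DtE _ _ vX (vDt vY vZ)) e3.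
(* Trading [nabla] back for [Dt] brings the derivative of T Y Z into the form to which parallelism
   of T applies. *)
have -> : nabla X (apply_tensor T Y Z) p = Dt X (apply_tensor T Y Z) p + w p (X p) *: J p
  (apply_tensor T Y Z p).
  by rewrite e2 subrK.
rewrite e1 !DtE // /apply_tensor wT // weightB // weightZ //.
rewrite !(JB, JZ).
have aux (n jz nx ny jj : amb) (a x y b : R) :
  n - ((a - x * b) *: jz + y *: (nx - x *: jj) + x *: (y *: jj)) - x *: (ny - y *: jj) =
  n - (a - x * b) *: jz - y *: nx - x *: ny + (x * y) *: jj.
  by apply: entryP => i; rewrite !ambE; ring.
by refine (aux _ _ _ _ _ _ _ _ _).
Qed.

(** Vanishing torsion writes w([X, Y]) as w(nabla_X Y) - w(nabla_Y X), which cancels the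
    corresponding terms of the second derivatives. The terms J(nabla Z) and J(JZ) are symmetric in X
    and Y. *)
Lemma canonical_curvatureE X Y Z p : vfield X -> vfield Y -> vfield Z -> S2R p ->
  canonical_curvature X Y Z p = Rc (X p) (Y p) (Z p)
    + (w p (X p) * w p (J p (Y p)) - w p (Y p) * w p (J p (X p))) *: J p (Z p).
Proof.
move=> vX vY vZ Sp; rewrite -curvature_nabla // /curvature /canonical_curvature !DtDt //.
have vL := vfield_lie_bracket vX vY; have tL := vfield_tangent vL Sp;
  have tZ := vfield_tangent vZ Sp.
have -> : Dt (lie_bracket X Y) Z p = nabla (lie_bracket X Y) Z p - w p (lie_bracket X Y p) *: J
  p (Z p).
  by rewrite /sub_tensor /apply_tensor structure_form.
rewrite -(nabla_torsion_free vX vY Sp) weightB //;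
  [|exact: vfield_tangent (vfield_nabla vX vY) Sp|exact: vfield_tangent (vfield_nabla vY vX) Sp].
have aux (n n' n'' jz nx ny jj : amb) (a a' x y bX bY : R) :
  n - (a - x * bY) *: jz - y *: nx - x *: ny + (x * y) *: jj
  - (n' - (a' - y * bX) *: jz - x *: ny - y *: nx + (y * x) *: jj) - (n'' - (a - a') *: jz) =
  n - n' - n'' + (x * bY - y * bX) *: jz.
  by apply: entryP => i; rewrite !ambE; ring.
by refine (aux _ _ _ _ _ _ _ _ _ _ _ _ _).
Qed.

End AmbroseSinger.

(** * The weight is a multiple of dy with vanishing differential *)

Section WeightConstant.
Variable T : tensor.
Hypothesis hT : homogeneous_structure T.

Let tT : tensor_field12 T.
Proof. by have [] := homogeneous_structureE hT. Qed.
Let pT : parallel_tensor (sub_tensor nabla T) T.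
Proof. by have [] := homogeneous_structureE hT. Qed.

Local Notation w := (weight T).

Let wT p u v : S2R p -> tangent p u -> tangent p v -> T p u v = w p u *: J p v.
Proof. exact: structure_form. Qed.

Lemma weight_vertical p u : S2R p -> tangent p u -> w p u = u.2 * w p dy_vec.
Proof.
move=> Sp tu; have [x [px xx]] := exists_unit_orthogonal Sp.
pose e1 := frame1 x; pose e2 := frame2 p x.
have t1 : tangent p e1 by exact: tangent_frame1.
have t2 : tangent p e2 by exact: tangent_frame2.
have J1 : J p e1 = e2 by [].
have J2 : J p e2 = - e1 by exact: J_frame2.
have J2' : J p e2 = (-1) *: e1 by rewrite scaleN1r.
have d22 : dotp e2.1 e2.1 = 1 by exact: dotp_frame22.
have v1 := vfield_const e1; have v2 := vfield_const e2.
(* On the frame R(e1, e2) equals -J, and since J e1 = e2 and J e2 = -e1 the weight terms contribute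
   -(w(e1)^2 + w(e2)^2) times J. *)
pose k := - (1 + w p e1 ^+ 2 + w p e2 ^+ 2).
have k0 : k != 0.
  rewrite oppr_eq0 gt_eqF // -addrA ltr_pwDl // addr_ge0 //; exact: sqr_ge0.
have RE Z : vfield Z -> canonical_curvature T (fun q => tproj q e1) (fun q => tproj q e2) Z p =
  k *: J p (Z p).
  move=> vZ; have tZ := vfield_tangent vZ Sp.
  rewrite canonical_curvatureE // !tproj_tangent // J1 J2' weightZ // (J_expansion Sp xx px tZ).
  rewrite /Rc -/e1 -/e2; have -> : hor e1 = e1 by []; have -> : hor e2 = e2 by [].
  apply: entryP => i; rewrite !ambE /k; ring.
have wJ z : tangent p z -> w p (J p z) = 0.
  move=> tz; have vz := vfield_const z.
  have tJ := tangent_J p z.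
  have tcJ c v : tangent p (c *: J p v) by rewrite /tangent /= dotpZr dotp_cross_l mulr0.
  (* The curvature operator k J is applied to T_z e1 = w(z) J e1. Its action on the value and its
     action on the argument e1 agree, so its action on the argument z, which is k w(Jz) J e1, has to
     vanish. *)
  have := canonical_curvature_derivation hT v1 v2 vz v1 Sp.
  rewrite (RE _ (vfield_tensor tT vz v1)) (RE _ vz) (RE _ v1) /apply_tensor !tproj_tangent //.
  rewrite !wT // weightZ // J1 !JZ => E.
  have : (k * w p (J p z)) *: e2 = 0.
    have aux (a b c : R) (y y' : amb) : a *: (b *: y') = (a * c) *: y + b *: (a *: y') ->
      (a * c) *: y = 0.
      move=> e; have -> : (a * c) *: y = (a * c) *: y + b *: (a *: y') - b *: (a *: y')
        by rewrite addrK.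
      by rewrite -e; apply: entryP => i; rewrite !ambE; ring.
    exact: aux E.
  move=> /(congr1 (fun v : amb => dotp e2.1 v.1)); rewrite dotpZr d22 mulr1 dotp0r => /eqP.
  by rewrite mulf_eq0 (negbTE k0) => /eqP.
have w2 : w p e2 = 0 by rewrite -J1; exact: wJ.
have w1 : w p e1 = 0.
  by have := wJ _ t2; rewrite J2' weightZ // mulN1r => /eqP; rewrite oppr_eq0 => /eqP.
have t0 : tangent p 0 by exact: dotp0r.
have tZ c v : tangent p v -> tangent p (c *: v) by move=> tv;
  rewrite /tangent /= dotpZr (tangentE tv) mulr0.
have ty := tangent_dy p.
rewrite {1}(frame_expansion Sp xx px tu) -addrA weight_linear //; last first.
  by apply: tangent_linear => //; exact: tZ.
by rewrite weight_linear ?weightZ ?w1 ?w2 ?mulr0 ?add0r //; exact: tZ.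
Qed.

Lemma vfield_dy : vfield (fun _ : amb => dy_vec).
Proof. by split; [exact: smooth_S2R_cst|move=> p _; exact: tangent_dy]. Qed.

Lemma smooth_weight_dy : smooth_S2R (fun q => w q dy_vec : R^o).
Proof. exact: smooth_weight tT vfield_dy. Qed.

(** The vertical field is parallel for nabla - T because J kills it, and J commutes with nabla - T.
    Differentiating T_dy Z = f JZ, with f the weight of the vertical field, therefore leaves the
    single term X(f) JZ, to be zero for Z = e1. *)
Lemma der_weight_dy p v : S2R p -> tangent p v -> der (fun q => w q dy_vec : R^o) p v = 0.
Proof.
move=> Sp tv; have [x [px xx]] := exists_unit_orthogonal Sp.
pose e1 := frame1 x; pose e2 := frame2 p x.
have t1 : tangent p e1 by exact: tangent_frame1.
have d22 : dotp e2.1 e2.1 = 1 by exact: dotp_frame22.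
pose X := fun q => tproj q v; pose Z := fun q => tproj q e1.
have vX : vfield X by exact: vfield_const.
have vZ : vfield Z by exact: vfield_const.
have vy := vfield_dy; have ty := tangent_dy p; have sw := smooth_weight_dy.
have Xp : X p = v by rewrite /X tproj_tangent.
have Zp : Z p = e1 by rewrite /Z tproj_tangent.
have t0 : tangent p 0 by exact: dotp0r.
have E : eq_on_S2R (apply_tensor T (fun=> dy_vec) Z) (fun q => (w q dy_vec : R^o) *: J q (Z q)).
  by move=> q Sq; rewrite /apply_tensor wT //; [exact: tangent_dy|exact: vfield_tangent vZ Sq].
have vJ := vfield_J vZ.
have vTZ := vfield_tensor tT vy vZ.
have n0 : sub_tensor nabla T X (fun=> dy_vec) p = 0.
  rewrite /sub_tensor /apply_tensor wT //; last exact: vfield_tangent vX Sp.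
  by rewrite /nabla /act_on der_cst linear0 /J /= cross0r (_ : (0,
    0) = 0 :> amb) // scaler0 subr0.
have := pT vX vy vZ Sp.
rewrite {1}/apply_tensor /= (sub_tensor_ext tT vX vTZ (vfieldZ sw vJ) E Sp).
have tX := vfield_tangent vX Sp.
have tJ z : tangent p (J p z) := tangent_J p z.
have tcJ c z : tangent p (c *: J p z) by rewrite /tangent /= dotpZr dotp_cross_l mulr0.
have tn : tangent p (nabla X Z p) := vfield_tangent (vfield_nabla vX vZ) Sp.
rewrite {1}/sub_tensor nablaZ // nabla_J // {1}/apply_tensor wT //.
rewrite /apply_tensor n0.
have -> : T p 0 (Z p) = 0.
  by have := tens_linl tT (-1) Sp t0 t0 t1; rewrite Zp scaler0 addr0 scaleN1r addNr.
rewrite /sub_tensor /apply_tensor !wT ?Zp //; last by apply: tangentB => //; rewrite wT.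
rewrite !JB !JZ add0r /act_on Xp => e.
have : (der (fun q => w q dy_vec : R^o) p v : R) *: e2 = 0.
  move: e; rewrite -[J p e1]/e2.
  have aux (a b c : R) (u y z : amb) : a *: u + b *: y - c *: (b *: z) = b *: (y - c *: z) ->
    a *: u = 0.
    move=> e; have -> : a *: u = (a *: u + b *: y - c *: (b *: z)) - (b *: y - c *: (b *: z)).
      by apply: entryP => i; rewrite !ambE; ring.
    by rewrite e; apply: entryP => i; rewrite !ambE; ring.
  by move=> e; refine (aux _ _ _ _ _ _ e).
by move=> /(congr1 (fun z : amb => dotp e2.1 z.1)); rewrite dotpZr d22 mulr1 dotp0r.
Qed.

End WeightConstant.

End Classification.

(** * Functions with vanishing differential are constant *)

Section Constancy.
Context {R : realType}.
Local Notation amb := (ambient R).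
Implicit Types (p q z v : amb).

Lemma tangent_derive_retr z v : 0 < dotp z.1 z.1 -> tangent (retr z) ('D_v (@retr R) z).
Proof.
move=> z0; have dr := differentiable_retr z0.
pose Q := fun y : amb => dotp y.1 y.1 : R^o.
have dQ : differentiable Q (retr z) by exact: differentiable_dotp_sqr.
have : 'D_v (Q \o retr) z = 0.
  have n1 : \forall y \near z, (fun=> 1 : R^o) y = (Q \o retr) y.
    by apply: filterS (near_dotp_gt0 z0) => y y0; exact/esym/(S2R_retr y0).
  by rewrite -(near_eq_derive v n1) derive_cst.
rewrite deriveE; last exact: differentiable_comp.
rewrite (diff_comp dr dQ) /= -(deriveE _ dr) -(deriveE _ dQ) derive_dotp_sqr => /eqP.
by rewrite mulf_eq0 pnatr_eq0 /= => /eqP.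
Qed.

(** Where the R^3 component is nonzero, [retr] is idempotent and its derivative takes tangent
    values, since the squared length of its image is constantly 1. The chain rule thus reduces to
    derivatives of f along tangent vectors. *)
Lemma retr_comp_flat (f : amb -> R^o) z v : smooth_S2R f ->
  (forall p v, S2R p -> tangent p v -> der f p v = 0) -> 0 < dotp z.1 z.1 ->
  differentiable (f \o retr) z /\ 'D_v (f \o retr) z = 0.
Proof.
move=> sf f0 z0; have dr := differentiable_retr z0; have Sz := S2R_retr z0.
have dF := differentiable_retr_comp sf Sz.
have n1 : \forall y \near z, ((f \o retr) \o retr) y = (f \o retr) y.
  by apply: filterS (near_dotp_gt0 z0) => y y0 /=; rewrite (retr_S2R (S2R_retr y0)).
split; first by apply: near_eq_differentiable n1 _; exact: differentiable_comp.
rewrite -(near_eq_derive v n1) deriveE; last exact: differentiable_comp.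
rewrite (diff_comp dr dF) /= -(deriveE _ dr) -(deriveE _ dF).
exact: f0 Sz (tangent_derive_retr v z0).
Qed.

(** f o retr is constant along an ambient segment that avoids the axis where the R^3 component
    vanishes. Only antipodal sphere components are excluded by this, and such points are joined
    through one whose sphere component is orthogonal to both. *)
Lemma flat_constant (f : amb -> R^o) : smooth_S2R f ->
  (forall p v, S2R p -> tangent p v -> der f p v = 0) ->
  forall p q, S2R p -> S2R q -> f p = f q.
Proof.
move=> sf f0.
have step p q : S2R p -> S2R q -> p.1 + q.1 != 0 -> f p = f q.
  move=> Sp Sq pq0.
  (* The segment meets the axis only if (1 - t) p = - t q on the R^3 components; comparing lengths
     gives t = 1/2, so p and q would be antipodal. *)
  have c0 t : 0 < dotp (p + t *: (q - p)).1 (p + t *: (q - p)).1.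
    rewrite lt_def dotp_ge0 andbT dotp_eq0; apply: contra pq0 => /eqP /= e.
    have e1 : (1 - t) *: p.1 = - (t *: q.1).
      by move/eqP: e; rewrite scalerBr addrCA addrC addr_eq0 scalerBl scale1r => /eqP.
    have : dotp ((1 - t) *: p.1) ((1 - t) *: p.1) = dotp (- (t *: q.1)) (- (t *: q.1))
      by rewrite e1.
    rewrite dotpNl dotpNr opprK !dotpZl !dotpZr Sp Sq !mulr1 => e2.
    have t2 : t = 2^-1 by lra.
    move: e1; rewrite t2 (_ : 1 - 2^-1 = 2^-1 :> R); last by lra.
    move=> /eqP; rewrite -subr_eq0 opprK -scalerDr scaler_eq0 invr_eq0 pnatr_eq0 /=.
    by move=> /eqP ->.
  pose g (t : R) : R := (f \o retr) (p + t *: (q - p)).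
  have dg (t : R) : is_derive t (1 : R) g 0.
    have [d1 d2] := retr_comp_flat (q - p) sf f0 (c0 t).
    by have := is_derive_line d1; rewrite d2.
  have := is_derive_0_is_cst 0 1 dg.
  by rewrite /g scale0r addr0 scale1r addrC subrK /= !retr_S2R.
move=> p q Sp Sq; have [e|] := eqVneq (p.1 + q.1) 0; last exact: step.
have [x [px xx]] := exists_unit_orthogonal Sp.
have Sr : S2R (x, 0 : R^o) by exact: xx.
have qE : q.1 = - p.1 by apply/eqP; rewrite -addr_eq0 addrC e.
apply: (@etrans _ _ (f (x, 0 : R^o))); apply: step => //=.
  apply/negP => /eqP /(congr1 (dotp x)); rewrite dotpDr (dotpC x p.1) px xx add0r dotp0r => /eqP.
  by rewrite oner_eq0.
rewrite qE; apply/negP => /eqP /(congr1 (dotp x)); rewrite dotpDr dotpNr (dotpC x p.1) px xx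
  subr0 dotp0r => /eqP.
by rewrite oner_eq0.
Qed.

Lemma structure_classification (T : amb -> amb -> amb -> amb) : homogeneous_structure T ->
  exists c : R, forall p u v, S2R p -> tangent p u -> tangent p v -> T p u v = (c * u.2) *: J p v.
Proof.
move=> hT; have [e2 Sb] : exists e : 'cV[R]_3, dotp e e = 1.
  by exists (delta_mx 0 0); rewrite !vec3E /=; ring.
exists (weight T (e2, 0) dy_vec) => p u v Sp tu tv.
rewrite structure_form // weight_vertical // mulrC; congr ((_ * _) *: _).
have Se : S2R (e2, 0 : R^o) by exact: Sb.
by apply: (flat_constant (smooth_weight_dy hT)) => // p' v' Sp'; exact: der_weight_dy.
Qed.

End Constancy.

(** * Isometries and uniqueness of the parameter *)

Section Isometries.
Context {R : realType}.
Local Notation amb := (ambient R).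
Local Notation fields := (amb -> amb).
Local Notation tensor := (amb -> amb -> amb -> amb).
Implicit Types (p q z u v : amb) (phi psi : fields).

(** A linear map of the ambient space is a sum of coordinates times fixed vectors; the case k = 0
    also supplies its continuity. *)
Lemma Ck_affine k (L : {linear amb -> amb}) (c : amb) : Ck k setT (fun q => L q + c).
Proof.
have H : Ck k setT (fun q : amb => L q).
  apply: (@Ck_ext _ _ _ _ _ (fun q : amb => \sum_i crd i q *: L (bas i))); first exact: openT.
    by move=> q _; rewrite [in RHS](crd_sum q) linear_sum; apply: eq_bigr => i _; rewrite linearZ.
  apply: Ck_sum; first exact: openT.
  by move=> i; apply: Ck_Zl; [exact: openT|exact: Ck_crd openT].
exact: CkD openT H (Ck_cst _ _ _).
Qed.

Lemma smooth_affine (L : {linear amb -> amb}) (c : amb) : smooth_S2R (fun q => L q + c).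
Proof. by apply: smooth_S2R_global => k; exact: Ck_affine. Qed.

Lemma der_affine (L : {linear amb -> amb}) (c : amb) p v : S2R p -> tangent p v ->
  der (fun q => L q + c) p v = L v.
Proof.
move=> Sp tv.
have cL : continuous L.
  move=> x; have := @Ck_affine 0 L 0 x I.
  by rewrite (_ : (fun q => L q + 0) = L) //; apply/funext => q; rewrite addr0.
have dL : differentiable L p by exact: linear_differentiable.
have dLc : differentiable ((L : amb -> amb) + cst c) p.
  by apply: differentiableD => //; exact: differentiable_cst.
rewrite (der_extension (F := (L : amb -> amb) + cst c) Sp openT) //.
rewrite deriveD; [|exact: diff_derivable|exact: derivable_cst].
by rewrite derive_cst addr0 -[L : amb -> amb]/(L \o id) derive_lin // derive_id.
Qed.

Lemma der_tangent phi p v : smooth_S2R phi -> (forall q, S2R q -> S2R (phi q)) ->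
  S2R p -> tangent (phi p) (der phi p v).
Proof.
move=> sphi Sphi Sp.
have := der_dotp v sphi sphi Sp.
rewrite (der_ext (g := fun=> 1 : R^o) _ Sp); last by move=> q /Sphi.
rewrite der_cst dotpC => e; apply: addrr_eq0; exact: esym e.
Qed.

Lemma derive_chain (U V W : normedModType R) (f : U -> V) (g : V -> W) (x v : U) :
  differentiable f x -> differentiable g (f x) -> 'D_v (g \o f) x = 'D_('D_v f x) g (f x).
Proof.
move=> df dg; rewrite !deriveE //; last exact: differentiable_comp.
by rewrite (diff_comp df dg).
Qed.

(** The inner [retr] acts trivially because psi already lands in the submanifold, so this is the
    ambient chain rule. *)
Lemma der_comp phi psi p v : smooth_S2R phi -> smooth_S2R psi ->
  (forall q, S2R q -> S2R (psi q)) -> S2R p ->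
  der phi (psi p) (der psi p v) = der (phi \o psi) p v.
Proof.
move=> sphi spsi Spsi Sp.
have d1 := differentiable_retr_comp spsi Sp.
have d2 : differentiable (phi \o retr) ((psi \o retr) p).
  by rewrite /= retr_S2R //; exact: differentiable_retr_comp sphi (Spsi p Sp).
have n1 : \forall y \near p, ((phi \o retr) \o (psi \o retr)) y = ((phi \o psi) \o retr) y.
  apply: filterS (near_dotp_gt0 (S2R_gt0 Sp)) => y y0 /=.
  by rewrite (retr_S2R (Spsi _ (S2R_retr y0))).
have E : psi p = (psi \o retr) p by rewrite /= retr_S2R.
apply: etrans (near_eq_derive v n1); apply: etrans (esym (derive_chain v d1 d2)).
by rewrite /der {1}E.
Qed.

Definition flip (p : amb) : amb := (p.1, - p.2).

Fact flip_is_linear : linear flip.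
Proof. by move=> a u v; rewrite /flip; congr pair; rewrite /= scalerN opprD. Qed.

HB.instance Definition _ := GRing.isLinear.Build R amb amb _ flip flip_is_linear.

Lemma smooth_flip : smooth_S2R flip.
Proof.
have -> : flip = (fun q => flip q + 0) by apply/funext => q; rewrite addr0.
exact: (smooth_affine flip).
Qed.

Lemma der_flip p v : S2R p -> tangent p v -> der flip p v = flip v.
Proof.
move=> Sp tv; have -> : flip = (fun q => flip q + 0) by apply/funext => q; rewrite addr0.
by rewrite (der_affine flip) // addr0.
Qed.

Lemma isometry_id : Defs.isometry (@id amb).
Proof.
split=> //; first exact: smooth_S2R_id.
  by exists id; split => //; exact: smooth_S2R_id.
by move=> p u v Sp tu tv; rewrite !der_id.
Qed.

Lemma isometry_flip : Defs.isometry flip.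
Proof.
split=> //; first exact: smooth_flip.
  exists flip; split => //; first exact: smooth_flip.
    by case=> a b _; rewrite /flip /= opprK.
  by case=> a b _; rewrite /flip /= opprK.
by move=> p u v Sp tu tv; rewrite !der_flip // /metric /= mulrNN.
Qed.

Lemma isomorphic_Tlam (s : bool) (T : tensor) : homogeneous_structure T ->
  exists2 lam : R, 0 <= lam & isomorphic T (Tlam s lam).
Proof.
move=> hT; have [c Tc] := structure_classification hT.
have ss : (-1) ^+ s * (-1) ^+ s = 1 :> R by rewrite -expr2 sqrr_sign.
(* [Tlam s lam] is lam (-1)^s dy times J, so c (-1)^s is the parameter of T for the orientation s.
   Its sign decides between the identity and the reflection of the line. *)
have [c0|c0] := leP 0 (c * (-1) ^+ s).
  exists (c * (-1) ^+ s) => //; exists id; first exact: isometry_id.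
  move=> X Y vX vY p Sp; have tX := vfield_tangent vX Sp; have tY := vfield_tangent vY Sp.
  have [[_ tT _ _] _ _ _] := homogeneous_structureE hT.
  rewrite !der_id //; last by have [[_ _ H _] _ _ _] := homogeneous_structureE hT; exact: H.
  rewrite TlamE Tc //; congr (_ *: _).
  by rewrite mulrAC -[c * _ * _]mulrA ss mulr1.
exists (- (c * (-1) ^+ s)); first by rewrite oppr_ge0 ltW.
exists flip; first exact: isometry_flip.
move=> X Y vX vY p Sp; have tX := vfield_tangent vX Sp; have tY := vfield_tangent vY Sp.
rewrite !der_flip //; last by have [[_ _ H _] _ _ _] := homogeneous_structureE hT; exact: H.
rewrite TlamE Tc // linearZ /=.
have -> : flip (J p (Y p)) = J (flip p) (flip (Y p)) by rewrite /flip /J /= oppr0.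
congr (_ *: _).
have aux (a b d : R) : d * d = 1 -> a * b = - (a * d) * - b * d.
  by move=> dd; rewrite mulrNN mulrAC -[a * d * d]mulrA dd mulr1.
exact: aux.
Qed.

Lemma metric_Tlam (s : bool) (lam : R) q u v : S2R q -> tangent q v ->
  metric (Tlam s lam q u v) (Tlam s lam q u v) = lam ^+ 2 * (u.2 ^+ 2 * dotp v.1 v.1).
Proof.
move=> Sq tv; rewrite TlamE metricZl metricC metricZl /metric /= mul0r addr0.
rewrite dotp_cross_cross //.
have aux (a b d e : R) : d ^+ 2 = 1 -> a * b * d * (a * b * d * e) = a ^+ 2 * (b ^+ 2 * e).
  move=> dd; have -> : a * b * d * (a * b * d * e) = d ^+ 2 * (a ^+ 2 * (b ^+ 2 * e)) by ring.
  by rewrite dd mul1r.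
by apply: aux; rewrite sqrr_sign.
Qed.

(** At p, vectors a and b are chosen whose images under phi are the vertical unit vector and a
    horizontal one, where T_a b has length lam. Their images under phi' are still unit vectors but
    of unknown inclination, so the same length is at most lam'. Exchanging the roles gives
    equality. *)
Lemma isomorphic_Tlam_le (s : bool) (T : tensor) (lam lam' : R) : tensor_field12 T ->
  0 <= lam -> 0 <= lam' -> isomorphic T (Tlam s lam) -> isomorphic T (Tlam s lam') -> lam <= lam'.
Proof.
move=> tT l0 l0' [phi [Sphi sphi [psi [Spsi spsi _ phipsi]] mphi] iphi].
move=> [phi' [Sphi' sphi' _ mphi'] iphi'].
have [e Se] : exists e : amb, S2R e.
  by exists (delta_mx 0 0, 0); rewrite /S2R /= !vec3E /=; ring.
have [x [ex xx]] := exists_unit_orthogonal Se.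
pose p := psi e; have Sp : S2R p by exact: Spsi.
have pe : phi p = e by exact: phipsi.
(* The differential of psi at e is a right inverse of the differential of phi at p. *)
have lift v : tangent e v -> exists2 u, tangent p u & der phi p u = v.
  move=> tv; exists (der psi e v); first exact: der_tangent.
  rewrite der_comp //.
  by rewrite (der_ext (g := id) _ Se) ?der_id // => q Sq /=; exact: phipsi.
have [a ta ea] := lift _ (tangent_dy e); have [b tb eb] := lift _ (tangent_frame1 ex).
pose X := fun q => tproj q a; pose Y := fun q => tproj q b.
have vX : vfield X by exact: vfield_const.
have vY : vfield Y by exact: vfield_const.
have Xp : X p = a by rewrite /X tproj_tangent.
have Yp : Y p = b by rewrite /Y tproj_tangent.
have tab : tangent p (T p a b) by exact: (tens_tangent tT).
have := iphi X Y vX vY p Sp; rewrite Xp Yp ea eb pe => E.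
have := iphi' X Y vX vY p Sp; rewrite Xp Yp => E'.
have m1 : metric (T p a b) (T p a b) = lam ^+ 2.
  rewrite -(mphi p) // E metric_Tlam //= xx; by rewrite expr1n !mulr1.
have tb' : tangent (phi' p) (der phi' p b) by exact: der_tangent.
have m2 : lam' ^+ 2 * ((der phi' p a).2 ^+ 2 * dotp (der phi' p b).1 (der phi' p b).1) = lam ^+ 2.
  by rewrite -m1 -(mphi' _ _ _ Sp tab tab) E' metric_Tlam //; exact: Sphi'.
have ma : metric (der phi' p a) (der phi' p a) = 1.
  by rewrite (mphi' _ _ _ Sp ta ta) -(mphi _ _ _ Sp ta ta) ea /metric /= dotp0r add0r mulr1.
have mb : metric (der phi' p b) (der phi' p b) = 1.
  by rewrite (mphi' _ _ _ Sp tb tb) -(mphi _ _ _ Sp tb tb) eb /metric /= xx mulr0 addr0.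
have a1 : (der phi' p a).2 ^+ 2 <= 1 by rewrite -ma /metric -expr2 lerDr dotp_ge0.
have b1 : dotp (der phi' p b).1 (der phi' p b).1 <= 1 by rewrite -mb /metric -expr2 lerDl sqr_ge0.
have : lam ^+ 2 <= lam' ^+ 2.
  rewrite -m2 ler_piMr ?sqr_ge0 //.
  apply: le_trans a1; rewrite ler_piMr //; exact: sqr_ge0.
by rewrite ler_sqr.
Qed.

Lemma classification (s : bool) (T : tensor) : homogeneous_structure T ->
  exists! lam : R, 0 <= lam /\ isomorphic T (Tlam s lam).
Proof.
move=> hT; have [tT _ _ _] := homogeneous_structureE hT.
have [lam l0 iT] := isomorphic_Tlam s hT; exists lam; split => // lam' [l0' iT'].
apply/eqP; rewrite eq_le; apply/andP; split.
  exact: (isomorphic_Tlam_le tT l0 l0' iT iT').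
exact: (isomorphic_Tlam_le tT l0' l0 iT' iT).
Qed.

End Isometries.

(** * The matrix exponential *)

Section MatrixExponential.
Context {R : realType}.
Implicit Types (A X : 'M[R]_3) (t x : R).

(* Coefficients, as a power series in t, of the entries of exp(tA) A^m. *)
Let cf (m : nat) A (i j : 'I_3) (k : nat) : R := (k`!%:R)^-1 * (A ^+ (k + m)) i j.

Lemma exprS_mxE A k i j : (A ^+ k.+1) i j = \sum_l (A ^+ k) i l * A l j.
Proof. by rewrite exprSr -[_ * A]/(_ *m A) mxE. Qed.

Lemma expr_mx_bound A : exists2 K, 0 <= K & forall k i j, `|(A ^+ k) i j| <= K ^+ k.
Proof.
pose K := 1 + \sum_l \sum_j `|A l j|.
have S0 : 0 <= \sum_l \sum_j `|A l j| by apply: sumr_ge0 => l _; exact: sumr_ge0.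
have K0 : 0 <= K by rewrite addr_ge0.
exists K => //; elim=> [|k ih] i j.
  by rewrite !expr0 -[1 : 'M[R]_3]/(1%:M) mxE; case: (i == j); rewrite ?normr1 ?normr0.
rewrite exprS_mxE; apply: le_trans (ler_norm_sum _ _ _) _.
apply: (@le_trans _ _ (\sum_l K ^+ k * `|A l j|)).
  by apply: ler_sum => l _; rewrite normrM ler_wpM2r.
rewrite -mulr_sumr exprSr ler_wpM2l ?exprn_ge0 //.
rewrite -[leLHS]add0r /K lerD // ler_sum // => l _.
by rewrite (bigD1 j) //= lerDl sumr_ge0.
Qed.

(** Dominated by K^m times the exponential series of K |x|. *)
Lemma cvg_cf m A i j x : cvgn (pseries (cf m A i j) x).
Proof.
have [K K0 HK] := expr_mx_bound A.
apply: normed_cvg.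
apply: (@series_le_cvg _ _ (fun k => K ^+ m * exp_coeff (K * `|x|) k)).
- by move=> n /=.
- by move=> n; rewrite mulr_ge0 ?exprn_ge0 //; apply: exp_coeff_ge0; rewrite mulr_ge0.
- move=> n /=; rewrite /cf /exp_coeff /= !normrM normrX.
  have f0 : 0 <= (n`!%:R : R)^-1 by rewrite invr_ge0.
  rewrite (ger0_norm f0).
  apply: (@le_trans _ _ ((n`!%:R)^-1 * K ^+ (n + m) * `|x| ^+ n)).
    by rewrite ler_wpM2r ?exprn_ge0 // ler_wpM2l.
  by rewrite exprD exprMn le_eqVlt; apply/orP; left; apply/eqP; ring.
apply: (is_cvg_seriesZ (f := exp_coeff (K * `|x|))); exact: is_cvg_series_exp_coeff.
Qed.

(** The reason for the index m: differentiating term by term, (k + 1) / (k + 1)! = 1 / k! leaves the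
    same coefficients with one more factor A. *)
Lemma pseries_diffs_cf m A i j : pseries_diffs (cf m A i j) = cf m.+1 A i j.
Proof.
apply/funext => k; rewrite /pseries_diffs /cf factS natrM addSnnS mulrA; congr (_ * _).
by rewrite invfM mulrA mulfV ?mul1r // pnatr_eq0.
Qed.

Lemma is_derive_cf m A i j x :
  is_derive x (1 : R) (fun x => limn (pseries (cf m A i j) x)) (limn (pseries (cf m.+1 A i j) x)).
Proof.
rewrite -pseries_diffs_cf; apply: (@pseries_snd_diffs _ _ (`|x| + 1));
  rewrite ?pseries_diffs_cf; try exact: cvg_cf.
by rewrite [ltRHS]ger0_norm ?addr_ge0 // ltrDl.
Qed.

Lemma limn_cf_succ A i j x :
  limn (pseries (cf 1 A i j) x) = \sum_l limn (pseries (cf 0 A i l) x) * A l j.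
Proof.
apply: cvg_lim => //.
have -> : pseries (cf 1 A i j) x = (fun n => \sum_l (pseries (cf 0 A i l) x n * A l j)).
  apply/funext => n; rewrite /pseries /series /=.
  under [RHS]eq_bigr do rewrite mulr_suml.
  rewrite exchange_big /=; apply: eq_bigr => k _.
  rewrite /cf addn1 exprS_mxE addn0 mulr_sumr mulr_suml; apply: eq_bigr => l _.
  ring.
rewrite sum3E; under eq_fun do rewrite sum3E.
by apply: cvgD; [apply: cvgD|]; apply: cvgM; first [exact: cvg_cf|exact: cvg_cst].
Qed.

Lemma cvg_mx (T : Type) (F : set_system T) (FF : Filter F) m n (f : T -> 'M[R]_(m,
  n)) (M : 'M[R]_(m, n)) :
  (forall i j, f x i j @[x --> F] --> M i j) -> f @ F --> M.
Proof.
move=> H; apply/cvgrPdist_le => /= e e0.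
near=> x.
rewrite /Num.Def.normr/= mx_normrE (bigmax_le _ (ltW e0))//= => i _.
rewrite !mxE/=.
move: i; near: x; apply: filter_forall => /= i.
exact: ((cvgrPdist_le _ _).1 (H i.1 i.2)).
Unshelve. all: by end_near. Qed.

Lemma expmE A t i j : expm (t *: A) i j = limn (pseries (cf 0 A i j) t).
Proof.
pose M : 'M[R]_3 := \matrix_(i, j) limn (pseries (cf 0 A i j) t).
suff -> : expm (t *: A) = M by rewrite mxE.
apply: cvg_lim => //; apply: cvg_mx => k l; rewrite mxE.
have -> : (fun n => (\sum_(k0 < n) (k0`!%:R)^-1 *: (t *: A) ^+ k0) k l) = pseries (cf 0 A k l) t.
  apply/funext => n; rewrite summxE /pseries /series /= big_mkord; apply: eq_bigr => h _.
  by rewrite mxE exprZn mxE /cf addn0 mulrCA mulrC.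
exact: cvg_cf.
Qed.

Lemma is_derive_expm A i j t :
  is_derive t (1 : R) (fun t => expm (t *: A) i j) ((expm (t *: A) *m A) i j).
Proof.
have -> : (fun t => expm (t *: A) i j) = (fun t => limn (pseries (cf 0 A i j) t)).
  by apply/funext => u; rewrite expmE.
rewrite mxE; under eq_bigr do rewrite expmE.
by rewrite -limn_cf_succ; exact: is_derive_cf.
Qed.

Lemma expm0 : expm (0 : 'M[R]_3) = 1%:M.
Proof.
apply: lim_near_cst => //; near=> n.
(* The partial sums equal 1 only from n = 1 on; the empty sum is 0. *)
have n0 : (0 < n)%N by near: n; exists 1%N.
rewrite -(prednK n0) big_ord_recl expr0 fact0 invr1 scale1r big1 ?addr0 // => i _.
by rewrite exprS mul0r scaler0.
Unshelve. all: by end_near. Qed.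

Lemma is_derive_sum3 (f df : 'I_3 -> R -> R) t :
  (forall i, is_derive t (1 : R) (f i) (df i t)) ->
  is_derive t (1 : R) (fun t => \sum_i f i t) (\sum_i df i t).
Proof.
move=> H; under eq_fun do rewrite sum3E.
rewrite sum3E; have h0 := H 0; have h1 := H 1; have h2 := H 2.
exact: (is_deriveD (is_deriveD h0 h1) h2).
Qed.

Lemma is_derive_mul (f g : R -> R) (df dg t : R) :
  is_derive t (1 : R) f df -> is_derive t (1 : R) g dg ->
  is_derive t (1 : R) (fun t => f t * g t) (f t * dg + g t * df).
Proof. by move=> Hf Hg; exact: is_deriveM. Qed.

(** Used in both directions: for skew A the derivative vanishes identically, and at t = 0 its value
    is A + A^T. *)
Lemma is_derive_expm_gram A i j t :
  is_derive t (1 : R) (fun t => (expm (t *: A) *m (expm (t *: A))^T) i j)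
    ((expm (t *: A) *m (A + A^T) *m (expm (t *: A))^T) i j).
Proof.
pose E t := expm (t *: A).
have dE k l : is_derive t (1 : R) (fun t => E t k l) ((E t *m A) k l) by exact: is_derive_expm.
have -> : (fun t => (E t *m (E t)^T) i j) = (fun t => \sum_l E t i l * E t j l).
  by apply/funext => u; rewrite mxE; apply: eq_bigr => l _; rewrite mxE.
have -> : (E t *m (A + A^T) *m (E t)^T) i j =
    \sum_l (E t i l * (E t *m A) j l + E t j l * (E t *m A) i l).
  rewrite mulmxDr mulmxDl mxE big_split /= addrC; congr (_ + _).
    have -> : E t *m A^T *m (E t)^T = E t *m (E t *m A)^T by rewrite trmx_mul mulmxA.
    by rewrite mxE; apply: eq_bigr => l _; rewrite mxE.
  by rewrite mxE; apply: eq_bigr => l _; rewrite [(E t)^T l j]mxE mulrC.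
apply: (@is_derive_sum3 (fun l t => E t i l * E t j l)
  (fun l t => E t i l * (E t *m A) j l + E t j l * (E t *m A) i l)) => l.
exact: is_derive_mul (dE i l) (dE j l).
Qed.

Lemma expm_orthogonal A : A^T = - A -> expm A *m (expm A)^T = 1%:M.
Proof.
move=> sA; apply/matrixP => i j.
pose g (t : R) : R := (expm (t *: A) *m (expm (t *: A))^T) i j.
have dg (t : R) : is_derive t (1 : R) g 0.
  by have := is_derive_expm_gram A i j t; rewrite sA subrr mulmx0 mul0mx mxE.
have := is_derive_0_is_cst 1 0 dg.
by rewrite /g scale1r scale0r expm0 trmx1 mulmx1.
Qed.

Lemma skew_of_orthogonal A : (forall t, expm (t *: A) *m (expm (t *: A))^T = 1%:M) -> A^T = - A.
Proof.
move=> H; apply/matrixP => i j; rewrite !mxE; apply/eqP; rewrite -addr_eq0; apply/eqP.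
have d := is_derive_expm_gram A i j 0.
have c : (fun t => (expm (t *: A) *m (expm (t *: A))^T) i j) = (fun=> (1%:M : 'M[R]_3) i j).
  by apply/funext => t; rewrite H.
rewrite c scale0r expm0 mul1mx trmx1 mulmx1 !mxE in d.
have := @derive_val _ _ _ _ _ _ _ d.
by rewrite derive_cst addrC => /esym.
Qed.

Lemma det3E (M : 'M[R]_3) : \det M =
  M 0 0 * (M 1 1 * M 2 2 - M 1 2 * M 2 1) - M 0 1 * (M 1 0 * M 2 2 - M 1 2 * M 2 0)
  + M 0 2 * (M 1 0 * M 2 1 - M 1 1 * M 2 0).
Proof.
rewrite (expand_det_row _ ord0).
rewrite !big_ord_recl !big_ord0 /cofactor !(expand_det_row _ ord0).
rewrite !big_ord_recl !big_ord0 /cofactor !det_mx11 !mxE /=.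
have e1 : lift ord0 ord0 = 1 :> 'I_3 by apply/val_inj.
have e2 : lift ord0 (lift ord0 ord0) = 2 :> 'I_3 by apply/val_inj.
have e2' : lift ord0 (lift ord0 0) = 2 :> 'I_3 by apply/val_inj.
have e3 : lift 1 ord0 = 0 :> 'I_3 by apply/val_inj.
have e4 : lift 2 ord0 = 0 :> 'I_3 by apply/val_inj.
have e5 : lift 1 (lift ord0 0) = 2 :> 'I_3 by apply/val_inj.
have e6 : lift 2 (lift ord0 0) = 1 :> 'I_3 by apply/val_inj.
have e0 : ord0 = 0 :> 'I_3 by apply/val_inj.
have e7 : lift (lift ord0 ord0) 0 = 0 :> 'I_2 by apply/val_inj.
have e8 : lift 0 0 = 1 :> 'I_3 by apply/val_inj.
have e9 : lift 1 0 = 0 :> 'I_3 by apply/val_inj.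
have e10 : lift 2 0 = 0 :> 'I_3 by apply/val_inj.
rewrite ?e2' ?e2 ?e1 ?e3 ?e4 ?e5 ?e6 ?e0 ?e7 ?e8 ?e9 ?e10 /bump /=.
rewrite !(addn0, add0n, addn1, expr0, expr1, sqrrN, expr1n, sqrr_sign) /=.
ring.
Qed.

Lemma expm_entry_continuous A i j : continuous (fun t => expm (t *: A) i j : R).
Proof.
move=> t; apply: differentiable_continuous; apply/derivable1_diffP.
by have [] := is_derive_expm A i j t.
Qed.

(** Orthogonality leaves only the values 1 and -1. The determinant of exp(tA) is continuous in t and
    starts at 1, so reaching -1 would force a zero in between. *)
Lemma det_expm_skew A : A^T = - A -> \det (expm A) = 1.
Proof.
move=> sA; pose d (t : R) : R := \det (expm (t *: A)).
have d2 t : d t ^+ 2 = 1.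
  have sT : (t *: A)^T = - (t *: A) by rewrite linearZ /= sA scalerN.
  have := congr1 determinant (expm_orthogonal sT).
  by rewrite det_mulmx det_tr det1 expr2.
have d0 : d 0 = 1 by rewrite /d scale0r expm0 det1.
have cd : continuous d.
  have c (i j : 'I_3) : continuous (fun t => expm (t *: A) i j : R)
    by exact: expm_entry_continuous.
  rewrite /d; under eq_fun do rewrite det3E.
  have cM (f g : R -> R) : continuous f -> continuous g -> continuous (fun t => f t * g t).
    by move=> Cf Cg t; exact: cvgM (Cf t) (Cg t).
  have cD (f g : R -> R) : continuous f -> continuous g -> continuous (fun t => f t + g t).
    by move=> Cf Cg t; exact: cvgD (Cf t) (Cg t).
  have cB (f g : R -> R) : continuous f -> continuous g -> continuous (fun t => f t - g t).
    by move=> Cf Cg t; exact: cvgB (Cf t) (Cg t).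
  apply: (cD); first apply: (cB).
  - by apply: (cM) => //; apply: (cB); apply: (cM).
  - by apply: (cM) => //; apply: (cB); apply: (cM).
  - by apply: (cM) => //; apply: (cB); apply: (cM).
have [d1|d1] := eqVneq (d 1) 1; first by move: d1; rewrite /d scale1r.
have {}d1 : d 1 = -1.
  by have /eqP := d2 1; rewrite -[1 in X in _ == X](expr1n _ 2) eqf_sqr (negbTE d1) /= => /eqP.
have [||u _ u0] := IVT (f := d) (v := 0) (@ler01 R).
- exact: continuous_subspaceT.
- by rewrite d0 d1 ge_min le_max lerN10 ler01 orbT.
have := d2 u; rewrite u0 expr0n /= => /esym/eqP; by rewrite oner_eq0.
Qed.

(** Column j of the derivative exp(tA) A involves only column j of A, so column j of exp(tA) keeps
    its initial value. *)
Lemma expm_fix A (i j : 'I_3) : (forall k, A k j = 0) -> expm A i j = (i == j)%:R.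
Proof.
move=> A0; pose g (t : R) : R := expm (t *: A) i j.
have dg (t : R) : is_derive t (1 : R) g 0.
  have := is_derive_expm A i j t.
  by rewrite mxE big1 // => l _; rewrite A0 mulr0.
have := is_derive_0_is_cst 1 0 dg.
by rewrite /g scale1r scale0r expm0 mxE.
Qed.

Lemma fix_expm A (i j : 'I_3) : (forall t, expm (t *: A) i j = (i == j)%:R) -> A i j = 0.
Proof.
move=> H; have d := is_derive_expm A i j 0.
have c : (fun t => expm (t *: A) i j) = (fun=> (i == j)%:R) by apply/funext.
rewrite c scale0r expm0 mul1mx in d.
have := @derive_val _ _ _ _ _ _ _ d.
by rewrite derive_cst => /esym.
Qed.

End MatrixExponential.

(** * The group SO(3) x R *)

Section RotationGroup.
Context {R : realType}.
Local Notation amb := (ambient R).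
Local Notation group := ('M[R]_3 * R^o)%type.
Implicit Types (A B : 'M[R]_3) (a X Y : group) (x y : 'cV[R]_3).

Definition e3 : 'cV[R]_3 := delta_mx 2 0.

Lemma SO_tr_mul A : SO A -> A^T *m A = 1%:M.
Proof. by case=> /mulmx1C. Qed.

Lemma SO_mul A B : SO A -> SO B -> SO (A *m B).
Proof.
move=> [oA dA] [oB dB]; split; last by rewrite det_mulmx dA dB mulr1.
by rewrite trmx_mul mulmxA -(mulmxA A) oB mulmx1.
Qed.

Lemma SO_trmx A : SO A -> SO A^T.
Proof. by move=> soA; split; [rewrite trmxK; exact: SO_tr_mul|rewrite det_tr; case: soA]. Qed.

Lemma dotp_mx x y : dotp x y = (x^T *m y) 0 0.
Proof. by rewrite mxE; apply: eq_bigr => i _; rewrite mxE. Qed.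

Lemma dotp_SO A x y : SO A -> dotp (A *m x) (A *m y) = dotp x y.
Proof. by move=> soA; rewrite !dotp_mx trmx_mul mulmxA -(mulmxA x^T) SO_tr_mul // mulmx1. Qed.

Lemma mulmx3E A x i : (A *m x) i 0 = A i 0 * x 0 0 + A i 1 * x 1 0 + A i 2 * x 2 0.
Proof. by rewrite mxE sum3E. Qed.

Lemma mulmx33E A B i j : (A *m B) i j = A i 0 * B 0 j + A i 1 * B 1 j + A i 2 * B 2 j.
Proof. by rewrite mxE sum3E. Qed.

(** The cofactor identity, in which A^T maps the cross product of A x and A y to det A times that of
    x and y, holds for all matrices; here A^T is the inverse of A and det A = 1. *)
Lemma cross_SO A x y : SO A -> cross (A *m x) (A *m y) = A *m cross x y.
Proof.
move=> soA; have [oA dA] := soA.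
have E : A^T *m cross (A *m x) (A *m y) = \det A *: cross x y.
  apply: cV3P; rewrite mulmx3E ![_^T _ _]mxE [RHS]mxE !(cross0E, cross1E,
    cross2E) !mulmx3E det3E; ring.
by rewrite -[LHS]mul1mx -oA -mulmxA E dA scale1r.
Qed.

Lemma mulmx_e3 A i : (A *m e3) i 0 = A i 2.
Proof. by rewrite mulmx3E !mxE /= !mulr0 !add0r mulr1. Qed.

Lemma e3E i : e3 i 0 = (i == 2)%:R.
Proof. by rewrite mxE andbT. Qed.

Lemma fix_e3P A : A *m e3 = e3 <-> forall i, A i 2 = (i == 2)%:R.
Proof.
split=> [E i|E]; first by rewrite -mulmx_e3 E e3E.
by apply/matrixP => i j; rewrite ord1 mulmx_e3 E e3E.
Qed.

Lemma SO_fix_row A : SO A -> A *m e3 = e3 -> forall i, A 2 i = (i == 2)%:R.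
Proof.
move=> soA E i; have : A^T *m e3 = e3 by rewrite -{1}E mulmxA SO_tr_mul // mul1mx.
by move/fix_e3P => /(_ i); rewrite mxE.
Qed.

Lemma SO_block (B : 'M[R]_2) : SO (block_mx B 0 0 1%:M : 'M[R]_(2 + 1)) <-> SO B.
Proof.
rewrite /SO det_ublock det1 mulr1 tr_block_mx mulmx_block.
rewrite !trmx0 trmx1 !(mulmx0, mul0mx, mulmx1, addr0, add0r) (scalar_mx_block 2 1).
by split=> -[H ->]; split => //; [have [] := eq_block_mx H|rewrite H].
Qed.

Lemma block_last_col (B : 'M[R]_2) (i : 'I_(2 + 1)) :
  (block_mx B 0 0 1%:M : 'M[R]_(2 + 1)) i (rshift 2 0) = (i == rshift 2 0)%:R.
Proof.
rewrite -[i]splitK; case: (fintype.split i) => j /=; first by rewrite block_mxEur mxE eq_lrshift.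
by rewrite block_mxEdr mxE eq_rshift.
Qed.

Lemma two_rshift : 2 = rshift 2 (0 : 'I_1) :> 'I_3.
Proof. exact: val_inj. Qed.

(** A rotation fixing e3 has e3 as its last column and, its transpose fixing e3 as well, as its last
    row; it is therefore block diagonal. *)
Lemma SO2P a : SO2 a <-> [/\ a.2 = 0, SO a.1 & a.1 *m e3 = e3].
Proof.
case: a => A t; rewrite /SO2 /=; split.
  move=> [-> [B soB ->]]; split => //; first exact: (SO_block B).2.
  by apply/(fix_e3P _).2 => i; rewrite two_rshift; exact: block_last_col.
move=> [-> soA fA]; split => //.
have cA := (fix_e3P A).1 fA; have rA := SO_fix_row soA fA.
pose B : 'M[R]_2 := ulsubmx (A : 'M[R]_(2 + 1)).
have l2 (i : 'I_2) : (lshift 1 i == rshift 2 (0 : 'I_1)) = false by rewrite eq_lrshift.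
have EA : A = block_mx B 0 0 1%:M :> 'M[R]_(2 + 1).
  rewrite -[LHS](@submxK _ 2 1 2 1); congr block_mx.
  - by apply/matrixP => i j; rewrite !mxE !ord1 -two_rshift cA two_rshift l2.
  - by apply/matrixP => i j; rewrite !mxE !ord1 -two_rshift rA two_rshift l2.
  - by apply/matrixP => i j; rewrite !mxE !ord1 -two_rshift cA !eqxx.
exists B => //; apply/(SO_block B).1; by rewrite -EA.
Qed.

Lemma isotropy_SO3R : isotropy SO3R base_point = SO2 :> set group.
Proof.
apply/seteqP; split=> a.
  move=> [soA [fA tA]]; apply/SO2P; split => //.
  by move: tA; rewrite /= add0r.
move=> /SO2P[a2 soA fA]; split => //.
by rewrite /gact /base_point /= -/e3 fA a2 addr0.
Qed.

Lemma lie_SO3RP X : lie SO3R X <-> X.1^T = - X.1.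
Proof.
split=> [H|sX t].
  by apply: skew_of_orthogonal => t; have [] := H t.
have st : (t *: X.1)^T = - (t *: X.1) by rewrite linearZ /= sX scalerN.
by split; [exact: expm_orthogonal|exact: det_expm_skew].
Qed.

Lemma lie_SO2P X : lie SO2 X <-> [/\ X.1^T = - X.1, X.2 = 0 & forall i, X.1 i 2 = 0].
Proof.
split=> [H|[sX X2 X1] t].
  have H' t := (SO2P _).1 (H t); split.
  - by apply: skew_of_orthogonal => t; have [_ []] := H' t.
  - by have [] := H' 1; rewrite /= scale1r.
  - move=> i; apply: fix_expm => t.
    by have [_ _ /fix_e3P] := H' t; apply.
apply/SO2P; rewrite /gexp /= X2 scaler0.
have st : (t *: X.1)^T = - (t *: X.1) by rewrite linearZ /= sX scalerN.
split=> //; first by split; [exact: expm_orthogonal|exact: det_expm_skew].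
by apply/fix_e3P => i; apply: expm_fix => k; rewrite mxE X1 mulr0.
Qed.

Lemma fundE X (p : amb) : fund X p = (X.1 *m p.1, X.2).
Proof.
pose F (t : R) : amb := gact (gexp (t *: X)) p.
have dcst (c : R) : is_derive (0 : R) (1 : R) (fun=> c) 0 by exact: is_derive_cst.
have dF i : is_derive (0 : R) (1 : R) (fun t => entry i (F t)) (entry i (X.1 *m p.1, X.2)).
  case: i => [i|]; rewrite /entry /F /gact /gexp /=.
    under eq_fun do rewrite mxE.
    rewrite mxE; apply: (@is_derive_sum3 _ (fun l t => expm (t *: X.1) i l * p.1 l 0) (fun l _
      => X.1 i l * p.1 l 0)) => l.
    have := is_derive_mul (is_derive_expm X.1 i l 0) (dcst (p.1 l 0)).
    by rewrite scale0r expm0 mul1mx mulr0 add0r mulrC.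
  have := is_deriveD (dcst p.2) (is_derive_mul (is_derive_id (0 : R) (1 : R)) (dcst X.2)).
  by rewrite mulr0 !add0r mulr1.
rewrite /fund derive1E -/F.
have dFF : differentiable F 0.
  apply: differentiable_ambient => i; apply/derivable1_diffP.
  by have [] := dF i.
apply: entryP => i; rewrite /entry -derive_crd //.
exact: (@derive_val _ _ _ _ _ _ _ (dF i)).
Qed.

Lemma exists_rotation (p : 'cV[R]_3) : dotp p p = 1 -> exists2 A, SO A & A *m e3 = p.
Proof.
move=> pp; have [x [px xx]] := exists_unit_orthogonal pp.
(* The rows form a positively oriented orthonormal basis ending in p, so the transpose is a rotation
   with third column p. *)
pose B : 'M[R]_3 := \matrix_(i, j) ([:: x; cross p x; p]`_i) j 0.
have yy : dotp (cross p x) (cross p x) = 1 by rewrite dotp_cross_cross.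
have soB : SO B.
  split.
    apply/matrixP => i j; rewrite mxE.
    have -> : \sum_k B i k * B^T k j = dotp [:: x; cross p x; p]`_i [:: x; cross p x; p]`_j.
      by apply: eq_bigr => k _; rewrite !mxE.
    rewrite mxE; elim/ord3_case: i; elim/ord3_case: j => //=.
    - exact: dotp_cross_r.
    - by rewrite dotpC.
    - by rewrite dotpC dotp_cross_r.
    - by rewrite dotpC dotp_cross_l.
    - exact: dotp_cross_l.
  have BE i j : B i j = ([:: x; cross p x; p]`_i) j 0 by rewrite mxE.
  have -> : \det B = dotp p (cross x (cross p x)) by rewrite det3E !BE /= !vec3E; ring.
  by rewrite cross_cross xx scale1r (dotpC x p) px scale0r subr0.
exists B^T; first exact: SO_trmx.
by apply/matrixP => i j; rewrite ord1 mulmx_e3 2!mxE.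
Qed.

Lemma polar (c s : R) : c ^+ 2 + s ^+ 2 = 1 -> exists t, cos t = c /\ sin t = s.
Proof.
move=> cs.
have c1 : -1 <= c <= 1.
  rewrite -ler_norml -(@ler_sqr R) ?nnegrE // ?normr_ge0 // expr1n real_normK ?num_real //.
  by rewrite -cs lerDl sqr_ge0.
have sE : Num.sqrt (1 - c ^+ 2) = `|s| by rewrite -cs addrC addKr sqrtr_sqr.
have [s0|s0] := leP 0 s.
  by exists (acos c); rewrite acosK ?in_itv //= sin_acos // sE ger0_norm.
by exists (- acos c); rewrite cosN sinN acosK ?in_itv //= sin_acos // sE ltr0_norm // opprK.
Qed.

Definition rz (t : R) : 'M[R]_3 := \matrix_(i, j)
  (nth [::] [:: [:: cos t; - sin t; 0]; [:: sin t; cos t; 0]; [:: 0; 0; 1]] i)`_j.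

Definition ry (t : R) : 'M[R]_3 := \matrix_(i, j)
  (nth [::] [:: [:: cos t; 0; sin t]; [:: 0; 1; 0]; [:: - sin t; 0; cos t]] i)`_j.

Lemma SO_rz t : SO (rz t).
Proof.
have E := cos2Dsin2 t; rewrite !expr2 in E.
split; last by rewrite det3E !mxE /= -[RHS]E; ring.
apply/matrixP => i j; rewrite mulmx33E.
by elim/ord3_case: i; elim/ord3_case: j; rewrite !mxE /=; first [ring|rewrite -[RHS]E; ring].
Qed.

Lemma SO_ry t : SO (ry t).
Proof.
have E := cos2Dsin2 t; rewrite !expr2 in E.
split; last by rewrite det3E !mxE /= -[RHS]E; ring.
apply/matrixP => i j; rewrite mulmx33E.
by elim/ord3_case: i; elim/ord3_case: j; rewrite !mxE /=; first [ring|rewrite -[RHS]E; ring].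
Qed.

Lemma rz0 : rz 0 = 1%:M.
Proof.
by apply/matrixP => i j; rewrite !mxE; elim/ord3_case: i; elim/ord3_case: j;
  rewrite /= ?cos0 ?sin0 ?oppr0.
Qed.

Lemma ry0 : ry 0 = 1%:M.
Proof.
by apply/matrixP => i j; rewrite !mxE; elim/ord3_case: i; elim/ord3_case: j;
  rewrite /= ?cos0 ?sin0 ?oppr0.
Qed.

Lemma SO_fix_rz B : SO B -> B *m e3 = e3 -> exists t, B = rz t.
Proof.
move=> soB fB; have [oB dB] := soB.
have cB := (fix_e3P B).1 fB; have rB := SO_fix_row soB fB.
have c0 : B 0 2 = 0 := cB 0. have c1 : B 1 2 = 0 := cB 1. have c2 : B 2 2 = 1 := cB 2.
have r0 : B 2 0 = 0 := rB 0. have r1 : B 2 1 = 0 := rB 1.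
have o i j : \sum_k B i k * B j k = (1%:M : 'M[R]_3) i j.
  by rewrite -oB mxE; apply: eq_bigr => k _; rewrite mxE.
have o00 := o 0 0; have o01 := o 0 1; move: dB o00 o01.
rewrite !sum3E det3E !mxE /= c0 c1 c2 r0 r1 !(mulr0, mul0r, mulr1, subr0, addr0).
set a := B 0 0; set b := B 0 1; set c := B 1 0; set d := B 1 1 => dB o00 o01.
have da : d = a.
  have -> : d = d * (a * a + b * b) by rewrite o00 mulr1.
  have -> : d * (a * a + b * b) = a * (a * d - b * c) + b * (a * c + b * d) by ring.
  by rewrite dB o01 mulr1 mulr0 addr0.
have cb : c = - b.
  have -> : c = c * (a * a + b * b) by rewrite o00 mulr1.
  have -> : c * (a * a + b * b) = a * (a * c + b * d) - b * (a * d - b * c) by ring.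
  by rewrite dB o01 mulr1 mulr0 sub0r.
have [t [ct st]] : exists t, cos t = a /\ sin t = c by apply: polar; rewrite cb sqrrN !expr2.
exists t; apply/matrixP => i j; rewrite mxE.
by elim/ord3_case: i; elim/ord3_case: j; rewrite /= ?ct ?st -?/a -?/b -?/c -?/d ?cb ?opprK.
Qed.

(** Spherical coordinates t, u of A e3 give a rotation [rz t *m ry u] with the same effect on e3.
    The remaining factor fixes e3 and is a rotation about that axis. *)
Lemma euler_angles A : SO A -> exists t u w, A = rz t *m ry u *m rz w.
Proof.
move=> soA.
pose v := A *m e3.
have vv : dotp v v = 1 by rewrite dotp_SO // !vec3E /=; ring.
move: vv; rewrite dotpE; set a := v 0 0; set b := v 1 0; set c := v 2 0 => vv.
pose r := Num.sqrt (a ^+ 2 + b ^+ 2).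
have ab0 : 0 <= a ^+ 2 + b ^+ 2 by rewrite addr_ge0 ?sqr_ge0.
have r2 : r ^+ 2 = a ^+ 2 + b ^+ 2 by rewrite sqr_sqrtr.
have [u [cu su]] : exists u, cos u = c /\ sin u = r.
  by apply: polar; rewrite r2 -vv !expr2; ring.
have [t [ct st]] : exists t, cos t * r = a /\ sin t * r = b.
  (* At a pole the azimuth is undetermined, and 0 is taken. *)
  have [r0|r0] := eqVneq r 0.
    exists 0; rewrite r0 !mulr0; move: r2; rewrite r0 expr0n /= => /esym/eqP.
    by rewrite paddr_eq0 ?sqr_ge0 // !sqrf_eq0 => /andP[/eqP -> /eqP ->].
  have [t [ct st]] : exists t, cos t = a / r /\ sin t = b / r.
    by apply: polar; rewrite !expr_div_n -mulrDl -r2 mulfV // expf_neq0.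
  by exists t; rewrite ct st !divfK.
pose Q := rz t *m ry u; have soQ : SO Q by apply: SO_mul; [exact: SO_rz|exact: SO_ry].
have Qe : Q *m e3 = v.
  by apply: cV3P; rewrite mulmx_e3 mulmx33E ![rz _ _ _]mxE ![ry _ _ _]mxE /= !(mulr0, mul0r,
    mul1r, mulr1, addr0, add0r) ?su ?ct ?st ?cu.
have [w wE] : exists w, Q^T *m A = rz w.
  apply: SO_fix_rz; first by apply: SO_mul => //; exact: SO_trmx.
  by rewrite -mulmxA -/v -Qe mulmxA SO_tr_mul // mul1mx.
exists t, u, w; rewrite -wE mulmxA -/Q; have [-> _] := soQ; by rewrite mul1mx.
Qed.

(** Multiplying the Euler angles and the translation by t gives a curve from the identity to any
    given element. The group is the union of these curves, which all pass through the identity. *)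
Lemma connected_SO3R : connected (SO3R : set group).
Proof.
pose g (i : R * R * R * R) (t : R) : group :=
  (rz (t * i.1.1.1) *m ry (t * i.1.1.2) *m rz (t * i.1.2), t * i.2).
have -> : (SO3R : set group) = \bigcup_i (g i @` setT).
  apply/seteqP; split=> [[A y] /= soA|[A y] [[[[a b] c] d] _ [t _ /= [<- _]]]]; last first.
    by apply: SO_mul; [apply: SO_mul|]; [exact: SO_rz|exact: SO_ry|exact: SO_rz].
  have [a [b [c E]]] := euler_angles (soA : SO A).
  by exists (a, b, c, y) => //; exists 1 => //=; rewrite /g /= !mul1r -E.
apply: bigcup_connected.
  exists (1%:M, 0) => i _; exists 0 => //.
  by rewrite /g !mul0r rz0 ry0 !mulmx1.
move=> h _; apply: connected_continuous_connected; first exact/connected_intervalP.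
apply: continuous_subspaceT => t.
have cm (k u : R) : t * k @[t --> u] --> u * k by apply: cvgM; [exact: cvg_id|exact: cvg_cst].
have cc (k : R) : continuous (fun t : R => cos (t * k)).
  by move=> u; apply: continuous_comp; [exact: cm|exact: continuous_cos].
have cs (k : R) : continuous (fun t : R => sin (t * k)).
  by move=> u; apply: continuous_comp; [exact: cm|exact: continuous_sin].
have cz (k : R) (i j : 'I_3) : continuous (fun t : R => rz (t * k) i j).
  under eq_fun do rewrite mxE.
  elim/ord3_case: i; elim/ord3_case: j => /=; do ?[exact: cc|exact: cs|exact: cst_continuous].
  by move=> u; apply: continuousN; exact: cs.
have cy (k : R) (i j : 'I_3) : continuous (fun t : R => ry (t * k) i j).
  under eq_fun do rewrite mxE.
  elim/ord3_case: i; elim/ord3_case: j => /=; do ?[exact: cc|exact: cs|exact: cst_continuous].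
  by move=> u; apply: continuousN; exact: cs.
have cM (F G : R -> 'M[R]_3) : (forall i j, continuous (fun t => F t i j : R)) ->
   (forall i j, continuous (fun t => G t i j : R)) -> forall i j,
     continuous (fun t => (F t *m G t) i j : R).
  move=> cF cG i' j' u; under eq_fun do rewrite mulmx33E.
  apply: cvgD; [apply: cvgD|]; apply: cvgM; first [exact: cF|exact: cG].
have H1 : rz (u * h.1.1.1) *m ry (u * h.1.1.2) *m rz (u * h.1.2) @[u --> t] -->
    rz (t * h.1.1.1) *m ry (t * h.1.1.2) *m rz (t * h.1.2).
  by apply: cvg_mx => k l; exact: (cM _ _ (cM _ _ (cz h.1.1.1) (cy h.1.1.2)) (cz h.1.2) k l t).
exact: cvg_pair H1 (cm _ _).
Qed.

Definition linear_part a (p : amb) : amb := (a.1 *m p.1, p.2).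

Fact linear_part_is_linear a : linear (linear_part a).
Proof. by move=> c u v; rewrite /linear_part; congr pair; rewrite /= mulmxDr -scalemxAr. Qed.

HB.instance Definition _ a := GRing.isLinear.Build R amb amb _ (linear_part a)
  (linear_part_is_linear a).

Lemma gactE a : gact a = (fun p => linear_part a p + (0, a.2)).
Proof. by apply/funext => p; rewrite /gact /linear_part; congr pair; rewrite /= addr0. Qed.

Lemma der_gact a (p v : amb) : S2R p -> tangent p v -> der (gact a) p v = linear_part a v.
Proof. by move=> Sp tv; rewrite gactE (der_affine (linear_part a)). Qed.

Lemma smooth_gact a : smooth_S2R (gact a).
Proof. by rewrite gactE; exact: (smooth_affine (linear_part a)). Qed.

Lemma S2R_gact a (p : amb) : SO3R a -> S2R p -> S2R (gact a p).
Proof. by move=> soA; rewrite /S2R /gact /= dotp_SO. Qed.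

Lemma isometry_gact a : SO3R a -> Defs.isometry (gact a).
Proof.
move=> soA; have [oA _] := soA; split.
- by move=> p; exact: S2R_gact.
- exact: smooth_gact.
- exists (gact (a.1^T, - a.2)); split.
  + by move=> p; apply: S2R_gact; exact: SO_trmx.
  + exact: smooth_gact.
  + by case=> x t _; rewrite /gact /= mulmxA SO_tr_mul // mul1mx addrK.
  + by case=> x t _; rewrite /gact /= mulmxA oA mul1mx subrK.
- by move=> p u v Sp tu tv; rewrite !der_gact // /metric /= dotp_SO.
Qed.

Lemma transitive_SO3R : transitive_isometric (SO3R : set group).
Proof.
split; first exact: isometry_gact.
move=> [x t] [y u] Sp Sq.
have [A soA Ax] := exists_rotation (Sp : dotp x x = 1).
have [B soB By] := exists_rotation (Sq : dotp y y = 1).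
exists (B *m A^T, u - t : R^o); first by apply: SO_mul => //; exact: SO_trmx.
by rewrite /gact /= -Ax mulmxA -(mulmxA B) SO_tr_mul // mulmx1 By addrC subrK.
Qed.

Lemma invariant_Tlam (s : bool) (lam : R) : Defs.invariant SO3R (Tlam s lam).
Proof.
move=> a p u v soA Sp tu tv; rewrite !der_gact //; last exact: (tens_tangent (Tlam_tensor s lam)).
by rewrite /Tlam /linear_part /gact /dy /= -scalemxAr cross_SO.
Qed.

(* The entry (1, 0) of a skew matrix is its component in so(2). *)
Definition complement (k : R) : set group := [set X | X.1^T = - X.1 /\ X.1 1 0 = k * X.2].

Lemma skewE A i j : A^T = - A -> A i j = - A j i.
Proof. by move=> /(congr1 (fun M : 'M[R]_3 => M j i)); rewrite !mxE. Qed.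

Lemma skew_diag A i : A^T = - A -> A i i = 0.
Proof. by move=> sA; apply: addrr_eq0; rewrite {1}(skewE i i sA) addNr. Qed.

Lemma reductive_complement (k : R) : reductive SO3R SO2 (complement k).
Proof.
split.
- split; first by split; rewrite ?mxE /= ?mulr0 ?trmx0 ?oppr0.
  move=> c [A t] [B u] [/= sA eA] [/= sB eB]; split => /=.
    by rewrite linearD linearZ /= sA sB scalerN opprD.
  by rewrite !mxE eA eB -[c *: t]/(c * t); ring.
- by move=> X [sX _]; apply/lie_SO3RP.
- apply/seteqP; split=> [[A t]|_ ->]; last first.
    split; first by split; rewrite ?mxE /= ?mulr0 ?trmx0 ?oppr0.
    by apply/lie_SO2P; split => //= [|i]; rewrite ?trmx0 ?oppr0 ?mxE.
  move=> [[/= sA e10] /lie_SO2P[/= _ t0 cA]]; congr pair => //.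
  have A10 : A 1 0 = 0 by rewrite e10 t0 mulr0.
  apply/matrixP => i j; rewrite mxE.
  elim/ord3_case: i; elim/ord3_case: j; rewrite ?cA ?A10 ?skew_diag //.
  + by rewrite skewE // A10 oppr0.
  + by rewrite skewE // cA oppr0.
  + by rewrite skewE // cA oppr0.
- move=> [A t] /lie_SO3RP /= sA.
  (* The excess of the so(2)-component over the value k t prescribed in the complement; N is c times
     the generator Z, with Z 1 0 = 1 and Z 0 1 = -1. *)
  pose c := A 1 0 - k * t.
  pose N : 'M[R]_3 := \matrix_(i, j) (c * ((i == 1) && (j == 0))%:R - c * ((i == 0) && (j ==
    1))%:R).
  have sN : N^T = - N by apply/matrixP => i j; rewrite !mxE opprB ![(i == _) && _]andbC.
  exists (A - N, t : R^o), (N, 0 : R^o); split.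
  + split; first by rewrite /= linearB /= sA sN opprB opprK addrC.
    by rewrite /= !mxE /= mulr0 mulr1 subr0 /c opprB addrC subrK.
  + by apply/lie_SO2P; split => //= i; rewrite mxE /= !andbF !mulr0 subr0.
  + by congr pair; rewrite /= ?subrK ?addr0.
- move=> [A u] [B t] /SO2P[/= _ soA fA] [/= sB eB].
  have [oA dA] := soA.
  have uA : A \in unitmx by rewrite unitmxE dA unitr1.
  have iA : invmx A = A^T by rewrite -[LHS]mulmx1 -oA mulmxA mulVmx // mul1mx.
  rewrite /Ad /= iA; split => /=; first by rewrite !trmx_mul trmxK sB mulNmx mulmxN mulmxA.
  have cA := (fix_e3P A).1 fA; have rA := SO_fix_row soA fA.
  have c0 : A 0 2 = 0 := cA 0. have c1 : A 1 2 = 0 := cA 1. have c2 : A 2 2 = 1 := cA 2.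
  have r0 : A 2 0 = 0 := rA 0. have r1 : A 2 1 = 0 := rA 1.
  have b00 := skew_diag 0 sB; have b11 := skew_diag 1 sB; have b01 := skewE 0 1 sB.
  (* Conjugation by a rotation about e3 multiplies the entry (1, 0) of a skew matrix by the
     determinant of the upper block, which is det A = 1. *)
  rewrite -eB -[RHS]mulr1 -dA det3E !mulmx33E ![_^T _ _]mxE c0 c1 c2 r0 r1 b00 b11 b01.
  by ring.
Qed.

(** Brackets of two rotations about horizontal axes lie in so(2) and vanish at the base point, so
    only the components k x Z, k y Z, k z Z contribute. There Z acts as J, and by its skewness the
    terms in y and z cancel while those in x add up to 2 k x <J(B e3), C e3>. Hence k = lam
    (-1)^s. *)
Lemma determined_Tlam (s : bool) (lam : R) : determined_by SO3R (complement (lam * (-1) ^+ s))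
  base_point (Tlam s lam).
Proof.
split; first exact: invariant_Tlam.
move=> [A x] [B y] [C z] [/= sA eA] [/= sB eB] [/= sC eC].
rewrite !fundE /Tlam /metric /gbracket /dy /= -/e3.
set k := lam * _ in eA eB eC *.
have -> : lam * x * (-1) ^+ s = k * x by rewrite /k mulrAC.
have zE (c : R) (v : 'cV[R]_3) i : (c *: v) i 0 = c * v i 0 by rewrite mxE.
have bE (M N : 'M[R]_3) i j : (M - N) i j = M i j - N i j by rewrite !mxE.
rewrite !dotpE !zE !(cross0E, cross1E, cross2E) !mulmx_e3 !e3E /= !bE !mulmx33E.
rewrite !(skew_diag _ sA) !(skew_diag _ sB) !(skew_diag _ sC).
rewrite !(skewE 0 1 sA) !(skewE 0 1 sB) !(skewE 0 1 sC) !(skewE 2 0 sA) !(skewE 2 0 sB) !(skewE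
  2 0 sC).
rewrite !(skewE 2 1 sA) !(skewE 2 1 sB) !(skewE 2 1 sC) eA eB eC.
by ring.
Qed.

Lemma coset_representation_Tlam (s : bool) (lam : R) : coset_representation SO3R SO2 base_point
  (Tlam s lam).
Proof.
split.
- exact: connected_SO3R.
- exact: transitive_SO3R.
- by split; [rewrite /S2R /= !vec3E /=; ring|exact: isotropy_SO3R].
- by exists (complement (lam * (-1) ^+ s)); split; [exact: reductive_complement|exact:
  determined_Tlam].
Qed.

End RotationGroup.

Theorem theorem1 (R : realType) (s : bool) :
  [/\ forall lam : R, 0 <= lam -> homogeneous_structure (Tlam s lam),
      forall T : ambient R -> ambient R -> ambient R -> ambient R,
        homogeneous_structure T ->
        exists! lam : R, 0 <= lam /\ isomorphic T (Tlam s lam) &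
      forall lam : R, 0 <= lam ->
        coset_representation SO3R SO2 base_point (Tlam s lam)].
Proof.
split.
- by move=> lam _; exact: Tlam_homogeneous.
- by move=> T; exact: classification.
- by move=> lam _; exact: coset_representation_Tlam.
Qed.
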